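(* Let $\mathbb{K}$ be a field, let $V$ be a finite-dimensional vector superspace over $\mathbb{K}$, and let $\delta_V=\mathrm{sdim}\,V$. There is a unique additive ($\mathbb{K}$-linear) covariant functor $F:\mathcal{OB}(\delta_V)\to\mathcal{T}_{\mathrm{GL}}(V)$ of pre-additive categories with the following properties: (i) $F$ sends the object $\eta\in\mathcal{N}$ to $V^\eta$ and a morphism $D\in\mathrm{Hom}(\eta,\eta')$ to $F(D):V^\eta\to V^{\eta'}$, where $F(D)$ is defined on the generators of the oriented Brauer diagrams by $$F(I^+)=\mathrm{id}_V,\quad F(I^-)=\mathrm{id}_{V^*},\quad F(X)=P,\quad F(U^+)=\check C^{+-},\quad F(U^-)=\check C^{-+},\quad F(A^+)=\hat C_{-+},\quad F(A^-)=\hat C_{+-};$$ (ii) $F$ respects tensor products, so that for any objects $\eta,\eta'$ and morphisms $D,D'$ in $\mathcal{OB}(\delta_V)$, $$F(\eta\otimes\eta')=V^\eta\otimes V^{\eta'}=F(\eta)\otimes F(\eta'),\qquad F(D\otimes D')=F(D)\otimes F(D').$$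
   Context: Oriented Brauer category. A $(k,\ell)$ Brauer diagram is a partition into pairs (arcs) of a set of $k+\ell$ nodes, $k$ on a lower horizontal line and $\ell$ on an upper one. An oriented Brauer diagram is a Brauer diagram with an orientation chosen on each arc. $\mathcal{N}$ is the set of all finite (possibly empty) sequences in $\{+,-\}$. The source of an oriented diagram is the sequence whose $p$-th entry is $+$ if the $p$-th bottom node is the end point (head) of its arc and $-$ if it is the starting point; the target is the sequence whose $q$-th entry is $+$ if the $q$-th top node is the starting point of its arc and $-$ if it is the end point (head). For $\delta\in\mathbb{K}$, $OB_s^t(\delta)$ is the free $\mathbb{K}$-module on the oriented Brauer diagrams with source $s$ and target $t$. Composition $D_1\circ D_2$ places $D_1$ above $D_2$ (when the target of $D_2$ equals the source of $D_1$), identifies nodes, and replaces every closed loop by a factor $\delta$ irrespective of orientation; tensor product is juxtaposition. $\mathcal{OB}(\delta)$ is the $\mathbb{K}$-linear tensor category with object set $\mathcal{N}$, $\mathrm{Hom}(\eta,\eta')=OB_\eta^{\eta'}(\delta)$, and tensor product of objects given by concatenation. Its morphisms are generated under composition and tensor product by: $I^+$, $I^-$ (single vertical arcs, identities of $(+)$ and $(-)$; $I^+$ is directed downwards), $X:(+,+)\to(+,+)$ (crossing with both arcs directed downwards), the caps $A^+:(-,+)\to\emptyset$, $A^-:(+,-)\to\emptyset$ and the cups $U^+:\emptyset\to(+,-)$, $U^-:\emptyset\to(-,+)$ (single arcs with the orientation determined by source/target). Representation category. $V=V_{\bar 0}\oplus V_{\bar 1}$, $\mathrm{sdim}\,V=\dim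 V_{\bar 0}-\dim V_{\bar 1}$, $[v]$ is the degree of homogeneous $v$. $\mathrm{GL}(V)$ is the general linear supergroup (affine group superscheme), acting naturally on $V$, on $V^*$ by $(g\cdot\bar w)(v)=\bar w(g^{-1}v)$, and diagonally on tensor products. $V^+=V$, $V^-=V^*$, and $V^\eta=V^{\varepsilon_1}\otimes\cdots\otimes V^{\varepsilon_r}$ for $\eta=(\varepsilon_1,\dots,\varepsilon_r)$, $V^\emptyset=\mathbb{K}$. $\mathcal{T}_{\mathrm{GL}}(V)$ is the full subcategory of $\mathrm{GL}(V)$-modules with objects $V^\eta$, $\eta\in\mathcal{N}$, with the usual tensor product. With $\{b_i\}$ a homogeneous basis of $V$ and $\{b_i^*\}$ the dual basis of $V^*$: $P:V\otimes V\to V\otimes V$, $v\otimes w\mapsto(-1)^{[v][w]}w\otimes v$; $\check C^{+-}:\mathbb{K}\to V\otimes V^*$, $1\mapsto\sum_i b_i\otimes b_i^*$; $\check C^{-+}:\mathbb{K}\to V^*\otimes V$, $1\mapsto\sum_i(-1)^{[b_i]}b_i^*\otimes b_i$; $\hat C_{-+}:V^*\otimes V\to\mathbb{K}$, $\bar w\otimes v\mapsto\bar w(v)$; $\hat C_{+-}:V\otimes V^*\to\mathbb{K}$, $v\otimes\bar w\mapsto(-1)^{[v][\bar w]}\bar w(v)$. *)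

(* Defs.v *)
From HB Require Import structures.
From mathcomp Require Import all_boot all_algebra.
From mathcomp Require Import boolp.

Set Implicit Arguments.
Unset Strict Implicit.
Unset Printing Implicit Defensive.

Import GRing.Theory.
Local Open Scope ring_scope.

(* A sequence of signs: [true] stands for +, [false] for -. *)
Notation signs := (seq bool).

Section Positions.
Variables s1 s2 : signs.
Definition lpos (i : 'I_(size s1)) : 'I_(size (s1 ++ s2)) :=
  cast_ord (esym (size_cat s1 s2)) (lshift (size s2) i).
Definition rpos (i : 'I_(size s2)) : 'I_(size (s1 ++ s2)) :=
  cast_ord (esym (size_cat s1 s2)) (rshift (size s1) i).

Lemma lpos_inj : injective lpos.
Proof. by move=> i j /cast_ord_inj /lshift_inj. Qed.

Lemma rpos_inj : injective rpos.
Proof. by move=> i j /cast_ord_inj /rshift_inj. Qed.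

Lemma lrpos i j : (lpos i == rpos j) = false.
Proof.
by apply/eqP => /(congr1 val) /= E; move: (ltn_ord i); rewrite E ltnNge leq_addr.
Qed.

Variant pos_spec : 'I_(size (s1 ++ s2)) -> Type :=
| PosL i : pos_spec (lpos i)
| PosR i : pos_spec (rpos i).

Lemma posP i : pos_spec i.
Proof.
have -> : i = cast_ord (esym (size_cat s1 s2)) (cast_ord (size_cat s1 s2) i).
  by rewrite cast_ordK.
by case: (split_ordP (cast_ord (size_cat s1 s2) i)) => j ->; [left | right].
Qed.

Lemma nth_lpos b i : nth b (s1 ++ s2) (lpos i) = nth b s1 i.
Proof. by rewrite nth_cat /= ltn_ord. Qed.

Lemma nth_rpos b i : nth b (s1 ++ s2) (rpos i) = nth b s2 i.
Proof. by rewrite nth_cat /= ltnNge leq_addr /= addKn. Qed.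
End Positions.

Arguments lpos {s1} s2 i.
Arguments rpos s1 {s2} i.

(* [inl i] is the i-th bottom node and [inr j] the j-th top node. *)
Notation node k l := ('I_k + 'I_l)%type.

(* An oriented arc is the pair (starting point, end point). *)
Definition incident (T : finType) (x : T) (a : T * T) : bool :=
  (a.1 == x) || (a.2 == x).

Definition is_odiag k l (D : {set node k l * node k l}) : bool :=
  [forall a in D, a.1 != a.2] &&
  [forall x, #|[set a in D | incident x a]| == 1%N].

Definition odiag k l := {D : {set node k l * node k l} | is_odiag D}.

Definition arcs k l (D : odiag k l) : {set node k l * node k l} := val D.

Definition is_start k l (D : odiag k l) x := [exists a in arcs D, a.1 == x].
Definition is_end k l (D : odiag k l) x := [exists a in arcs D, a.2 == x].

Definition source k l (D : odiag k l) : signs :=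
  [seq is_end D (inl i) | i <- enum 'I_k].
Definition target k l (D : odiag k l) : signs :=
  [seq is_start D (inr j) | j <- enum 'I_l].

Definition obdiag (s t : signs) :=
  {D : odiag (size s) (size t) | (source D == s) && (target D == t)}.

Definition obarcs s t (D : obdiag s t) := arcs (val D).

(* Whether a node must be a starting point, as prescribed by the signs. *)
Definition starts (s t : signs) (x : node (size s) (size t)) : bool :=
  match x with inl i => ~~ nth true s i | inr j => nth true t j end.
Arguments starts : clear implicits.

Lemma odiag_exists k l (D : odiag k l) x :
  exists2 a, a \in arcs D & incident x a.
Proof.
case/andP: (valP D) => _ /forallP/(_ x)/cards1P[a E].
by exists a; move/setP/(_ a): E; rewrite !inE eqxx => /andP[].
Qed.

Lemma odiag_unique k l (D : odiag k l) x a b :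
  a \in arcs D -> b \in arcs D -> incident x a -> incident x b -> a = b.
Proof.
case/andP: (valP D) => _ /forallP/(_ x)/cards1P[c /setP E] aD bD xa xb.
by move: (E a) (E b); rewrite !inE aD bD xa xb => /esym/eqP-> /esym/eqP->.
Qed.

Lemma odiag_neq k l (D : odiag k l) a : a \in arcs D -> a.1 != a.2.
Proof. by case/andP: (valP D) => /forall_inP H _ /H. Qed.

Lemma is_startN k l (D : odiag k l) x : is_start D x = ~~ is_end D x.
Proof.
apply/idP/idP.
  case/exists_inP=> a aD /eqP ax; apply/exists_inP => -[b bD /eqP bx].
  have E : a = b by apply: (odiag_unique aD bD (x := x));
    rewrite /incident ?ax ?bx eqxx ?orbT.
  by move: (odiag_neq aD); rewrite {2}E ax bx eqxx.
have [a aD /orP[ax _|ax]] := odiag_exists D x; first by apply/exists_inP; exists a.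
by case/exists_inP; exists a.
Qed.

Lemma startsE s t (D : obdiag s t) x : starts s t x = is_start (val D) x.
Proof.
case/andP: (valP D) => /eqP Es /eqP Et; case: x => i /=.
  rewrite is_startN -{1}Es (nth_map i) ?size_enum_ord //; congr (~~ is_end _ _).
  by congr inl; apply: val_inj; rewrite /= nth_enum_ord.
rewrite -{1}Et (nth_map i) ?size_enum_ord //; congr (is_start _ _).
by congr inr; apply: val_inj; rewrite /= nth_enum_ord.
Qed.

Lemma obarcs_starts s t (D : obdiag s t) a :
  a \in obarcs D -> starts s t a.1 && ~~ starts s t a.2.
Proof.
move=> aD; rewrite !(startsE D) [in X in _ && X]is_startN negbK.
by apply/andP; split; apply/exists_inP; exists a.
Qed.

Section MkObdiag.
Variables (s t : signs).
Let N := node (size s) (size t).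
Variable A : {set N * N}.
Hypothesis Ast : forall a, a \in A -> starts s t a.1 && ~~ starts s t a.2.
Hypothesis Aex : forall x, exists2 a, a \in A & incident x a.
Hypothesis Aun : forall x a b,
  a \in A -> b \in A -> incident x a -> incident x b -> a = b.

Fact mk_is_odiag : is_odiag A.
Proof.
apply/andP; split.
  by apply/forall_inP => a /Ast; case: eqP => // ->; rewrite andbN.
apply/forallP => x; apply/cards1P; have [a aA xa] := Aex x; exists a.
apply/setP => b; rewrite !inE; apply/andP/eqP => [[bA xb]|->//].
exact: (Aun bA aA xb xa).
Qed.

Let D0 : odiag (size s) (size t) := Sub A mk_is_odiag.

Let D0start x : is_start D0 x = starts s t x.
Proof.
have [a aA xa] := Aex x; have /andP[a1 a2] := Ast aA.
case/orP: xa => /eqP Ex; rewrite -Ex.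
  by rewrite a1; apply/exists_inP; exists a.
by rewrite is_startN (negPf a2); apply/negbF/exists_inP; exists a.
Qed.

Fact mk_is_obdiag : (source D0 == s) && (target D0 == t).
Proof.
apply/andP; split; apply/eqP.
  apply: (@eq_from_nth _ true); first by rewrite size_map size_enum_ord.
  rewrite size_map size_enum_ord => i lt_i.
  rewrite (nth_map (Ordinal lt_i)) ?size_enum_ord //.
  rewrite -[LHS]negbK -is_startN D0start /= negbK.
  by congr (nth _ _ _); rewrite /= nth_enum_ord.
apply: (@eq_from_nth _ true); first by rewrite size_map size_enum_ord.
rewrite size_map size_enum_ord => i lt_i.
rewrite (nth_map (Ordinal lt_i)) ?size_enum_ord // D0start /=.
by congr (nth _ _ _); rewrite /= nth_enum_ord.
Qed.

Definition mk_obdiag : obdiag s t := Sub D0 mk_is_obdiag.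
Lemma mk_obdiagE : obarcs mk_obdiag = A. Proof. by []. Qed.
End MkObdiag.

Section Identity.
Variable s : signs.
Let N := node (size s) (size s).

Definition id_arc (i : 'I_(size s)) : N * N :=
  if nth true s i then (inr i, inl i) else (inl i, inr i).
Definition id_arcs : {set N * N} := [set id_arc i | i : 'I_(size s)].

Let id_incident (x : N) i :
  incident x (id_arc i) = (i == match x with inl j => j | inr j => j end).
Proof.
by rewrite /incident /id_arc; case: x => j; case: (nth _ _ _); rewrite /= ?orbF.
Qed.

Fact id_arcs_starts a : a \in id_arcs -> starts s s a.1 && ~~ starts s s a.2.
Proof.
by case/imsetP=> i _ ->; rewrite /id_arc; case E: (nth _ _ _); rewrite /= E.
Qed.

Fact id_arcs_exists x : exists2 a, a \in id_arcs & incident x a.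
Proof.
exists (id_arc match x with inl j => j | inr j => j end); first exact: imset_f.
by rewrite id_incident.
Qed.

Fact id_arcs_unique x a b :
  a \in id_arcs -> b \in id_arcs -> incident x a -> incident x b -> a = b.
Proof.
case/imsetP=> i _ -> /imsetP[j _ ->]; rewrite !id_incident.
by move=> /eqP-> /eqP->.
Qed.

Definition id_diag : obdiag s s :=
  mk_obdiag id_arcs_starts id_arcs_exists id_arcs_unique.
End Identity.

Lemma inlI A B : injective (@inl A B). Proof. by move=> x y []. Qed.
Lemma inrI A B : injective (@inr A B). Proof. by move=> x y []. Qed.

Section TensorDiagram.
Variables (s1 t1 s2 t2 : signs).
Let N := node (size (s1 ++ s2)) (size (t1 ++ t2)).

Definition lnode (x : node (size s1) (size t1)) : N :=
  match x with inl i => inl (lpos s2 i) | inr j => inr (lpos t2 j) end.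
Definition rnode (x : node (size s2) (size t2)) : N :=
  match x with inl i => inl (rpos s1 i) | inr j => inr (rpos t1 j) end.

Variables (D1 : obdiag s1 t1) (D2 : obdiag s2 t2).

Definition tens_arcs : {set N * N} :=
  [set (lnode a.1, lnode a.2) | a in obarcs D1] :|:
  [set (rnode a.1, rnode a.2) | a in obarcs D2].

Let lnode_inj : injective lnode.
Proof.
move=> [] i [] j //=.
  by move=> E; congr inl; apply: (@lpos_inj s1 s2); apply: (@inlI _ _ _ _ E).
by move=> E; congr inr; apply: (@lpos_inj t1 t2); apply: (@inrI _ _ _ _ E).
Qed.

Let rnode_inj : injective rnode.
Proof.
move=> [] i [] j //=.
  by move=> E; congr inl; apply: (@rpos_inj s1 s2); apply: (@inlI _ _ _ _ E).
by move=> E; congr inr; apply: (@rpos_inj t1 t2); apply: (@inrI _ _ _ _ E).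
Qed.

Let lrnode x y : (lnode x == rnode y) = false.
Proof.
case: x y => i [] j //=; apply/negP => /eqP.
  by move=> E; have /eqP := (@inlI _ _ _ _ E); rewrite lrpos.
by move=> E; have /eqP := (@inrI _ _ _ _ E); rewrite lrpos.
Qed.

Let starts_lnode x : starts (s1 ++ s2) (t1 ++ t2) (lnode x) = starts s1 t1 x.
Proof. by case: x => i /=; rewrite nth_lpos. Qed.

Let starts_rnode x : starts (s1 ++ s2) (t1 ++ t2) (rnode x) = starts s2 t2 x.
Proof. by case: x => i /=; rewrite nth_rpos. Qed.

Fact tens_arcs_starts a :
  a \in tens_arcs ->
  starts (s1 ++ s2) (t1 ++ t2) a.1 && ~~ starts (s1 ++ s2) (t1 ++ t2) a.2.
Proof.
case/setUP=> /imsetP[b bD ->].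
  by rewrite !starts_lnode; exact: obarcs_starts bD.
by rewrite !starts_rnode; exact: obarcs_starts bD.
Qed.

Fact tens_arcs_exists x : exists2 a, a \in tens_arcs & incident x a.
Proof.
have L y : exists2 a, a \in tens_arcs & incident (lnode y) a.
  have [a aD ya] := odiag_exists (val D1) y.
  exists (lnode a.1, lnode a.2); first by apply/setUP; left; apply/imsetP; exists a.
  by rewrite /incident /= !(inj_eq lnode_inj).
have R y : exists2 a, a \in tens_arcs & incident (rnode y) a.
  have [a aD ya] := odiag_exists (val D2) y.
  exists (rnode a.1, rnode a.2); first by apply/setUP; right; apply/imsetP; exists a.
  by rewrite /incident /= !(inj_eq rnode_inj).
case: x => i; case: (posP i) => j; first exact: (L (inl j)).
- exact: (R (inl j)).
- exact: (L (inr j)).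
exact: (R (inr j)).
Qed.

Fact tens_arcs_unique x a b :
  a \in tens_arcs -> b \in tens_arcs -> incident x a -> incident x b -> a = b.
Proof.
case/setUP=> /imsetP[{}a aD ->] /setUP[]/imsetP[{}b bD ->].
- move=> xa xb; have [y Ey] : exists y, x = lnode y.
    by case/orP: xa => /eqP <-; eexists.
  move: xa xb; rewrite {x}Ey /incident /= !(inj_eq lnode_inj) => xa xb.
  by rewrite (odiag_unique aD bD xa xb).
- by rewrite /incident /= => /orP[]/eqP<-; rewrite ![rnode _ == _]eq_sym !lrnode.
- by rewrite /incident /= => /orP[]/eqP<-; rewrite !lrnode.
move=> xa xb; have [y Ey] : exists y, x = rnode y.
  by case/orP: xa => /eqP <-; eexists.
move: xa xb; rewrite {x}Ey /incident /= !(inj_eq rnode_inj) => xa xb.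
by rewrite (odiag_unique aD bD xa xb).
Qed.

Definition tens_diag : obdiag (s1 ++ s2) (t1 ++ t2) :=
  mk_obdiag tens_arcs_starts tens_arcs_exists tens_arcs_unique.
End TensorDiagram.

(* Reachability for the graph of a partial injection. *)
Section PartialInjection.
Variables (T : finType) (d : rel T).
Hypothesis d_fun : forall x y z, d x y -> d x z -> y = z.
Hypothesis d_inj : forall x y z, d x z -> d y z -> x = y.

Let sd := [rel x y | d x y || d y x].

Lemma pinj_sym : connect_sym sd.
Proof. by apply: sym_connect_sym => x y /=; rewrite orbC. Qed.

Lemma pinj_sub x y : connect d x y -> connect sd x y.
Proof. by apply: connect_sub => u v duv; apply/connect1; rewrite /= duv. Qed.

Lemma pinj_connect x y :
  (forall z, ~~ d z x) -> connect sd x y -> connect d x y.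
Proof.
move=> nox /connectP[p]; elim/last_ind: p y => [|p z IH] y /=.
  by move=> _ ->.
rewrite rcons_path last_rcons => /andP[/IH/(_ erefl) cp /orP[dz|dz] ->].
  exact: connect_trans cp (connect1 dz).
case/connectP: cp => q; case/lastP: q => [|q w] /=.
  by move=> _ E; move: dz; rewrite E (negPf (nox _)).
rewrite rcons_path last_rcons => /andP[pq dw] E; rewrite E in dz.
by rewrite (d_inj dz dw); apply/connectP; exists q.
Qed.

Lemma pinj_total x y z :
  connect d x y -> connect d x z -> connect d y z || connect d z y.
Proof.
case/connectP=> p; elim: p x => [|w p IH] x /=.
  by move=> _ -> ->.
case/andP=> dw pw Ey /connectP[[|v q] /=].
  move=> _ ->; apply/orP; right; apply/connectP; exists (w :: p) => //=.
  by rewrite dw.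
case/andP=> dv pv Ez; move: dv pv Ez => /(d_fun dw) <- pv Ez.
by apply: (IH w) => //; apply/connectP; exists q.
Qed.

Lemma pinj_end x y : (forall z, ~~ d x z) -> connect d x y -> x = y.
Proof.
by move=> nox /connectP[[|w p] //= /andP[]]; rewrite (negPf (nox w)).
Qed.

Lemma pinj_unique x y z :
  (forall w, ~~ d w x) -> (forall w, ~~ d y w) -> (forall w, ~~ d z w) ->
  connect sd x y -> connect sd x z -> y = z.
Proof.
move=> nox noy noz /(pinj_connect nox) cy /(pinj_connect nox) cz.
case/orP: (pinj_total cy cz); first exact: pinj_end.
by move/(pinj_end noz).
Qed.

Lemma pinj_exists x :
  (forall z, ~~ d z x) -> exists2 y, (forall z, ~~ d y z) & connect sd x y.
Proof.
move=> nox; have [/exists_inP[y cy /forallP noy]|no] :=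
  boolP [exists (y | connect d x y), forall z, ~~ d y z].
  by exists y => //; exact: pinj_sub.
pose R := [set y | connect d x y].
have succ y : y \in R -> exists z, d y z.
  rewrite inE => cy; move: no; rewrite negb_exists_in => /forall_inP/(_ _ cy).
  by rewrite negb_forall => /existsP[z]; rewrite negbK; exists z.
pose f y := odflt y [pick z | d y z].
have df y : y \in R -> d y (f y).
  by rewrite /f; case: pickP => //= no' /succ[z]; rewrite no'.
have f_inj : {in R &, injective f}.
  by move=> y z /df dy /df dz E; rewrite E in dy; exact: d_inj dy dz.
have sub : f @: R \subset R :\ x.
  apply/subsetP=> _ /imsetP[y yR ->]; rewrite in_setD1; apply/andP; split.
    by apply/eqP => E; move: (df _ yR); rewrite E (negPf (nox _)).
  have := yR; rewrite !inE => cy; apply: connect_trans cy _.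
  exact/connect1/df.
have xR : x \in R by rewrite inE connect0.
by move: (subset_leq_card sub); rewrite (card_in_imset f_inj) (cardsD1 x R) xR ltnn.
Qed.
End PartialInjection.

Section Composition.
Variables (s t u : signs) (D1 : obdiag t u) (D2 : obdiag s t).

(* The nodes of the stacked diagram: bottom, middle (identified) and top. *)
Definition stack := ('I_(size s) + 'I_(size t) + 'I_(size u))%type.

Definition lower (x : node (size s) (size t)) : stack := inl x.
Definition upper (x : node (size t) (size u)) : stack :=
  match x with inl i => inl (inr i) | inr j => inr j end.
Definition outer (x : node (size s) (size u)) : stack :=
  match x with inl i => inl (inl i) | inr j => inr j end.

Definition stack_arcs : {set stack * stack} :=
  [set (lower a.1, lower a.2) | a in obarcs D2] :|:
  [set (upper a.1, upper a.2) | a in obarcs D1].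

Definition joined : rel stack :=
  [rel x y | ((x, y) \in stack_arcs) || ((y, x) \in stack_arcs)].

(* Connected components of the stacked diagram without any outer node. *)
Definition loops : nat :=
  n_comp joined [pred z | ~~ [exists x, connect joined (outer x) z]].

Definition comp_arcs : {set node (size s) (size u) * node (size s) (size u)} :=
  [set a | [&& starts s u a.1, ~~ starts s u a.2 &
               connect joined (outer a.1) (outer a.2)]].

Let d : rel stack := [rel x y | (x, y) \in stack_arcs].

Let dE z w : d z w ->
  (exists2 a, a \in obarcs D2 & z = lower a.1 /\ w = lower a.2) \/
  (exists2 a, a \in obarcs D1 & z = upper a.1 /\ w = upper a.2).
Proof.
by case/setUP=> /imsetP[a aD [-> ->]]; [left | right]; exists a.
Qed.

Let lower_inj : injective lower. Proof. by move=> x y []. Qed.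
Let upper_inj : injective upper. Proof. by move=> [] i [] j //= [] ->. Qed.

(* The sign at a middle node makes it start in exactly one of D1, D2. *)
Let clash x y : lower x = upper y -> starts s t x = ~~ starts t u y.
Proof. by case: x y => i [] j //= [] ->; rewrite negbK. Qed.

Let d_fun x y z : d x y -> d x z -> y = z.
Proof.
move=> /dE[][a aD [Ex ->]] /dE[][b bD [Ex' ->]].
- have E : a.1 = b.1 by apply: lower_inj; rewrite -Ex -Ex'.
  by congr (lower _.2); apply: (odiag_unique aD bD (x := a.1));
    rewrite /incident ?E eqxx.
- have /andP[Sa _] := obarcs_starts aD; have /andP[Sb _] := obarcs_starts bD.
  by move: Sa; rewrite (@clash a.1 b.1) ?Sb // -Ex -Ex'.
- have /andP[Sa _] := obarcs_starts aD; have /andP[Sb _] := obarcs_starts bD.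
  by move: Sb; rewrite (@clash b.1 a.1) ?Sa // -Ex -Ex'.
have E : a.1 = b.1 by apply: upper_inj; rewrite -Ex -Ex'.
by congr (upper _.2); apply: (odiag_unique aD bD (x := a.1));
  rewrite /incident ?E eqxx.
Qed.

Let d_inj x y z : d x z -> d y z -> x = y.
Proof.
move=> /dE[][a aD [-> Ex]] /dE[][b bD [-> Ex']].
- have E : a.2 = b.2 by apply: lower_inj; rewrite -Ex -Ex'.
  by congr (lower _.1); apply: (odiag_unique aD bD (x := a.2));
    rewrite /incident ?E eqxx orbT.
- have /andP[_ Sa] := obarcs_starts aD; have /andP[_ Sb] := obarcs_starts bD.
  by move: Sa; rewrite (@clash a.2 b.2) ?Sb // -Ex -Ex'.
- have /andP[_ Sa] := obarcs_starts aD; have /andP[_ Sb] := obarcs_starts bD.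
  by move: Sb; rewrite (@clash b.2 a.2) ?Sa // -Ex -Ex'.
have E : a.2 = b.2 by apply: upper_inj; rewrite -Ex -Ex'.
by congr (upper _.1); apply: (odiag_unique aD bD (x := a.2));
  rewrite /incident ?E eqxx orbT.
Qed.

Let d_lowerE x : starts s t x -> exists w, d (lower x) w.
Proof.
rewrite (startsE D2) => /exists_inP[a aD /eqP <-]; exists (lower a.2).
by apply/setUP; left; apply/imsetP; exists a.
Qed.
Let d_upperE x : starts t u x -> exists w, d (upper x) w.
Proof.
rewrite (startsE D1) => /exists_inP[a aD /eqP <-]; exists (upper a.2).
by apply/setUP; right; apply/imsetP; exists a.
Qed.
Let d_lowerV x : ~~ starts s t x -> exists w, d w (lower x).
Proof.
rewrite (startsE D2) is_startN negbK => /exists_inP[a aD /eqP <-]; exists (lower a.1).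
by apply/setUP; left; apply/imsetP; exists a.
Qed.
Let d_upperV x : ~~ starts t u x -> exists w, d w (upper x).
Proof.
rewrite (startsE D1) is_startN negbK => /exists_inP[a aD /eqP <-]; exists (upper a.1).
by apply/setUP; right; apply/imsetP; exists a.
Qed.

Let outer_inj : injective outer. Proof. by move=> [] i [] j //= [] ->. Qed.

Let outer_lower x y : outer x = lower y -> starts s u x = starts s t y.
Proof. by case: x y => i [] j //= [->]. Qed.

Let outer_upper x y : outer x = upper y -> starts s u x = starts t u y.
Proof. by case: x y => i [] j //= [->]. Qed.

Let outer_pred x z : starts s u x -> ~~ d z (outer x).
Proof.
move=> sx; apply/negP => /dE[][a /obarcs_starts/andP[_ na] [_ E]].
  by rewrite -(outer_lower E) sx in na.
by rewrite -(outer_upper E) sx in na.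
Qed.

Let outer_succ x z : ~~ starts s u x -> ~~ d (outer x) z.
Proof.
move=> sx; apply/negP => /dE[][a /obarcs_starts/andP[na _] [E _]].
  by rewrite -(outer_lower E) (negPf sx) in na.
by rewrite -(outer_upper E) (negPf sx) in na.
Qed.

Let no_succ z : (forall w, ~~ d z w) -> exists2 x, z = outer x & ~~ starts s u x.
Proof.
case: z => [[i|i]|j] no.
- exists (inl i) => //; apply/negP => /= si.
  by have [//|w] := @d_lowerE (inl i); rewrite (negPf (no w)).
- case E: (nth true t i).
    by have [//|w] := @d_lowerE (inr i); rewrite (negPf (no w)).
  by have [|w] := @d_upperE (inl i); rewrite /= ?E // (negPf (no w)).
exists (inr j) => //; apply/negP => /= si.
by have [//|w] := @d_upperE (inr j); rewrite (negPf (no w)).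
Qed.

Let no_pred z : (forall w, ~~ d w z) -> exists2 x, z = outer x & starts s u x.
Proof.
case: z => [[i|i]|j] no.
- exists (inl i) => //; apply: contraT => /= si.
  by have [//|w] := @d_lowerV (inl i); rewrite (negPf (no w)).
- case E: (nth true t i).
    by have [|w] := @d_upperV (inl i); rewrite /= ?E // (negPf (no w)).
  by have [|w] := @d_lowerV (inr i); rewrite /= ?E // (negPf (no w)).
exists (inr j) => //; apply: contraT => /= si.
by have [//|w] := @d_upperV (inr j); rewrite (negPf (no w)).
Qed.

Let joinedC : joined =2 [rel x y | d y x || d x y].
Proof. by move=> x y /=; rewrite orbC. Qed.

Let joined_sym : connect_sym joined. Proof. exact: (@pinj_sym _ d). Qed.

Fact comp_arcs_starts a : a \in comp_arcs -> starts s u a.1 && ~~ starts s u a.2.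
Proof. by rewrite inE => /and3P[-> ->]. Qed.

Fact comp_arcs_exists x : exists2 a, a \in comp_arcs & incident x a.
Proof.
have [sx|sx] := boolP (starts s u x).
  have [|_ /no_succ[y -> sy] c] := @pinj_exists _ d d_inj (outer x).
    by move=> z; exact: outer_pred.
  by exists (x, y); [rewrite inE /= sx sy | rewrite /incident eqxx].
pose d' := [rel x y | d y x].
have d'_inj y z w : d' y w -> d' z w -> y = z by exact: d_fun.
have nox z : ~~ d' z (outer x) by exact: outer_succ.
have [_ /no_pred[y -> sy] c] := pinj_exists d'_inj nox.
exists (y, x); last by rewrite /incident eqxx orbT.
by rewrite inE /= sx sy joined_sym (eq_connect joinedC).
Qed.

Fact comp_arcs_unique x a b :
  a \in comp_arcs -> b \in comp_arcs -> incident x a -> incident x b -> a = b.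
Proof.
case: a b => [a1 a2] [b1 b2]; rewrite !inE /=.
move=> /and3P[sa1 sa2 ca] /and3P[sb1 sb2 cb].
have E1 : a1 = b1 -> a2 = b2.
  move=> E; apply: outer_inj.
  apply: (@pinj_unique _ d d_fun d_inj (outer a1)) => //; try by move=> w;
    first [exact: outer_pred | exact: outer_succ].
  by rewrite E.
have E2 : a2 = b2 -> a1 = b1.
  move=> E; apply: outer_inj.
  apply: (@pinj_unique _ [rel x y | d y x] _ _ (outer a2)).
  - by move=> ? ? ? /= H1 H2; exact: d_inj H1 H2.
  - by move=> ? ? ? /= H1 H2; exact: d_fun H1 H2.
  - by move=> w; exact: outer_succ.
  - by move=> w; exact: outer_pred.
  - by move=> w; exact: outer_pred.
  - by rewrite -(eq_connect joinedC) joined_sym.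
  by rewrite -(eq_connect joinedC) joined_sym E.
rewrite /incident /= => /orP[]/eqP Ea /orP[]/eqP Eb.
- by rewrite E1 ?Ea ?Eb.
- by move: sb2; rewrite Eb -Ea sa1.
- by move: sa2; rewrite Ea -Eb sb1.
by rewrite E2 ?Ea ?Eb.
Qed.

Definition comp_diag : obdiag s u :=
  mk_obdiag comp_arcs_starts comp_arcs_exists comp_arcs_unique.
End Composition.

Section DiagramOfSeq.
Variables (s t : signs).
Let N := node (size s) (size t).
Variable l : seq (N * N).
Hypothesis l_starts : all (fun a => starts s t a.1 && ~~ starts s t a.2) l.
Hypothesis l_once : forall x, count (incident x) l = 1%N.

Fact seq_starts a :
  a \in [set b in l] -> starts s t a.1 && ~~ starts s t a.2.
Proof. by rewrite inE => /(allP l_starts). Qed.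

Fact seq_exists x : exists2 a, a \in [set b in l] & incident x a.
Proof.
have /hasP[a al xa] : has (incident x) l by rewrite has_count l_once.
by exists a; rewrite ?inE.
Qed.

Fact seq_unique x a b :
  a \in [set b in l] -> b \in [set b in l] ->
  incident x a -> incident x b -> a = b.
Proof.
rewrite !inE => al bl xa xb; move: (l_once x); rewrite -size_filter.
have : a \in filter (incident x) l by rewrite mem_filter xa.
have : b \in filter (incident x) l by rewrite mem_filter xb.
case: filter => [|c [|]] //.
by rewrite !inE => /eqP-> /eqP->.
Qed.

Definition seq_diag : obdiag s t := mk_obdiag seq_starts seq_exists seq_unique.
End DiagramOfSeq.

(* The i-th bottom (resp. top) node of a (k, l) diagram. *)
Local Notation bot k l i := (@inl 'I_k 'I_l (@Ordinal k i isT)).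
Local Notation top k l i := (@inr 'I_k 'I_l (@Ordinal l i isT)).
Local Notation "[ 'diag' s --> t | l ]" :=
  (@seq_diag s t l isT (ltac:(by case=> [[[|[|]]]|[[|[|]]]]))).

Definition I_plus :=
  [diag [:: true] --> [:: true] | [:: (top 1 1 0, bot 1 1 0)]].
Definition I_minus :=
  [diag [:: false] --> [:: false] | [:: (bot 1 1 0, top 1 1 0)]].
Definition X_diag :=
  [diag [:: true; true] --> [:: true; true] |
    [:: (top 2 2 0, bot 2 2 1); (top 2 2 1, bot 2 2 0)]].
Definition A_plus :=
  [diag [:: false; true] --> ([::] : signs) | [:: (bot 2 0 0, bot 2 0 1)]].
Definition A_minus :=
  [diag [:: true; false] --> ([::] : signs) | [:: (bot 2 0 1, bot 2 0 0)]].
Definition U_plus :=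
  [diag ([::] : signs) --> [:: true; false] | [:: (top 0 2 0, top 0 2 1)]].
Definition U_minus :=
  [diag ([::] : signs) --> [:: false; true] | [:: (top 0 2 1, top 0 2 0)]].

Definition OB (K : fieldType) (s t : signs) := {ffun obdiag s t -> K^o}.

Section BrauerCategory.
Variables (K : fieldType) (delta : K).

Definition ob_basis s t (D : obdiag s t) : OB K s t := [ffun D' => (D' == D)%:R].

Definition ob_id s : OB K s s := ob_basis (id_diag s).

Definition ob_comp s t u (f : OB K t u) (g : OB K s t) : OB K s u :=
  \sum_(D1 : obdiag t u) \sum_(D2 : obdiag s t)
    (f D1 * g D2 * delta ^+ loops D1 D2) *: ob_basis (comp_diag D1 D2).

Definition ob_tens s1 t1 s2 t2 (f : OB K s1 t1) (g : OB K s2 t2) :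
    OB K (s1 ++ s2) (t1 ++ t2) :=
  \sum_(D1 : obdiag s1 t1) \sum_(D2 : obdiag s2 t2)
    (f D1 * g D2) *: ob_basis (tens_diag D1 D2).
End BrauerCategory.

(* Degrees in Z/2 are booleans: [false] is even and [true] is odd. *)
Record superspace (K : fieldType) := Superspace {
  sv_space :> vectType K;
  homog : bool -> {vspace sv_space};
  homog_sum : (homog false + homog true = fullv)%VS;
  homog_cap : (homog false :&: homog true = 0)%VS
}.

Definition sdim K (V : superspace K) : int :=
  (\dim (homog V false))%:Z - (\dim (homog V true))%:Z.

(* Commutative superalgebras; [part a] is the projection onto the component of
   degree [a].  [part_odd] only adds to [part_comm] in characteristic 2. *)
Record comSuperAlg (K : fieldType) := ComSuperAlg {
  sa_alg :> algType K;
  part : bool -> {linear sa_alg -> sa_alg};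
  part_sum : forall x, part false x + part true x = x;
  part_part : forall a b x, part a (part b x) = if a == b then part b x else 0;
  part_one : part false 1 = 1;
  part_mul : forall a b x y, part a x = x -> part b y = y ->
    part (a (+) b) (x * y) = x * y;
  part_comm : forall a b x y, part a x = x -> part b y = y ->
    x * y = (-1) ^+ (a && b) * (y * x);
  part_odd : forall x, part true x = x -> x * x = 0
}.

Section Representations.
Variables (K : fieldType) (V : superspace K).

Local Notation n := (\dim (homog V false) + \dim (homog V true))%N.

Definition hbasis : n.-tuple V :=
  [tuple of vbasis (homog V false) ++ vbasis (homog V true)].
Definition deg (i : 'I_n) : bool := (\dim (homog V false) <= i)%N.

Lemma hbasis_basis : basis_of fullv hbasis.
Proof.
have D : directv (homog V false + homog V true).
  by apply/directv_addP; exact: homog_cap.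
by have := cat_basis D (vbasisP _) (vbasisP _); rewrite homog_sum.
Qed.

Lemma hbasis_deg i : tnth hbasis i \in homog V (deg i).
Proof.
rewrite (tnth_nth 0) nth_cat size_tuple /deg.
case: ltnP => [lt_i|ge_i] /=.
  by apply: vbasis_mem; rewrite mem_nth // size_tuple.
by apply: vbasis_mem; rewrite mem_nth // size_tuple ltn_subLR.
Qed.

Definition dual := 'Hom(V, K^o).

Definition dbasis (i : 'I_n) : dual := linfun (coord hbasis i : V -> K^o).

Definition homog_dual (a : bool) (w : dual) : Prop :=
  forall v : V, v \in homog V (~~ a) -> w v = 0.

Definition Vsign (e : bool) : vectType K := if e then sv_space V else dual.

Definition sign_coord (e : bool) (i : 'I_n) : Vsign e -> K :=
  match e with
  | true => fun v : V => coord hbasis i v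
  | false => fun w : dual => w (tnth hbasis i)
  end.

Definition idx (s : signs) := {ffun 'I_(size s) -> 'I_n}.
Definition lidx s1 s2 (I : idx (s1 ++ s2)) : idx s1 := [ffun q => I (lpos s2 q)].
Definition ridx s1 s2 (I : idx (s1 ++ s2)) : idx s2 := [ffun q => I (rpos s1 q)].

(* The tensor space V^s, in coordinates with respect to the tensor products of
   elements of [hbasis] and of its dual basis. *)
Definition tspace (s : signs) := {ffun idx s -> K^o}.

Definition tbasis s (I : idx s) : tspace s := [ffun J => (J == I)%:R].

(* The identifications of K with V^[::] and of V^e with V^[:: e], and the
   tensor product of vectors. *)
Definition tone : tspace [::] := [ffun => 1].
Definition tin (e : bool) (v : Vsign e) : tspace [:: e] :=
  [ffun I : idx [:: e] => sign_coord (I ord0) v].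
Definition tmul s1 s2 (x : tspace s1) (y : tspace s2) : tspace (s1 ++ s2) :=
  [ffun I : idx (s1 ++ s2) => (x (lidx I) : K) * y (ridx I)].

Section Points.
Variable A : comSuperAlg K.

(* The A-points of GL(V): the even automorphisms of the right A-module V (x) A,
   given by b_j |-> \sum_i b_i g_ij. *)
Record GLpoint := MkGLpoint {
  gmat :> 'M[A]_n;
  ginv : 'M[A]_n;
  geven : forall i j, part A (deg i (+) deg j) (gmat i j) = gmat i j;
  gmulV : gmat *m ginv = 1%:M;
  gVmul : ginv *m gmat = 1%:M
}.

(* The matrix of g on V^e (x) A.  In the dual case the functional g b_j^* takes
   the value (g^-1)_ji at b_i, and (b_i^* a)(b_i) = (-1)^([a][b_i]) a. *)
Definition sign_mx (g : GLpoint) (e : bool) : 'M[A]_n :=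
  if e then gmat g
  else \matrix_(i, j) ((-1) ^+ (deg i && (deg i (+) deg j)) * ginv g j i).

(* The matrix of the diagonal action of g on V^s (x) A.  The sign comes from
   moving the coefficient of the q-th factor, of degree [I q] + [J q], past the
   r-th basis vector, of degree [I r], for q < r. *)
Definition tens_entry (g : GLpoint) s (I J : idx s) : A :=
  (-1) ^+ (\sum_(q < size s) \sum_(r < size s | (q < r)%N)
             ((deg (I q) (+) deg (J q)) && deg (I r)))%N
  * \prod_(q < size s) sign_mx g (nth true s q) (I q) (J q).

Definition tspaceA s := {ffun idx s -> A}.

Definition GLact (g : GLpoint) s (x : tspaceA s) : tspaceA s :=
  [ffun I => \sum_J tens_entry g I J * x J].

(* The base change f (x) A of a linear map f. *)
Definition baseA s t (f : tspace s -> tspace t) (x : tspaceA s) : tspaceA t :=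
  [ffun I => \sum_J (f (tbasis J) I : K) *: x J].
End Points.

Definition equivariant s t (f : 'Hom(tspace s, tspace t)) : Prop :=
  forall (A : comSuperAlg K) (g : GLpoint A) (x : tspaceA A s),
    baseA f (GLact g x) = GLact g (baseA f x).

Definition equivariantb s t : {pred 'Hom(tspace s, tspace t)} :=
  fun f => `[< equivariant f >].

Fact baseA_lin (A : comSuperAlg K) s t a (f g : 'Hom(tspace s, tspace t))
    (x : tspaceA A s) :
  baseA (a *: f + g) x = [ffun I => a *: baseA f x I + baseA g x I].
Proof.
apply/ffunP=> I; rewrite !ffunE scaler_sumr -big_split; apply: eq_bigr => J _.
by rewrite lfunE /= lfunE /= !ffunE scalerDl scalerA.
Qed.

Fact GLact_lin (A : comSuperAlg K) (g : GLpoint A) s a (x y : tspaceA A s) :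
  GLact g [ffun I => a *: x I + y I] =
  [ffun I => a *: GLact g x I + GLact g y I].
Proof.
apply/ffunP=> I; rewrite !ffunE scaler_sumr -big_split; apply: eq_bigr => J _.
by rewrite ffunE mulrDr scalerAr.
Qed.

Fact equivariant_submod s t : submod_closed (@equivariantb s t).
Proof.
split=> [|a f g /asboolP Hf /asboolP Hg].
  have Z (A : comSuperAlg K) (x : tspaceA A s) :
      baseA (0 : 'Hom(tspace s, tspace t)) x = [ffun => 0].
    apply/ffunP=> I; rewrite !ffunE big1 // => J _.
    by rewrite lfunE /= ffunE scale0r.
  apply/asboolP => A g x; rewrite !Z.
  by apply/ffunP=> I; rewrite !ffunE big1 // => J _; rewrite ffunE mulr0.
by apply/asboolP => A h x; rewrite !baseA_lin GLact_lin Hf Hg.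
Qed.

HB.instance Definition _ s t :=
  GRing.isSubmodClosed.Build K 'Hom(tspace s, tspace t) (@equivariantb s t)
    (equivariant_submod s t).

Record GLhom (s t : signs) := MkGLhom {
  GLmap :> 'Hom(tspace s, tspace t);
  GLmapP : GLmap \in @equivariantb s t
}.
HB.instance Definition _ s t := [isSub for @GLmap s t].
HB.instance Definition _ s t := [Choice of GLhom s t by <:].
HB.instance Definition _ s t := [SubChoice_isSubLmodule of GLhom s t by <:].

Lemma GLhom_equivariant s t (f : GLhom s t) : equivariant f.
Proof. by apply/asboolP; exact: GLmapP. Qed.

Fact GLid_subproof s : (\1%VF : 'Hom(tspace s, tspace s)) \in @equivariantb s s.
Proof.
have E (A : comSuperAlg K) (x : tspaceA A s) :
    baseA (\1%VF : 'Hom(tspace s, tspace s)) x = x.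
  apply/ffunP => I; rewrite ffunE (bigD1 I) //= big1 ?addr0.
    by rewrite lfunE ffunE eqxx scale1r.
  by move=> J nIJ; rewrite lfunE ffunE eq_sym (negPf nIJ) scale0r.
by apply/asboolP => A g x; rewrite !E.
Qed.
Definition GLid s : GLhom s s := MkGLhom (GLid_subproof s).

Fact GLcomp_subproof s t u (f : GLhom t u) (g : GLhom s t) :
  (GLmap f \o GLmap g)%VF \in @equivariantb s u.
Proof.
have E (A : comSuperAlg K) (x : tspaceA A s) :
    baseA (GLmap f \o GLmap g)%VF x = baseA f (baseA g x).
  apply/ffunP => I; rewrite !ffunE.
  under [RHS]eq_bigr => J _ do rewrite ffunE scaler_sumr.
  rewrite exchange_big; apply: eq_bigr => J _.
  rewrite lfunE /=.
  have Eg : g (tbasis J) = \sum_I' (g (tbasis J) I' : K) *: tbasis I'.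
    apply/ffunP => I'; rewrite sum_ffunE (bigD1 I') //= big1 ?addr0.
      by rewrite !ffunE eqxx /GRing.scale /= mulr1.
    by move=> J' nJ; rewrite !ffunE eq_sym (negPf nJ) /GRing.scale /= mulr0.
  rewrite {1}Eg linear_sum sum_ffunE scaler_suml; apply: eq_bigr => I' _.
  by rewrite linearZ ffunE scalerA mulrC.
apply/asboolP => A h x; rewrite !E.
by rewrite (GLhom_equivariant g) (GLhom_equivariant f).
Qed.
Definition GLcomp s t u (f : GLhom t u) (g : GLhom s t) : GLhom s u :=
  MkGLhom (GLcomp_subproof f g).
End Representations.

Arguments tone {K} V.
Arguments tin {K V} e v.

(* [tmul] makes V^(s1 ++ s2) the tensor product of V^s1 and V^s2: it sends the
   pairs of basis vectors bijectively to the basis of V^(s1 ++ s2). *)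
Lemma tmul_basis (K : fieldType) (V : superspace K) s1 s2
    (I : idx V (s1 ++ s2)) :
  tmul (tbasis (lidx I)) (tbasis (ridx I)) = tbasis I.
Proof.
apply/ffunP=> J; rewrite !ffunE -natrM mulnb; congr (nat_of_bool _)%:R.
apply/andP/eqP => [[/eqP El /eqP Er]|-> //].
apply/ffunP=> q; case: (posP q) => i.
  by move/ffunP/(_ i): El; rewrite !ffunE.
by move/ffunP/(_ i): Er; rewrite !ffunE.
Qed.

Lemma idx_pair_bij (K : fieldType) (V : superspace K) s1 s2 :
  bijective (fun I : idx V (s1 ++ s2) => (lidx I, ridx I)).
Proof.
pose f (p : idx V s1 * idx V s2) : idx V (s1 ++ s2) := [ffun q =>
  match split (cast_ord (size_cat s1 s2) q) with
  | inl i => p.1 i | inr j => p.2 j end].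
have fl p i : f p (lpos s2 i) = p.1 i.
  rewrite ffunE /lpos cast_ordKV; case: split_ordP => j.
    by move/lshift_inj ->.
  by move/eqP; rewrite eq_lrshift.
have fr p i : f p (rpos s1 i) = p.2 i.
  rewrite ffunE /rpos cast_ordKV; case: split_ordP => j.
    by move/eqP; rewrite eq_rlshift.
  by move/rshift_inj ->.
exists f => [I|[I J]].
  by apply/ffunP => q; case: (posP q) => i; rewrite ?fl ?fr ffunE.
by congr pair; apply/ffunP => i; rewrite ffunE ?fl ?fr.
Qed.

(* Linear functors from OB(delta) to T_GL(V) sending the object s to V^s. *)
Record OBfunctor (K : fieldType) (delta : K) (V : superspace K) := {
  Fmap : forall s t, {linear OB K s t -> GLhom V s t};
  Fmap_id : forall s, Fmap s s (ob_id K s) = GLid V s;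
  Fmap_comp : forall s t u (f : OB K t u) (g : OB K s t),
    Fmap s u (ob_comp delta f g) = GLcomp (Fmap t u f) (Fmap s t g)
}.

Arguments Fmap {K delta V} _ {s t}.

Section FunctorProperties.
Variables (K : fieldType) (delta : K) (V : superspace K).
Variable F : OBfunctor delta V.

Definition Fdiag s t (D : obdiag s t) : GLhom V s t :=
  Fmap F (ob_basis K D).

Definition generator_values : Prop :=
  [/\ Fdiag I_plus = GLid V [:: true] /\ Fdiag I_minus = GLid V [:: false],
      forall (a b : bool) (v w : V), v \in homog V a -> w \in homog V b ->
        Fdiag X_diag (tmul (tin true v) (tin true w)) =
          (-1) ^+ (a && b) *: tmul (tin true w) (tin true v),
      Fdiag U_plus (tone V) =
        \sum_(i < \dim (homog V false) + \dim (homog V true))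
          tmul (tin true (tnth (hbasis V) i)) (tin false (dbasis i)) /\
      Fdiag U_minus (tone V) =
        \sum_(i < \dim (homog V false) + \dim (homog V true))
          (-1) ^+ deg i *: tmul (tin false (dbasis i)) (tin true (tnth (hbasis V) i)),
      forall (w : dual V) (v : V),
        Fdiag A_plus (tmul (tin false w) (tin true v)) = w v *: tone V &
      forall (a b : bool) (v : V) (w : dual V),
        v \in homog V a -> homog_dual b w ->
        Fdiag A_minus (tmul (tin true v) (tin false w)) =
          ((-1) ^+ (a && b) * w v) *: tone V].

(* F (f (x) g) = F f (x) F g.  There is no Koszul sign, morphisms in T_GL(V)
   being even: they commute with the point diag(1, t) of GL(V)(K[t, t^-1]). *)
Definition respects_tensor : Prop :=
  forall s1 t1 s2 t2 (f : OB K s1 t1) (g : OB K s2 t2)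
         (x : tspace V s1) (y : tspace V s2),
    Fmap F (ob_tens f g) (tmul x y) =
      tmul (Fmap F f x) (Fmap F g y).
End FunctorProperties.

(* Main.v *)
(** The functor is given by explicit matrix coefficients in homogeneous bases: the
    (I, J) coefficient of F(D) vanishes unless the labels I, J of the nodes agree
    along every arc of D, and is otherwise a sign, the parity of the number of
    crossings of odd arcs plus the number of odd arcs turning back as U^- or A^-.

    Functoriality.  Up to terms that depend on the boundary only, this parity is the
    number of inversions of the bijection from the starting points to the end points
    of the odd arcs.  For a stacked diagram, the arcs of both factors together with
    the reversed arcs of the composite form a permutation whose cycles are the
    connected components, so the parities of the factors add up to that of the
    composite plus the number of odd closed loops.  Summing over the labels of the
    loops, each of them contributes the sum of the (-1)^[b_i], that is sdim V.

    Equivariance and uniqueness.  Every diagram is obtained from identities and the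
    generators by tensor products and compositions that create no loop: bend all
    bottom nodes to the top, then bring the two ends of an arc next to each other by
    means of crossings, all of which are rotations of X.  It is then enough to treat
    the generators. *)
From HB Require Import structures.
Require Import Defs.
From mathcomp Require Import all_boot all_algebra perm ring zify.
From mathcomp Require Import boolp.
Import GRing.Theory.
Local Open Scope ring_scope.

Set Implicit Arguments.
Unset Strict Implicit.
Unset Printing Implicit Defensive.

(** Prescribing $F$ on generators only would require a complete list of relations between them.
    Coefficients attached to every diagram at once avoid any presentation, at the price of
    controlling signs globally. Crossings depend on a drawing and are awkward to compose; inversions
    are intrinsic. What links them to closed loops is that the parity of a permutation can be
    computed both from inversions and from the number of cycles.

    Loop-free compositions are essential in the generation argument: a composition with $k$ loops
    only yields $\delta^k D$, and $\delta_V$ may vanish in $\mathbb{K}$.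

    Diagrams are compared through their Boolean labellings that are constant along arcs. These
    determine the diagram, and those of a composite arise by composing relations, so identities
    between diagrams turn into computations with lists. *)

Arguments lnode {s1 t1} s2 t2 x.
Arguments rnode s1 t1 {s2 t2} x.
Arguments lower {s t} u x.
Arguments upper s {t u} x.
Arguments outer {s} t {u} x.

(** * Diagrams as involutions of their nodes, and labellings constant along arcs *)

Section Mate.
Variables (s t : signs) (D : obdiag s t).
Notation nd := (node (size s) (size t)).

(** The default [x] is never returned, as every node lies on an arc. Forgetting the orientation
    loses nothing: the signs of the nodes restore it ([obarcsE]). *)
Definition mate (x : nd) : nd :=
  odflt x [pick y | ((x, y) \in obarcs D) || ((y, x) \in obarcs D)].

Lemma mate_spec x : ((x, mate x) \in obarcs D) || ((mate x, x) \in obarcs D).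
Proof.
rewrite /mate; case: pickP => //= no.
have [[a b] aD /orP[] /= /eqP E] := odiag_exists (val D) x.
  by have := no b; rewrite -E [_ \in _]aD.
by have := no a; rewrite -E [(_, b) \in _]aD orbT.
Qed.

Lemma mem_start x : starts s t x -> (x, mate x) \in obarcs D.
Proof.
by move=> sx; case/orP: (mate_spec x) => // /obarcs_starts /andP[_]; rewrite sx.
Qed.

Lemma mem_end x : ~~ starts s t x -> (mate x, x) \in obarcs D.
Proof.
move=> sx; case/orP: (mate_spec x) => // /obarcs_starts /andP[/=].
by rewrite (negPf sx).
Qed.

Lemma starts_mate x : starts s t (mate x) = ~~ starts s t x.
Proof.
have [sx|sx] := boolP (starts s t x).
  by have /obarcs_starts/andP[_ /negPf] := mem_start sx.
by have /obarcs_starts/andP[] := mem_end sx.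
Qed.

Lemma mate_arc x y : (x, y) \in obarcs D -> mate x = y /\ mate y = x.
Proof.
move=> xy; have /andP[/= sx sy] := obarcs_starts xy.
have E1 : (x, y) = (x, mate x).
  by apply: (odiag_unique xy (mem_start sx) (x := x)); rewrite /incident eqxx.
have E2 : (x, y) = (mate y, y).
  by apply: (odiag_unique xy (mem_end sy) (x := y)); rewrite /incident eqxx orbT.
by case: E1 E2 => <- [<-].
Qed.

Lemma mateK : involutive mate.
Proof. by move=> x; case/orP: (mate_spec x) => /mate_arc[]. Qed.

Lemma mate_inj : injective mate. Proof. exact: inv_inj mateK. Qed.

Lemma obarcsE a : (a \in obarcs D) = starts s t a.1 && (mate a.1 == a.2).
Proof.
case: a => x y /=; apply/idP/andP => [xy|[sx /eqP <-]]; last exact: mem_start.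
have /andP[/= -> _] := obarcs_starts xy; split=> //; apply/eqP.
by have [] := mate_arc xy.
Qed.

(** Boolean labels serve to compare diagrams; labels by basis indices describe the nonzero matrix
    coefficients. *)
Definition compat (L : eqType) (f : nd -> L) : bool :=
  [forall x, f (mate x) == f x].

Lemma compatP (L : eqType) (f : nd -> L) :
  reflect (forall x, f (mate x) = f x) (compat f).
Proof. by apply: (iffP forallP) => H x; apply/eqP. Qed.

Lemma eq_compat (L : eqType) (f g : nd -> L) : f =1 g -> compat f = compat g.
Proof. by move=> E; apply: eq_forallb => x; rewrite !E. Qed.
End Mate.

Lemma mate_ext s t (D D' : obdiag s t) : mate D =1 mate D' -> D = D'.
Proof.
move=> E; apply: val_inj; apply: val_inj; apply/setP => a.
by rewrite -[LHS]/(a \in obarcs D) -[RHS]/(a \in obarcs D') !obarcsE E.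
Qed.

(** The indicator function of one arc of [D] is constant along the arcs of [D']. So [D'] pairs [x]
    with a node of this arc, and not with [x] itself, because one of two paired nodes is a starting
    point and the other is not. *)
Lemma compat_ext s t (D D' : obdiag s t) :
  (forall f : _ -> bool, compat D f -> compat D' f) -> D = D'.
Proof.
move=> H; apply: mate_ext => x.
have /H/compatP/(_ x) : compat D [pred y | (y == x) || (y == mate D x)].
  apply/compatP => y /=.
  by rewrite (inj_eq (@mate_inj _ _ D)) (inv_eq (mateK D)) orbC.
rewrite /= eqxx /= => /orP[/eqP E|/eqP-> //].
by have := starts_mate D' x; rewrite E; case: starts.
Qed.

Lemma mate_id s (i : 'I_(size s)) :
  mate (id_diag s) (inl i) = inr i /\ mate (id_diag s) (inr i) = inl i.
Proof.
have : id_arc i \in obarcs (id_diag s) by rewrite /obarcs /= imset_f.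
by rewrite /id_arc; case: nth => /mate_arc[].
Qed.

Lemma mate_tens s1 t1 s2 t2 (D1 : obdiag s1 t1) (D2 : obdiag s2 t2) :
  (forall x, mate (tens_diag D1 D2) (lnode _ _ x) = lnode _ _ (mate D1 x)) /\
  (forall x, mate (tens_diag D1 D2) (rnode _ _ x) = rnode _ _ (mate D2 x)).
Proof.
have L a : a \in obarcs D1 ->
    (lnode s2 t2 a.1, lnode s2 t2 a.2) \in obarcs (tens_diag D1 D2).
  by move=> aD; apply/setUP; left; apply/imsetP; exists a.
have R a : a \in obarcs D2 ->
    (rnode s1 t1 a.1, rnode s1 t1 a.2) \in obarcs (tens_diag D1 D2).
  by move=> aD; apply/setUP; right; apply/imsetP; exists a.
by split=> x; [case/orP: (mate_spec D1 x) => /L /mate_arc[]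
              |case/orP: (mate_spec D2 x) => /R /mate_arc[]].
Qed.

Lemma nodeP s1 s2 t1 t2 (P : node (size (s1 ++ s2)) (size (t1 ++ t2)) -> Prop) :
  (forall x, P (lnode s2 t2 x)) -> (forall x, P (rnode s1 t1 x)) ->
  forall x, P x.
Proof.
move=> HL HR [] i; case: (posP i) => j.
- exact: (HL (inl j)).
- exact: (HR (inl j)).
- exact: (HL (inr j)).
exact: (HR (inr j)).
Qed.

Lemma compat_tens s1 t1 s2 t2 (D1 : obdiag s1 t1) (D2 : obdiag s2 t2)
    (L : eqType) (f : _ -> L) :
  compat (tens_diag D1 D2) f =
  compat D1 (f \o lnode s2 t2) && compat D2 (f \o rnode s1 t1).
Proof.
have [EL ER] := mate_tens D1 D2.
apply/compatP/andP => [H|[/compatP HL /compatP HR]].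
  by split; apply/compatP => x /=; rewrite -?EL -?ER H.
by apply: nodeP => x; rewrite ?EL ?ER; [exact: HL | exact: HR].
Qed.

(** * Components and labellings of a stacked diagram *)

Section Composite.
Variables (s t u : signs) (D1 : obdiag t u) (D2 : obdiag s t).
Notation jn := (joined D1 D2).
Notation D := (comp_diag D1 D2).

Lemma joined_csym : connect_sym jn.
Proof. by apply: sym_connect_sym => x y; rewrite /joined /= orbC. Qed.

Lemma joined_lower x : jn (lower u x) (lower u (mate D2 x)).
Proof.
have H a : a \in obarcs D2 -> (lower u a.1, lower u a.2) \in stack_arcs D1 D2.
  by move=> aD; apply/setUP; left; apply/imsetP; exists a.
by rewrite /joined /=; case/orP: (mate_spec D2 x) => /H ->; rewrite ?orbT.
Qed.

Lemma joined_upper x : jn (upper s x) (upper s (mate D1 x)).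
Proof.
have H a : a \in obarcs D1 -> (upper s a.1, upper s a.2) \in stack_arcs D1 D2.
  by move=> aD; apply/setUP; right; apply/imsetP; exists a.
by rewrite /joined /=; case/orP: (mate_spec D1 x) => /H ->; rewrite ?orbT.
Qed.

Lemma joinedP z w : jn z w ->
  (exists2 x, z = lower u x & w = lower u (mate D2 x)) \/
  (exists2 x, z = upper s x & w = upper s (mate D1 x)).
Proof.
by case/orP => /setUP[] /imsetP[[x y] /= /mate_arc[<- Ey] [-> ->]];
  [left; exists x|right; exists x|left; exists (mate D2 x)|right; exists (mate D1 x)];
  rewrite ?Ey.
Qed.

Section StackLabel.
Variables (L : eqType) (f : stack s t u -> L).

Lemma stack_compat_const :
  compat D2 (f \o lower u) -> compat D1 (f \o upper s) ->
  forall z w, connect jn z w -> f z = f w.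
Proof.
move=> /compatP H2 /compatP H1 z w /connectP[p].
elim: p z => [z _ -> //|v p IH z /= /andP[zv pv] /(IH _ pv) <-].
by apply/esym; case: (joinedP zv) => [][x -> ->]; [exact: H2 | exact: H1].
Qed.

Lemma const_stack_compat :
  (forall z w, connect jn z w -> f z = f w) ->
  compat D2 (f \o lower u) && compat D1 (f \o upper s).
Proof.
move=> H; apply/andP; split; apply/compatP => x /=; apply/esym/H/connect1.
  exact: joined_lower.
exact: joined_upper.
Qed.
End StackLabel.

Lemma connect_outer_mate x : connect jn (outer t x) (outer t (mate D x)).
Proof.
case/orP: (mate_spec D x); rewrite inE => /and3P[_ _] //=.
by rewrite joined_csym.
Qed.

Lemma connect_outer_eq x y : starts s u x -> starts s u y ->
  connect jn (outer t x) (outer t y) -> x = y.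
Proof.
move=> sx sy xy.
apply: (@mate_inj _ _ D); apply/esym/(proj1 (mate_arc _)).
rewrite inE /=; apply/and3P; split=> //; first by rewrite starts_mate sx.
by apply: connect_trans (connect_outer_mate x); rewrite joined_csym.
Qed.

(** A component has at most one outer starting point by [connect_outer_eq]; replacing end points by
    their mates reduces the other cases to this one. *)
Lemma connect_outer (x y : node (size s) (size u)) :
  connect jn (outer t x) (outer t y) -> y = x \/ y = mate D x.
Proof.
move=> xy; have [|sx] := boolP (starts s u x); have [|sy] := boolP (starts s u y).
- by move=> sy sx; left; rewrite (connect_outer_eq sx sy xy).
- move=> sx; right; rewrite -[LHS](mateK D); congr (mate _ _); apply/esym.
  apply: connect_outer_eq => //; first by rewrite starts_mate.
  exact: connect_trans xy (connect_outer_mate y).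
- move=> sy; right; apply/esym/connect_outer_eq => //; first by rewrite starts_mate.
  by rewrite joined_csym in xy; rewrite joined_csym;
     apply: connect_trans xy (connect_outer_mate x).
left; apply: (@mate_inj _ _ D); apply/connect_outer_eq; rewrite ?starts_mate //.
have yx : connect jn (outer t y) (outer t x) by rewrite joined_csym.
apply: connect_trans (connect_outer_mate x); apply: connect_trans yx.
by rewrite joined_csym connect_outer_mate.
Qed.

Lemma compat_comp (L : eqType) (f : stack s t u -> L) :
  compat D2 (f \o lower u) -> compat D1 (f \o upper s) ->
  compat D (f \o outer t).
Proof.
move=> H2 H1; apply/compatP => x /=; apply/esym.
exact/(stack_compat_const H2 H1)/connect_outer_mate.
Qed.

(** A component that reaches the boundary takes the label found there, which is unambiguous by
    [connect_outer]; closed loops take the arbitrary label [a]. Together with [compat_comp], the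
    labellings of a composite are the relational composite of those of its factors. *)
Lemma compat_extend (L : eqType) (g : node (size s) (size u) -> L) (a : L) :
  compat D g ->
  exists f : stack s t u -> L,
    [/\ f \o outer t =1 g, compat D2 (f \o lower u) &
        compat D1 (f \o upper s)].
Proof.
move=> /compatP gD.
pose f z := if [pick x | connect jn (outer t x) z] is Some x then g x else a.
have fE x z : connect jn (outer t x) z -> f z = g x.
  move=> xz; rewrite /f; case: pickP => [y yz|/(_ x)]; last by rewrite xz.
  have /connect_outer[->//|->] : connect jn (outer t x) (outer t y).
    by apply: connect_trans xz _; rewrite joined_csym.
  exact: gD.
have /const_stack_compat/andP[H2 H1] : forall z w, connect jn z w -> f z = f w.
  move=> z w zw; rewrite {1}/f; case: pickP => [x xz|no].
    by apply/esym/fE/(connect_trans xz).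
  rewrite /f; case: pickP => // x xw; have := no x.
  by rewrite (connect_trans xw) // joined_csym.
by exists f; split=> // x; exact/fE/connect0.
Qed.

Lemma comp_eq (D' : obdiag s u) :
  (forall f : stack s t u -> bool,
     compat D2 (f \o lower u) -> compat D1 (f \o upper s) ->
     compat D' (f \o outer t)) ->
  comp_diag D1 D2 = D'.
Proof.
move=> H; apply: compat_ext => g gD.
have [f [Ef H2 H1]] := compat_extend false gD.
by rewrite -(eq_compat _ Ef); exact: H.
Qed.

(** The indicator function of a closed loop is a compatible labelling that vanishes at all outer
    nodes but not at the middle nodes of the loop. *)
Lemma loops_eq0 :
  (forall f : stack s t u -> bool,
     compat D2 (f \o lower u) -> compat D1 (f \o upper s) ->
     (forall x, f (outer t x) = false) -> forall i, f (inl (inr i)) = false) ->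
  loops D1 D2 = 0%N.
Proof.
move=> H; rewrite /loops /n_comp_mem; apply: eq_card0 => z; rewrite !inE.
apply/negP => /andP[_ no].
have nox x : connect jn z (outer t x) = false.
  rewrite joined_csym; apply/negbTE; apply: contra no => xz.
  by apply/existsP; exists x.
have /const_stack_compat/andP[H2 H1] :
    forall w v, connect jn w v -> connect jn z w = connect jn z v.
  by move=> w v wv; rewrite (same_connect_r joined_csym wv).
have := H _ H2 H1 nox.
case: z no nox {H H1 H2} => [[i|i]|i] no nox H.
- by have := nox (inl i); rewrite connect0.
- by have := H i; rewrite connect0.
by have := nox (inr i); rewrite connect0.
Qed.
End Composite.

(** * Labellings by lists of booleans *)

Definition slab k l (l1 l2 : seq bool) (x : node k l) : bool :=
  match x with inl i => nth false l1 i | inr j => nth false l2 j end.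

(** With lists in place of functions on ordinals, tensor products become concatenations and no cast
    into the ordinals below [size (s1 ++ s2)] appears. *)
Definition rel_diag s t (D : obdiag s t) (l1 l2 : seq bool) : bool :=
  [&& size l1 == size s, size l2 == size t & compat D (slab l1 l2)].

Lemma nth_codom n (f : 'I_n -> bool) (i : 'I_n) : nth false (codom f) i = f i.
Proof. by rewrite (nth_map i) ?size_enum_ord ?nth_ord_enum. Qed.

Lemma rel_compatP s t (D : obdiag s t) (f : _ -> bool) :
  compat D f -> rel_diag D (codom (fun i => f (inl i))) (codom (fun j => f (inr j))).
Proof.
move=> Df; rewrite /rel_diag !size_codom !card_ord !eqxx /=.
by rewrite -(eq_compat D (f := f)) // => -[] i /=; rewrite nth_codom.
Qed.

Lemma rel_compat s t (D : obdiag s t) (f : _ -> bool) :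
  rel_diag D (codom (fun i => f (inl i))) (codom (fun j => f (inr j))) -> compat D f.
Proof.
case/and3P => _ _; rewrite (eq_compat D (g := f)) // => -[] i /=;
  by rewrite nth_codom.
Qed.

Lemma rel_ext s t (D D' : obdiag s t) :
  (forall l1 l2, rel_diag D l1 l2 -> rel_diag D' l1 l2) -> D = D'.
Proof. by move=> H; apply: compat_ext => f /rel_compatP/H/rel_compat. Qed.

Lemma rel_compP s t u (D1 : obdiag t u) (D2 : obdiag s t) l1 l3 :
  rel_diag (comp_diag D1 D2) l1 l3 ->
  exists2 l2, rel_diag D2 l1 l2 & rel_diag D1 l2 l3.
Proof.
case/and3P=> s1 s3 /(compat_extend false)[f [Ef f2 f1]].
exists (codom (fun j => f (inl (inr j)))).
  rewrite /rel_diag s1 size_codom card_ord eqxx /=.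
  rewrite -(eq_compat D2 (f := f \o lower u)) // => -[] i /=; last by rewrite nth_codom.
  exact: (Ef (inl i)).
rewrite /rel_diag s3 size_codom card_ord eqxx /=.
rewrite -(eq_compat D1 (f := f \o upper s)) // => -[] i /=; first by rewrite nth_codom.
exact: (Ef (inr i)).
Qed.

Lemma rel_comp s t u (D1 : obdiag t u) (D2 : obdiag s t) l1 l2 l3 :
  rel_diag D2 l1 l2 -> rel_diag D1 l2 l3 -> rel_diag (comp_diag D1 D2) l1 l3.
Proof.
move=> /and3P[z1 _ c2] /and3P[_ z3 c1]; rewrite /rel_diag z1 z3.
pose f (z : stack s t u) : bool := match z with
  | inl (inl i) => nth false l1 i | inl (inr i) => nth false l2 i
  | inr i => nth false l3 i end.
rewrite (eq_compat _ (g := f \o outer t)); last by case.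
have E2 : slab l1 l2 =1 f \o lower u by case.
have E1 : slab l2 l3 =1 f \o upper s by case.
by apply: compat_comp; [rewrite -(eq_compat D2 E2) | rewrite -(eq_compat D1 E1)].
Qed.

Lemma comp_eq_rel s t u (D1 : obdiag t u) (D2 : obdiag s t) (D : obdiag s u) :
  (forall l1 l2 l3, rel_diag D2 l1 l2 -> rel_diag D1 l2 l3 -> rel_diag D l1 l3) ->
  comp_diag D1 D2 = D.
Proof.
move=> H; apply: comp_eq => f f2 f1; apply: rel_compat.
exact: H (rel_compatP f2) (rel_compatP f1).
Qed.

Lemma loops0_rel s t u (D1 : obdiag t u) (D2 : obdiag s t) :
  (forall l2, rel_diag D2 (nseq (size s) false) l2 ->
     rel_diag D1 l2 (nseq (size u) false) -> l2 = nseq (size t) false) ->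
  loops D1 D2 = 0%N.
Proof.
have E n (g : 'I_n -> bool) : g =1 xpred0 -> codom g = nseq n false.
  move=> g0; apply: (@eq_from_nth _ false); first by rewrite size_nseq size_codom
    card_ord.
  rewrite size_codom card_ord => i lt_in.
  by rewrite nth_nseq lt_in -[i]/(val (Ordinal lt_in)) nth_codom g0.
move=> H; apply: loops_eq0 => f f2 f1 f0 i.
have /= r2 := rel_compatP f2; have /= r1 := rel_compatP f1.
rewrite (E _ (fun i => _) (fun i => f0 (inl i))) in r2.
rewrite (E _ (fun i => _) (fun i => f0 (inr i))) in r1.
have := nth_codom (fun i => f (inl (inr i))) i.
by rewrite (H _ r2 r1) nth_nseq ltn_ord.
Qed.

Lemma rel_tens s1 t1 s2 t2 (D1 : obdiag s1 t1) (D2 : obdiag s2 t2) l1 l2 m1 m2 :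
  size l1 = size s1 -> size m1 = size t1 ->
  rel_diag (tens_diag D1 D2) (l1 ++ l2) (m1 ++ m2) =
  rel_diag D1 l1 m1 && rel_diag D2 l2 m2.
Proof.
move=> zl zm; rewrite /rel_diag compat_tens.
have -> : (size (l1 ++ l2) == size (s1 ++ s2)) = (size l2 == size s2).
  by rewrite !size_cat zl eqn_add2l.
have -> : (size (m1 ++ m2) == size (t1 ++ t2)) = (size m2 == size t2).
  by rewrite !size_cat zm eqn_add2l.
have -> : compat D1 (slab (l1 ++ l2) (m1 ++ m2) \o lnode s2 t2) = compat D1 (slab l1 m1).
  by apply: eq_compat => -[] i /=; rewrite nth_cat ?zl ?zm ltn_ord.
have -> : compat D2 (slab (l1 ++ l2) (m1 ++ m2) \o rnode s1 t1) = compat D2 (slab l2 m2).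
  by apply: eq_compat => -[] i /=; rewrite nth_cat ?zl ?zm ltnNge leq_addr /= addKn.
by rewrite zl zm !eqxx; case: (_ == _); case: (_ == _); rewrite //= ?andbF.
Qed.

Lemma rel_tensI s1 t1 s2 t2 (D1 : obdiag s1 t1) (D2 : obdiag s2 t2) l1 l2 m1 m2 :
  rel_diag D1 l1 m1 -> rel_diag D2 l2 m2 ->
  rel_diag (tens_diag D1 D2) (l1 ++ l2) (m1 ++ m2).
Proof.
by move=> r1 r2; have /and3P[/eqP z1 /eqP z2 _] := r1; rewrite rel_tens // r1.
Qed.

Lemma rel_tensP s1 t1 s2 t2 (D1 : obdiag s1 t1) (D2 : obdiag s2 t2) l m :
  rel_diag (tens_diag D1 D2) l m ->
  exists l1 l2 m1 m2, [/\ l = l1 ++ l2, m = m1 ++ m2,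
                          rel_diag D1 l1 m1 & rel_diag D2 l2 m2].
Proof.
move=> H; case/and3P: (H) => /eqP zl /eqP zm _; rewrite !size_cat in zl zm.
exists (take (size s1) l), (drop (size s1) l), (take (size t1) m), (drop (size t1) m).
rewrite !cat_take_drop; split=> //.
all: move: H; rewrite -{1}(cat_take_drop (size s1) l) -{1}(cat_take_drop (size t1) m).
all: by rewrite rel_tens ?size_takel ?zl ?zm ?leq_addr // => /andP[].
Qed.

Lemma rel_id s l m : rel_diag (id_diag s) l m = (size l == size s) && (l == m).
Proof.
rewrite /rel_diag; case: eqP => //= zl; apply/andP/eqP => [[/eqP zm /compatP H]|<-].
  apply: (@eq_from_nth _ false); first by rewrite zl zm.
  rewrite zl => i lt_i; have := H (inl (Ordinal lt_i)).
  by rewrite (mate_id _).1 /= => ->.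
by rewrite zl; split=> //; apply/compatP => -[] i; have [E1 E2] := mate_id i;
  rewrite ?E1 ?E2.
Qed.

(** Indexed by the sign of the left node, whence the names: [A_minus] has source $(+,-)$, while it
    is [U_plus] that has target $(+,-)$. *)
Definition cap e : obdiag [:: e; ~~ e] [::] :=
  match e with true => A_minus | false => A_plus end.
Definition cup e : obdiag [::] [:: e; ~~ e] :=
  match e with true => U_plus | false => U_minus end.

Lemma size_rel s t (D : obdiag s t) l m :
  rel_diag D l m -> size l = size s /\ size m = size t.
Proof. by case/and3P => /eqP-> /eqP->. Qed.

Lemma compat_arc s t (D : obdiag s t) (L : eqType) (f : _ -> L) x y :
  (x, y) \in obarcs D -> compat D f -> f x = f y.
Proof. by case/mate_arc=> <- _ /compatP ->. Qed.

Local Notation "[ 'bt' i ]" := (inl (@Ordinal 2 i isT)).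
Local Notation "[ 'tp' i ]" := (inr (@Ordinal 2 i isT)).

Lemma rel_cap e l m : rel_diag (cap e) l m -> m = [::] /\ exists a, l = [:: a; a].
Proof.
move=> H; case/and3P: (H) => + + C.
case: l m H C => [|a [|b [|]]] [|] //= H C _ _; split=> //; exists a.
case: e {H} C => C.
  have /= -> // := compat_arc (D := cap true) (x := [bt 1]) (y := [bt 0]) _ C.
  by rewrite /obarcs /= inE.
have /= -> // := compat_arc (D := cap false) (x := [bt 0]) (y := [bt 1]) _ C.
by rewrite /obarcs /= inE.
Qed.

Lemma rel_cup e l m : rel_diag (cup e) l m -> l = [::] /\ exists a, m = [:: a; a].
Proof.
move=> H; case/and3P: (H) => + + C.
case: l m H C => [|] [|a [|b [|]]] //= H C _ _; split=> //; exists a.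
case: e {H} C => C.
  have /= -> // := compat_arc (D := cup true) (x := [tp 0]) (y := [tp 1]) _ C.
  by rewrite /obarcs /= inE.
have /= -> // := compat_arc (D := cup false) (x := [tp 1]) (y := [tp 0]) _ C.
by rewrite /obarcs /= inE.
Qed.

Lemma rel_cupC e a : rel_diag (cup e) [::] [:: a; a].
Proof.
by rewrite /rel_diag; apply/compatP => -[] [[|[|]]] // i; case: mate => -[[|[|]]].
Qed.

Lemma rel_capC e a : rel_diag (cap e) [:: a; a] [::].
Proof.
by rewrite /rel_diag; apply/compatP => -[] [[|[|]]] // i; case: mate => -[[|[|]]].
Qed.

Definition crosses e1 e2 (D : obdiag [:: e1; e2] [:: e2; e1]) : Prop :=
  forall l m, rel_diag D l m -> exists a b, l = [:: a; b] /\ m = [:: b; a].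

Lemma rel_X : crosses X_diag.
Proof.
move=> l m H; case/and3P: (H) => + + C.
case: l m H C => [|a [|b [|]]] [|c [|d [|]]] //= H C _ _; exists a, b; split=> //.
have /= -> := compat_arc (D := X_diag) (x := [tp 0]) (y := [bt 1]) _ C.
  have /= -> // := compat_arc (D := X_diag) (x := [tp 1]) (y := [bt 0]) _ C.
  by rewrite /obarcs /= !inE.
by rewrite /obarcs /= !inE.
Qed.

(** * Generation of the oriented Brauer diagrams *)

(** The condition on [loops] makes the composite an honest product of basis elements, free of powers
    of $\delta$, so that a property of the factors passes to the composite even if $\delta=0$. The
    arcs $I^+$ and $I^-$ are instances of [gen_id]. *)
Inductive generated : forall s t, obdiag s t -> Prop :=
| gen_id s : generated (id_diag s)
| gen_X : generated X_diag
| gen_A_plus : generated A_plus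
| gen_A_minus : generated A_minus
| gen_U_plus : generated U_plus
| gen_U_minus : generated U_minus
| gen_tens s1 t1 s2 t2 (D1 : obdiag s1 t1) (D2 : obdiag s2 t2) :
    generated D1 -> generated D2 -> generated (tens_diag D1 D2)
| gen_comp s t u (D1 : obdiag t u) (D2 : obdiag s t) :
    generated D1 -> generated D2 -> loops D1 D2 = 0%N ->
    generated (comp_diag D1 D2).

Lemma gen_cap e : generated (cap e).
Proof. by case: e; constructor. Qed.

Lemma gen_cup e : generated (cup e).
Proof. by case: e; constructor. Qed.

(** A single analysis of the labellings of the stack gives two facts: its components join the outer
    nodes as [D] does, and each of them reaches an outer node. *)
Lemma gen_comp_eq s t u (D1 : obdiag t u) (D2 : obdiag s t) (D : obdiag s u) :
  generated D1 -> generated D2 ->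
  (forall l1 l2 l3, rel_diag D2 l1 l2 -> rel_diag D1 l2 l3 ->
    rel_diag D l1 l3 /\
    (l1 = nseq (size s) false -> l3 = nseq (size u) false -> l2 = nseq (size t) false)) ->
  generated D.
Proof.
move=> g1 g2 H; have <- : comp_diag D1 D2 = D.
  by apply: comp_eq_rel => l1 l2 l3 r2 r1; case: (H _ _ _ r2 r1).
apply: gen_comp => //; apply: loops0_rel => l2 r2 r1.
by have [_ ->] := H _ _ _ r2 r1.
Qed.

Lemma rel_id_tens s0 s t (D : obdiag s t) l m :
  rel_diag (tens_diag (id_diag s0) D) l m ->
  exists l0 l1 m1, [/\ l = l0 ++ l1, m = l0 ++ m1, size l0 = size s0 & rel_diag D l1 m1].
Proof.
case/rel_tensP=> l0 [l1 [m0 [m1 [-> ->]]]].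
by rewrite rel_id => /andP[/eqP z /eqP <-] r; exists l0, l1, m1.
Qed.

Lemma rel_tens_id s0 s t (D : obdiag s t) l m :
  rel_diag (tens_diag D (id_diag s0)) l m ->
  exists l0 l1 m1, [/\ l = l1 ++ l0, m = m1 ++ l0, size l0 = size s0 & rel_diag D l1 m1].
Proof.
case/rel_tensP=> l1 [l0 [m1 [m0 [-> -> r]]]].
by rewrite rel_id => /andP[/eqP z /eqP <-]; exists l0, l1, m1.
Qed.

Lemma size1P (l : seq bool) : size l = 1%N -> exists a, l = [:: a].
Proof. by case: l => [|a []] // _; exists a. Qed.

Lemma size2P (l : seq bool) : size l = 2%N -> exists a b, l = [:: a; b].
Proof. by case: l => [|a [|b []]] // _; exists a, b. Qed.

(* Turning a crossing by a quarter: the strand e2 is bent down on the left and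
   up on the right. *)
Lemma rotate_crossing e1 e2 (C : obdiag [:: e1; e2] [:: e2; e1]) :
  generated C -> crosses C ->
  exists2 C' : obdiag [:: ~~ e2; e1] [:: e1; ~~ e2], generated C' & crosses C'.
Proof.
move=> gC cC.
(* The source of [cap (~~ e2)] contains [~~ ~~ e2], which reduces to [e2] only once the sign is
   concrete. *)
have [capl gcapl rcapl] : exists2 c : obdiag [:: ~~ e2; e2] [::], generated c &
    forall l m, rel_diag c l m -> m = [::] /\ exists a, l = [:: a; a].
  by case: (e2); [exists (cap false) | exists (cap true)];
    first [exact: gen_cap | exact: rel_cap].
pose E1 : obdiag [:: ~~ e2; e1] [:: ~~ e2; e1; e2; ~~ e2] :=
  tens_diag (id_diag [:: ~~ e2; e1]) (cup e2).
pose E2 : obdiag [:: ~~ e2; e1; e2; ~~ e2] [:: ~~ e2; e2; e1; ~~ e2] :=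
  tens_diag (id_diag [:: ~~ e2]) (tens_diag C (id_diag [:: ~~ e2])).
pose E3 : obdiag [:: ~~ e2; e2; e1; ~~ e2] [:: e1; ~~ e2] :=
  tens_diag capl (id_diag [:: e1; ~~ e2]).
have g1 : generated E1 by exact: (gen_tens (gen_id [:: ~~ e2; e1]) (gen_cup e2)).
have g2 : generated E2.
  exact: (gen_tens (gen_id [:: ~~ e2]) (gen_tens gC (gen_id [:: ~~ e2]))).
have g3 : generated E3 by exact: (gen_tens gcapl (gen_id [:: e1; ~~ e2])).
have r1 l m : rel_diag E1 l m -> exists a b c, l = [:: a; b] /\ m = [:: a; b; c; c].
  case/(rel_id_tens (s0 := [:: ~~ e2; e1]) (D := cup e2)) =>
    l0 [l1 [m1 [-> -> /size2P[a [b ->]]]]].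
  by case/rel_cup => -> [c ->]; exists a, b, c.
have r2 l m : rel_diag E2 l m ->
    exists a b c d, l = [:: a; b; c; d] /\ m = [:: a; c; b; d].
  case/(rel_id_tens (s0 := [:: ~~ e2]) (D := tens_diag C (id_diag [:: ~~ e2]))) =>
    l0 [l1 [m1 [-> -> /size1P[a ->]]]].
  case/(rel_tens_id (s0 := [:: ~~ e2]) (D := C)) => l2 [l3 [m2 [-> -> /size1P[d ->]]]].
  by case/cC => b [c [-> ->]]; exists a, b, c, d.
have r3 l m : rel_diag E3 l m -> exists a b c, l = [:: a; a; b; c] /\ m = [:: b; c].
  case/(rel_tens_id (s0 := [:: e1; ~~ e2]) (D := capl)) =>
    l2 [l3 [m2 [-> -> /size2P[b [c ->]]]]].
  by case/rcapl => -> [a ->]; exists a, b, c.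
exists (comp_diag E3 (comp_diag E2 E1)).
  apply: gen_comp => //.
    apply: gen_comp => //; apply: loops0_rel => l2 /r1[a [b [c [/= E ->]]]].
    by case/r2 => a' [b' [c' [d' [E' E'']]]]; case: E => ? ?; case: E' => ? ? ? ?;
      subst; case: E'' => ? ?; subst.
  apply: loops0_rel => l2 /rel_compP[l1 /r1[a [b [c [/= E ->]]]]].
  case/r2 => a' [b' [c' [d' [E' ->]]]] /r3[a'' [b'' [c'' [E1' E2']]]].
  by case: E => ? ?; case: E' => ? ? ? ?; case: E1' => ? ? ? ?; case: E2' => ? ?; subst.
move=> l m /rel_compP[l2 /rel_compP[l1 /r1[a [b [c [-> ->]]]]]].
case/r2 => a' [b' [c' [d' [[<- <- <- <-] ->]]]].
case/r3 => a'' [b'' [c'' [[<- <- <- <-] ->]]].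
by exists c, b.
Qed.

(** Successive quarter turns of [X_diag] have the sources $(+,+)$, $(-,+)$, $(-,-)$, $(+,-)$, which
    exhausts the signs. *)
Lemma crossing_exists e1 e2 :
  exists2 C : obdiag [:: e1; e2] [:: e2; e1], generated C & crosses C.
Proof.
have [C1 g1 c1] := rotate_crossing gen_X rel_X.
have [C2 g2 c2] := rotate_crossing g1 c1.
have [C3 g3 c3] := rotate_crossing g2 c2.
case: e1 e2 => [] [].
- by exists X_diag; [exact: gen_X | exact: rel_X].
- by exists C3.
- by exists C1.
by exists C2.
Qed.

Lemma cup_exists e : exists2 c : obdiag [::] [:: ~~ e; e], generated c &
  forall l m, rel_diag c l m -> l = [::] /\ exists a, m = [:: a; a].
Proof.
by case: e; [exists (cup false) | exists (cup true)];
  first [exact: gen_cup | exact: rel_cup].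
Qed.

(* D is recovered from its left strand bent upwards by capping that strand. *)
Lemma gen_bend :
  (forall t (D : obdiag [::] t), generated D) ->
  forall s t (D : obdiag s t), generated D.
Proof.
move=> G; elim=> [|e s IH] t D; first exact: G.
have [c _ rc] := cup_exists e.
(* [comp_diag F2 F1] is [D] with its leftmost bottom node bent to the top. Its source is [s], so the
   induction hypothesis applies to it. *)
pose F1 : obdiag s [:: ~~ e, e & s] := tens_diag c (id_diag s).
pose F2 : obdiag [:: ~~ e, e & s] (~~ e :: t) := tens_diag (id_diag [:: ~~ e]) D.
pose E1 : obdiag (e :: s) [:: e, ~~ e & t] :=
  tens_diag (id_diag [:: e]) (comp_diag F2 F1).
pose E2 : obdiag [:: e, ~~ e & t] t := tens_diag (cap e) (id_diag t).
have rF l m : rel_diag (comp_diag F2 F1) l m ->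
    exists a m', m = a :: m' /\ rel_diag D (a :: l) m'.
  case/rel_compP => k /(rel_tens_id (s0 := s) (D := c)).
  case=> l0 [l1 [m1 [-> -> _ /rc[-> [a ->]]]]].
  move/(rel_id_tens (s0 := [:: ~~ e]) (D := D)).
  case=> k0 [k1 [m2 [E -> /size1P[b Eb] r]]]; subst k0; case: E r => <- <- r.
  by exists a, m2.
apply: (@gen_comp_eq _ _ _ E2 E1).
- exact: (gen_tens (gen_cap e) (gen_id t)).
- exact: (gen_tens (gen_id [:: e]) (IH _ _)).
move=> l1 l2 l3 /(rel_id_tens (s0 := [:: e]) (D := comp_diag F2 F1)).
case=> l0 [l4 [m1 [-> -> /size1P[a ->] /rF[b [m2 [-> rD]]]]]].
case/(rel_tens_id (s0 := t) (D := cap e)) => l5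
  [l6 [m3 [E12 -> _ /rel_cap[-> [d Ed]]]]]; subst l6.
case: E12 => Ea Eb Em; subst a b m2; split=> //.
by move=> [-> _] /= ->.
Qed.

Lemma crossing_pair a b l m e1 e2 (C : obdiag [:: e1; e2] [:: e2; e1]) :
  crosses C ->
  rel_diag (tens_diag (id_diag a) (tens_diag C (id_diag b))) l m ->
  exists l0 x y l1, [/\ l = l0 ++ x :: y :: l1, m = l0 ++ y :: x :: l1,
                        size l0 = size a & size l1 = size b].
Proof.
move=> cC /rel_id_tens[l0 [l1 [m1 [-> -> z0 /rel_tens_id]]]].
case=> l2 [l3 [m3 [-> -> z2 /cC[x [y [-> ->]]]]]].
by exists l0, x, y, l2.
Qed.

(* Induction on the number of strands between the two ends of the arc starting
   or ending at the leftmost top node. *)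
Lemma gen_pair (e : bool) a b (D : obdiag [::] (e :: a ++ ~~ e :: b)) :
  (forall D' : obdiag [::] (a ++ b), generated D') ->
  (forall x l1 y l2, size l1 = size a -> rel_diag D [::] (x :: l1 ++ y :: l2) -> x = y) ->
  generated D.
Proof.
elim/last_ind: a b D => [|a c IH] b D G arcD.
  (* Capping the arc closes a loop in the stack, but this composition only serves to define the rest
     [D'] of the diagram, which is generated by hypothesis. *)
  pose D' : obdiag [::] b :=
    comp_diag (tens_diag (cap e) (id_diag b) : obdiag (e :: ~~ e :: b) b) D.
  suff <- : (tens_diag (cup e) D' : obdiag [::] (e :: ~~ e :: b)) = D.
    exact: (gen_tens (gen_cup e) (G D')).
  apply/esym/rel_ext => l m rD; have [z1 zm] := size_rel rD.
  case: l z1 rD => // _; case: m zm => [|x [|y m]] //= [zm] rD.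
  have Exy := arcD x [::] y m erefl rD; rewrite -{y}Exy in rD *.
  apply: (rel_tensI (rel_cupC e x)); apply: rel_comp rD _.
  by apply: (rel_tensI (rel_capC e x)); rewrite rel_id eqxx andbT; case: zm => ->.
move: D G arcD; rewrite !cat_rcons => D G arcD.
(* [C] moves the far end of the arc one place to the left, where the induction hypothesis applies,
   and [C'] moves it back. *)
have [C _ cC] := crossing_exists c (~~ e).
have [C' gC' cC'] := crossing_exists (~~ e) c.
pose swap x y (C : obdiag [:: x; y] [:: y; x]) :
    obdiag (e :: a ++ x :: y :: b) (e :: a ++ y :: x :: b) :=
  tens_diag (id_diag (e :: a)) (tens_diag C (id_diag b)).
have swapP x y (C0 : obdiag [:: x; y] [:: y; x]) l m : crosses C0 ->
    rel_diag (swap _ _ C0) l m ->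
    exists z l0 x y l1, [/\ l = z :: l0 ++ x :: y :: l1, m = z :: l0 ++ y :: x :: l1,
                        size l0 = size a & size l1 = size b].
  move=> c0 /(crossing_pair (a := e :: a) c0).
  by case=> -[|z l0] [x' [y' [l1 [-> -> //= [z0] z1]]]]; exists z, l0, x', y', l1.
apply: (@gen_comp_eq _ _ _ (swap _ _ C') (comp_diag (swap _ _ C) D)).
- exact: (gen_tens (gen_id (e :: a)) (gen_tens gC' (gen_id b))).
- apply: IH => [//|x l1 y l2 z1 /rel_compP[l rD /(swapP _ _ _ _ _ cC)]].
  case=> z [l0 [x' [y' [l4 [El E z0 _]]]]].
  case: E => -> /eqP; rewrite eqseq_cat ?z1 ?z0 // => /andP[_ /eqP[-> _]].
  rewrite El in rD.
  by apply: (arcD z (rcons l0 x') y' l4); rewrite ?size_rcons ?z0 // cat_rcons.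
move=> l1 l2 l3 /rel_compP[l rD /(swapP _ _ _ _ _ cC)].
case=> z [l0 [x [y [l4 [El -> z0 z4]]]]] /(swapP _ _ _ _ _ cC').
case=> z' [l0' [x' [y' [l4' [E -> z0' z4']]]]].
case: E => <- /eqP; rewrite eqseq_cat ?z0 // => /andP[/eqP <- /eqP[<- <- <-]].
rewrite -El; split=> // _ Ez.
have : all (pred1 false) (z :: l0 ++ y :: x :: l4).
  have : all (pred1 false) l by rewrite Ez all_nseq orbT.
  by rewrite El /= !all_cat /= => /and5P[-> -> -> -> ->].
by move/all_pred1P => ->; congr nseq; rewrite /= !size_cat /= z0 z4.
Qed.

(** With an empty bottom row the arc at the first top node ends in the top row as well; removing it
    leaves two nodes fewer. *)
Lemma gen_nil t (D : obdiag [::] t) : generated D.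
Proof.
move: {2}(size t).+1 (ltnSn (size t)) => n; elim: n t D => // n IH [|e t] D zt.
  suff <- : id_diag [::] = D by exact: gen_id.
  by apply: mate_ext => -[] [].
have [k Ek] : exists k, mate D (inr ord0) = inr k.
  by case: (mate D _) => [[]|k] //; exists k.
have sk : nth true (e :: t) k = ~~ e.
  by rewrite -[LHS]/(starts [::] (e :: t) (inr k)) -Ek starts_mate.
case: k Ek sk => -[|j] lt_j Ek /= sk.
  by exfalso; move/eqP: sk; case: (e).
have Et : t = take j t ++ ~~ e :: drop j.+1 t.
  by rewrite -sk -drop_nth // cat_take_drop.
have zj : size (take j t) = j by rewrite size_takel // ltnW.
have arcD x l1 y l2 : size l1 = j -> rel_diag D [::] (x :: l1 ++ y :: l2) -> x = y.
  move=> z1 /and3P[_ _ /compatP/(_ (inr ord0))]; rewrite Ek /= => <-.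
  by rewrite nth_cat z1 ltnn subnn.
move: (take j t) (drop j.+1 t) zj Et D arcD zt {Ek lt_j sk} => a b <- -> D arcD zt.
apply: gen_pair arcD => D'; apply: IH.
by move: zt; rewrite /= !size_cat /= addnS !ltnS => /ltnW.
Qed.

Lemma all_generated s t (D : obdiag s t) : generated D.
Proof. exact: gen_bend gen_nil s t D. Qed.

(** * Inversions of permutations *)

(** In what follows [bool] is the field with two elements: [+] is exclusive or and [*] is
    conjunction, so parities are ordinary sums. *)
Lemma addbool (b : bool) : b + b = 0 :> bool.
Proof. by case: b. Qed.

Section Inversions.
Variables (T : finType) (r : T -> nat).
Hypothesis r_inj : injective r.
Implicit Types (p q : {perm T}) (x y : T).

Notation lt x y := (r x < r y)%N.

Lemma ltC x y : x != y -> lt y x = 1 + lt x y :> bool.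
Proof. by move=> nxy; rewrite ltnNge leq_eqVlt (inj_eq r_inj) (negPf nxy). Qed.

Lemma sum_sym (g : T -> T -> bool) :
  \sum_x \sum_y g x y =
  \sum_x \sum_y (lt x y * (g x y + g y x) : bool) + \sum_x g x x :> bool.
Proof.
have E x y : g x y = lt x y * g x y + lt y x * g x y + (x == y) * g x y :> bool.
  have [->|nxy] := eqVneq x y; first by rewrite ltnn !mul0r !add0r mul1r.
  by rewrite (ltC nxy); move: (leq _ _) (g _ _) => [] [].
under eq_bigr => x _ do (under eq_bigr => y _ do rewrite E; rewrite 2!big_split /=).
rewrite 2!big_split /= [X in _ + X + _]exchange_big /= -big_split /=; congr (_ + _).
  by apply: eq_bigr => x _; rewrite -big_split; apply: eq_bigr => y _; rewrite mulrDr.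
apply: eq_bigr => x _; rewrite (bigD1 x) //= eqxx mul1r big1 ?addr0 // => y.
by rewrite eq_sym => /negPf->; rewrite mul0r.
Qed.

(** The condition [lt x y] selects each unordered pair once, and [p] permutes the unordered
    pairs. *)
Lemma sum_lt_perm p (h : T -> T -> bool) :
  (forall x y, h x y = h y x) ->
  \sum_x \sum_y (lt x y * h (p x) (p y) : bool) =
  \sum_x \sum_y (lt x y * h x y : bool).
Proof.
move=> hC; rewrite (reindex_inj (@perm_inj _ p^-1)) /=.
under eq_bigr => x _.
  rewrite (reindex_inj (@perm_inj _ p^-1)) /=.
  under eq_bigr => y _ do rewrite !permKV.
  over.
rewrite sum_sym [X in _ + X]big1 ?addr0 => [|x _]; last by rewrite ltnn mul0r.
apply: eq_bigr => x _; apply: eq_bigr => y _; rewrite hC.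
have [->|nxy] := eqVneq x y; first by rewrite ltnn !mul0r.
have nxy' : p^-1%g x != p^-1%g y by rewrite (inj_eq perm_inj).
by rewrite (ltC nxy'); move: (leq _ _) (leq _ _) (h _ _) => [] [] [].
Qed.

Definition inversions p : bool := \sum_x \sum_y (lt x y * lt (p y) (p x) : bool).

(** Tells whether [p] changes the order of the pair. Unlike the summand of [inversions] it is
    symmetric in [x] and [y], so it may be reindexed by a permutation; this makes [inversions]
    multiplicative. *)
Let flip p x y : bool := lt x y + lt (p x) (p y).

Lemma flipC p x y : flip p x y = flip p y x.
Proof.
have [->//|nxy] := eqVneq x y; rewrite /flip (ltC nxy) [lt (p y) _]ltC
  ?(inj_eq perm_inj) //.
by move: (leq _ _) (leq _ _) => [] [].
Qed.

Lemma inversionsE p : inversions p = \sum_x \sum_y (lt x y * flip p x y : bool).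
Proof.
apply: eq_bigr => x _; apply: eq_bigr => y _.
case E: (lt x y); last by rewrite !mul0r.
rewrite /flip E (@ltC (p x)) // (inj_eq perm_inj).
by apply/eqP => Exy; move: E; rewrite Exy ltnn.
Qed.

Lemma inversionsM p q : inversions (p * q) = inversions p + inversions q.
Proof.
rewrite [inversions q]inversionsE -(sum_lt_perm p (flipC q)) -big_split /=.
apply: eq_bigr => x _; rewrite -big_split; apply: eq_bigr => y _ /=.
rewrite !permM /flip -mulrDr; have [->|nxy] := eqVneq x y; first by rewrite !ltnn.
rewrite [lt (p y) _]ltC ?(inj_eq perm_inj) // [lt (q (p y)) _]ltC ?(inj_eq perm_inj) //.
by move: (leq _ _) (leq _ _) (leq _ _) => [] [] [].
Qed.

(** For a third point [y] the pairs [a, y] and [b, y] contribute equally and cancel; only the pair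
    [a, b] is left. *)
Lemma inversions_tperm a b : a != b -> inversions (tperm a b) = true.
Proof.
move=> nab; pose h := flip (tperm a b); pose ab x := (x == a) || (x == b).
pose g x y : bool := (ab x && ~~ ab y) * h x y + ((x == a) && (y == b)) * h x y.
have h0 x y : ~~ ab x -> ~~ ab y -> h x y = 0.
  rewrite /ab !negb_or => /andP[xa xb] /andP[ya yb].
  by rewrite /h /flip !tpermD 1?eq_sym // addbool.
have gD x y : x != y -> h x y = g x y + g y x.
  move=> nxy; rewrite /g [h y x]flipC -/(h x y).
  have ne (u v w : T) (nvw : v != w) : (u == v) && (u == w) = false.
    by apply: contra_neqF nvw => /andP[/eqP<- /eqP<-].
  have nba : b != a by rewrite eq_sym.
  have := ne a x y nxy; have := ne b x y nxy; have := ne x a b nab.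
  have := ne y a b nab; have := h0 x y; rewrite /ab ![_ == x]eq_sym ![_ == y]eq_sym.
  by move: (x == a) (x == b) (y == a) (y == b) (h x y) => [] [] [] [] [] //= -> .
have E1 : \sum_x \sum_y ((ab x && ~~ ab y) * h x y : bool) = 0.
  rewrite exchange_big big1 // => y _ /=; have [yab|yab] := boolP (ab y).
    by rewrite big1 // => x _; rewrite andbF mul0r.
  rewrite (bigD1 a) //= (bigD1 b) 1?eq_sym //= big1 => [|x /andP[xa xb]].
    move: (yab); rewrite /ab !negb_or => /andP[ya yb].
    by rewrite /h /flip tpermL tpermR tpermD 1?eq_sym // !eqxx orbT;
      move: (leq _ _) (leq _ _) => [] [].
  by rewrite /ab (negPf xa) (negPf xb) mul0r.
have E2 : \sum_x \sum_y ((x == a) && (y == b) * h x y : bool) = h a b.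
  rewrite (bigD1 a) //= (bigD1 b) //= !eqxx mul1r !big1 ?addr0 // =>
    [x /negPf->|y /negPf->].
    by rewrite big1 // => y _; rewrite mul0r.
  by rewrite mul0r.
rewrite inversionsE -/h.
transitivity (\sum_x \sum_y g x y : bool).
  rewrite [RHS]sum_sym [X in _ = _ + X]big1 ?addr0 => [|x _].
    apply: eq_bigr => x _; apply: eq_bigr => y _.
    by have [->|/gD->//] := eqVneq x y; rewrite ltnn !mul0r.
  rewrite /g andbN mul0r add0r; case: eqP => [->|]; rewrite ?(negPf nab) mul0r //.
under eq_bigr => x _ do rewrite big_split /=.
rewrite big_split /= E1 E2 add0r /h /flip tpermL tpermR (ltC nab).
by case: leq.
Qed.

(** Both sides are homomorphisms with value [true] on transpositions. Since [odd_perm] is defined by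
    counting cycles, this is the bridge between signs and closed loops. *)
Lemma odd_perm_inversions p : odd_perm p = inversions p.
Proof.
have [ts -> /allP dts] := prod_tpermP p; rewrite odd_perm_prod ?(introT allP) //.
elim: ts dts => [|t ts IH] dts.
  rewrite big_nil; have := inversionsM 1 1; rewrite mulg1.
  by case: inversions.
have dt : t.1 != t.2 by exact: dts (mem_head _ _).
rewrite big_cons inversionsM inversions_tperm // -IH /=; first by case: odd.
by move=> u uts; apply: dts; rewrite inE uts orbT.
Qed.

(* The mixed pairs of a moved and a fixed point contribute evenly. *)
Lemma inversions_restrict (o : pred T) p :
  (forall x, o (p x) = o x) -> (forall x, ~~ o x -> p x = x) ->
  inversions p =
  \sum_x \sum_y (o x * o y * (lt x y * lt (p y) (p x)) : bool).
Proof.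
move=> op fixp; rewrite inversionsE.
pose g x y : bool := o x * ~~ o y * flip p x y.
have gs : \sum_x \sum_y g x y = 0.
  rewrite exchange_big big1 // => y _; have [oy|oy] := boolP (o y).
    by rewrite big1 // => x _; rewrite /g oy mulr0 mul0r.
  transitivity (\sum_x (o x * lt x y : bool) + \sum_x (o x * lt (p x) y : bool)).
    rewrite -big_split; apply: eq_bigr => x _ /=.
    by rewrite /g oy mulr1 /flip (fixp y) // mulrDr.
  rewrite [X in X + _](reindex_inj (@perm_inj _ p)) /=.
  by under eq_bigr => x _ do rewrite op; rewrite addbool.
have gs' : \sum_x \sum_y (lt x y * (g x y + g y x) : bool) = 0.
  rewrite -[RHS]gs [RHS]sum_sym [X in _ = _ + X]big1 ?addr0 // => x _.
  by rewrite /g; case: (o x); rewrite ?mul0r ?mulr0 ?mul0r.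
rewrite -[RHS]addr0 -[X in _ = _ + X]gs' -big_split; apply: eq_bigr => x _ /=.
rewrite -big_split; apply: eq_bigr => y _ /=.
  rewrite /g [flip p y x]flipC; have [->|nxy] := eqVneq x y;
    first by rewrite !ltnn !(mul0r, mulr0).
  have [ox|ox] := boolP (o x); have [oy|oy] := boolP (o y); last first.
  - by rewrite /flip !fixp // addbool !mulr0.
  - by rewrite !(mul0r, mulr0, mul1r, mulr1, add0r).
  - by rewrite !(mul0r, mulr0, mul1r, mulr1, add0r, addr0).
  rewrite /flip [lt (p y) _]ltC ?(inj_eq perm_inj) //.
  by move: (leq _ _) (leq _ _) => [] [].
Qed.
End Inversions.

(** * Parity of labelled diagrams *)

Lemma odd_sum (T : finType) (A : pred T) (F : T -> nat) :
  odd (\sum_(x | A x) F x) = \sum_(x | A x) odd (F x).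
Proof. by apply: (big_morph odd) => // m n; rewrite oddD. Qed.

Lemma odd_card (T : finType) (A : pred T) : odd #|A| = \sum_x (A x : bool).
Proof.
by rewrite -sum1_card big_mkcond odd_sum; apply: eq_bigr => x _; rewrite unfold_in;
  case: (A x).
Qed.

(** The bottom row precedes the top row, each read from left to right. Juxtaposed diagrams are
    therefore interleaved in this order; the boundary terms of [parity] compensate for that. *)
Definition nrk k l (x : node k l) : nat :=
  match x with inl i => i | inr j => (k + j)%N end.

Section SignParity.
Variables (s t : signs).
Implicit Types (D : obdiag s t) (o : node (size s) (size t) -> bool).

Definition arc_inv D o : bool :=
  \sum_(x | starts s t x) \sum_(y | starts s t y)
    (o x * o y * ((nrk x < nrk y)%N * (nrk (mate D y) < nrk (mate D x))%N) : bool).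

Definition cnt (r : signs) (o : 'I_(size r) -> bool) (b : bool) : bool :=
  \sum_(i < size r) ((nth true r i == b) * o i : bool).
(** It depends on one labelled row only; for the middle row of a stack it occurs in both factors and
    cancels. *)
Definition neg_inv (r : signs) (o : 'I_(size r) -> bool) : bool :=
  \sum_(i < size r) \sum_(j < size r)
    ((nth true r i == false) * o i * o j * (i < j)%N : bool).

(* The parity of the number of crossings of odd arcs plus the number of odd
   arcs that are cups U^- or caps A^-, as computed from the permutation which
   relates the starting points to the end points. *)
Definition parity D o : bool :=
  arc_inv D o + neg_inv (o \o inl) + neg_inv (o \o inr)
  + cnt (o \o inl) false * (cnt (o \o inr) false + cnt (o \o inr) true)
  + cnt (o \o inl) false.

Lemma sum_side (A : pred (node (size s) (size t))) b
  (F : node (size s) (size t) -> bool) :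
  (forall x, A x = (starts s t x == b)) ->
  \sum_(x | A x) F x =
  \sum_(i < size s) ((nth true s i == ~~ b) * F (inl i) : bool)
  + \sum_(j < size t) ((nth true t j == b) * F (inr j) : bool).
Proof.
move=> AE; rewrite big_mkcond big_sumType /=.
by congr (_ + _); apply: eq_bigr => i _; rewrite AE /=; case: b {AE};
   case: (nth _ _ _); rewrite /= ?mul0r ?mul1r.
Qed.

Lemma sum_mate D (F : node (size s) (size t) -> bool) :
  \sum_(x | starts s t x) F (mate D x) = \sum_(x | ~~ starts s t x) F x.
Proof.
rewrite [RHS](reindex_inj (@mate_inj _ _ D)); apply: eq_bigl => x.
by rewrite starts_mate negbK.
Qed.

Lemma startsT x : starts s t x = (starts s t x == true).
Proof. by rewrite eqb_id. Qed.
Lemma startsF x : ~~ starts s t x = (starts s t x == false).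
Proof. by rewrite eqbF_neg. Qed.

(** [mate] matches the odd starting points with the odd end points; sorting both by rows gives the
    identity modulo 2. It expresses that $F(D)$ is an even map. *)
Lemma compat_even D o : compat D o ->
  cnt (o \o inl) false + cnt (o \o inl) true =
  cnt (o \o inr) false + cnt (o \o inr) true :> bool.
Proof.
move=> /compatP Ho; have := sum_mate D o.
under eq_bigr => x _ do rewrite Ho.
rewrite (sum_side _ startsT) (sum_side _ startsF) /=.
have E (a b c d : bool) : a + d = b + c -> a + b = c + d by move: a b c d => [] [] [] [].
exact: E.
Qed.
End SignParity.

Lemma cnt_mul (r r' : signs) (o : 'I_(size r) -> bool) (o' : 'I_(size r') -> bool) b b' :
  cnt o b * cnt o' b' =
  \sum_(i < size r) \sum_(j < size r')
     ((nth true r i == b) * o i * ((nth true r' j == b') * o' j) : bool).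
Proof. by rewrite /cnt big_distrlr. Qed.

Definition pairs (r : signs) (o : 'I_(size r) -> bool) b b' : bool :=
  \sum_(i < size r) \sum_(j < size r)
     ((nth true r i == b) * o i * ((nth true r j == b') * o j) * (i < j)%N : bool).

Lemma pairsC (r : signs) (o : 'I_(size r) -> bool) b :
  pairs o b (~~ b) + pairs o (~~ b) b = cnt o b * cnt o (~~ b).
Proof.
rewrite cnt_mul /pairs [X in _ + X]exchange_big -big_split; apply: eq_bigr => i _ /=.
rewrite -big_split; apply: eq_bigr => j _ /=.
have [->|nij] := eqVneq i j.
  by rewrite ltnn; case: (nth _ _ _); case: b; case: (o j).
have -> : (j < i)%N = ~~ (i < j)%N.
  by rewrite ltnNge leq_eqVlt val_eqE (negPf nij).
by move: (_ == b) (_ == ~~ b) (o i) (o j) (i < j)%N => [] [] [] [] [].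
Qed.

Lemma sum_blocks (s t s' t' : signs) (A : pred (node (size s) (size t)))
    (A' : pred (node (size s') (size t'))) (b b' : bool)
    (o : _ -> bool) (o' : _ -> bool) (c : _ -> _ -> bool) :
  (forall x, A x = (starts s t x == b)) -> (forall x, A' x = (starts s' t' x == b')) ->
  \sum_(x | A x) \sum_(y | A' y) (o x * o' y * c x y : bool) =
  \sum_(i < size s) \sum_(j < size s') ((nth true s i == ~~ b) * o (inl i)
      * ((nth true s' j == ~~ b') * o' (inl j)) * c (inl i) (inl j) : bool)
  + \sum_(i < size s) \sum_(j < size t') ((nth true s i == ~~ b) * o (inl i)
      * ((nth true t' j == b') * o' (inr j)) * c (inl i) (inr j) : bool)
  + \sum_(i < size t) \sum_(j < size s') ((nth true t i == b) * o (inr i)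
      * ((nth true s' j == ~~ b') * o' (inl j)) * c (inr i) (inl j) : bool)
  + \sum_(i < size t) \sum_(j < size t') ((nth true t i == b) * o (inr i)
      * ((nth true t' j == b') * o' (inr j)) * c (inr i) (inr j) : bool).
Proof.
move=> AE AE'; under eq_bigr => x _ do rewrite (sum_side _ AE').
rewrite (sum_side _ AE).
rewrite -addrA; congr (_ + _); rewrite -big_split; apply: eq_bigr => i _ /=;
  rewrite mulrDr !big_distrr /=; congr (_ + _); apply: eq_bigr => j _; ring.
Qed.

Section Blocks.
Variables (r r' : signs) (p : 'I_(size r) -> bool) (p' : 'I_(size r') -> bool)
  (a b : bool).
Variable c : 'I_(size r) -> 'I_(size r') -> bool.
Let S := \sum_(i < size r) \sum_(j < size r')
  ((nth true r i == a) * p i * ((nth true r' j == b) * p' j) * c i j : bool).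

Lemma block1 : (forall i j, c i j) -> S = cnt p a * cnt p' b.
Proof.
move=> c1; rewrite cnt_mul; apply: eq_bigr => i _; apply: eq_bigr => j _.
by rewrite c1 mulr1.
Qed.

Lemma block0 : (forall i j, ~~ c i j) -> S = 0.
Proof.
by move=> c0; apply: big1 => i _; apply: big1 => j _; rewrite (negPf (c0 i j)) mulr0.
Qed.
End Blocks.

Lemma block_pairs (r : signs) (p : 'I_(size r) -> bool) a b c :
  (forall i j : 'I_(size r), c i j = (i < j)%N) ->
  \sum_(i < size r) \sum_(j < size r)
    ((nth true r i == a) * p i * ((nth true r j == b) * p j) * c i j : bool) =
      pairs p a b.
Proof. by move=> cE; apply: eq_bigr => i _; apply: eq_bigr => j _; rewrite cE. Qed.

(** Dictionary: [a1], [a2], [a3] are the values of [arc_inv] for the upper factor, the lower factor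
    and the composite, and [l] counts odd loops. The letters S, T, U stand for the bottom, middle
    and top rows, with 0 and 1 for the signs - and +: [S0] is a [cnt], [nS] a [neg_inv], and [s],
    [s'] are the two [pairs] of opposite signs. The long hypothesis equates inversions with points
    plus cycles. *)
Lemma parity_algebra (a1 a2 a3 l nS nT nU S0 S1 T0 T1 U0 U1 s s' t t' u u' : bool) :
  s + s' = S1 * S0 -> t + t' = T1 * T0 -> u + u' = U1 * U0 ->
  S0 + S1 = T0 + T1 -> T0 + T1 = U0 + U1 ->
  a2 + a1 + a3
  + ((S0 * T0 + S0 * U1 + t + T1 * U1) + (S1 * T1 + S1 * U0 + t' + T0 * U0))
  + ((s' + S0 * U0 + 0 + T1 * U0) + (s + S1 * U1 + 0 + T0 * U1))
  + ((0 + T0 * U0 + 0 + u) + (0 + T1 * U1 + 0 + u')) =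
  S0 + S1 + (T0 + T1) + (U0 + U1) + (l + (S0 + U1)) ->
  a1 + nT + nU + T0 * (U0 + U1) + T0 + (a2 + nS + nT + S0 * (T0 + T1) + S0) =
  a3 + nS + nU + S0 * (U0 + U1) + S0 + l.
Proof.
have move_r (x y z : bool) : x + y = z -> y = x + z by move: x y z => [] [] [].
have move_m (x y z v w : bool) : x + y + z + v = w -> y = x + z + (v + w).
  by move: x y z v w => [] [] [] [] [].
move=> /move_r-> /move_r-> /move_r-> ES ET.
rewrite -addrA -[X in X = _]addrA => /move_m ->.
set m := (X in a2 + a3 + X).
have {m} -> : m = l + (T0 * (U0 + U1) + T0 + S0 * (T0 + T1) + S0 * (U0 + U1)).
  rewrite {}/m; move: ES ET.
  by move: S0 S1 T0 T1 U0 U1 s t u l => [] [] [] [] [] [] // [] [] [] [].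
by move: a2 a3 l nS nT nU S0 T0 T1 U0 U1 {ES ET}
  => [] [] [] [] [] [] [] [] [] [] [].
Qed.

(** A pair of arcs is inverted exactly when the order of the tails differs from the order of the
    heads, so its contribution is a sum of two comparisons. The one for the heads is reindexed by
    the involutions, after which the matching of tails with heads has disappeared: mixed pairs
    depend on the labelled rows alone. *)
Lemma mixed_pairs (T : finType) (r : T -> nat) (nx : T -> T) (o : T -> bool)
    (G := fun z w => o z * o w * ((r z < r w)%N * (r (nx w) < r (nx z))%N) : bool)
    (I J : finType) (A : pred I) (B : pred J) (f : I -> T) (k : J -> T) m m' :
  injective r -> injective nx -> involutive m -> involutive m' ->
  (forall x, A x -> nx (f x) = f (m x)) ->
  (forall y, B y -> nx (k y) = k (m' y)) ->
  (forall x y, A x -> B y -> f x <> k y) ->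
  (forall x, o (f (m x)) = o (f x)) -> (forall y, o (k (m' y)) = o (k y)) ->
  \sum_(x | A x) \sum_(y | B y) (G (f x) (k y) + G (k y) (f x)) =
  \sum_(x | A x) \sum_(y | B y) (o (f x) * o (k y) * (r (f x) < r (k y))%N : bool)
  + \sum_(x | A (m x)) \sum_(y | B (m' y)) (o (f x) * o (k y) * (r (f x) < r (k y))%N :
    bool).
Proof.
move=> r_inj nx_inj mK mK' Ef Ek nfk om om'.
have crossed z w : z <> w -> G z w + G w z =
    o z * o w * ((r z < r w)%N + (r (nx z) < r (nx w))%N) :> bool.
  move=> nzw; have nzw' : nx z <> nx w by move/nx_inj.
  have L v v' : v <> v' -> (r v' < r v)%N = ~~ (r v < r v')%N.
    by move=> nv; rewrite -leqNgt [RHS]leq_eqVlt (inj_eq r_inj); case: eqP => // E;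
      case: nv.
  rewrite /G (L _ _ nzw) (L _ _ nzw').
  by move: (o z) (o w) (leq _ _) (leq _ _) => [] [] [] [].
rewrite [X in _ = _ + X](reindex_inj (inv_inj mK)) /=.
rewrite [X in _ = _ + X](eq_bigl A) => [|x]; last by rewrite mK.
rewrite -big_split; apply: eq_bigr => x Ax /=.
rewrite [X in _ = _ + X](reindex_inj (inv_inj mK')) /=.
rewrite [X in _ = _ + X](eq_bigl B) => [|y]; last by rewrite mK'.
rewrite -big_split; apply: eq_bigr => y By /=.
rewrite om om' -mulrDr -Ef // -Ek //.
by rewrite crossed //; exact: nfk.
Qed.

(** * Parity of a composite diagram *)

Section CompositeParity.
Variables (s t u : signs) (D1 : obdiag t u) (D2 : obdiag s t).
Notation M := (stack s t u).
Notation jn := (joined D1 D2).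
Notation D := (comp_diag D1 D2).
Variable o : M -> bool.
Hypothesis o_const : forall z w, connect jn z w -> o z = o w.

(* Closing up every strand of the stacked diagram by the reversed arc of the
   composite turns the components into cycles of a permutation. *)
Definition next (b : bool) (z : M) : M :=
  match z with
  | inl (inl i) => if ~~ nth true s i == b then lower u (mate D2 (inl i))
                   else outer t (mate D (inl i))
  | inl (inr j) => if nth true t j == b then lower u (mate D2 (inr j))
                   else upper s (mate D1 (inl j))
  | inr k => if nth true u k == b then upper s (mate D1 (inr k))
             else outer t (mate D (inr k))
  end.

Lemma next_lower b x : starts s t x = b -> next b (lower u x) = lower u (mate D2 x).
Proof. by case: x => i /= ->; rewrite eqxx. Qed.

Lemma next_upper b x : starts t u x = b -> next b (upper s x) = upper s (mate D1 x).
Proof. by case: x => i /= <-; rewrite ?eqxx //; case: nth. Qed.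

Lemma next_outer b x : starts s u x = ~~ b -> next b (outer t x) = outer t (mate D x).
Proof. by case: x => i /= ->; case: b. Qed.

(** For [b = true] these are the ways to leave a node: along an arc of [D2], along an arc of [D1],
    or, at an outer end point, back along the reversed arc of the composite. With [b = false] the
    cycles are traversed backwards. *)
Variant stack_spec b : M -> Type :=
| StackLower x : starts s t x = b -> stack_spec b (lower u x)
| StackUpper x : starts t u x = b -> stack_spec b (upper s x)
| StackOuter x : starts s u x = ~~ b -> stack_spec b (outer t x).

Lemma stackP b z : stack_spec b z.
Proof.
case: z => [[i|j]|k].
- have [E|/eqP E] := eqVneq (~~ nth true s i) b; first exact: (@StackLower b (inl i)).
  by apply: (@StackOuter b (inl i)); move: E; case: b; rewrite /=; case: nth.
- have [E|/eqP E] := eqVneq (nth true t j) b; first exact: (@StackLower b (inr j)).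
  by apply: (@StackUpper b (inl j)); move: E; case: b; rewrite /=; case: nth.
have [E|/eqP E] := eqVneq (nth true u k) b; first exact: (@StackUpper b (inr k)).
by apply: (@StackOuter b (inr k)); move: E; case: b; rewrite /=; case: nth.
Qed.

Lemma nextK b : cancel (next b) (next (~~ b)).
Proof.
move=> z; case: (stackP b z) => x sx.
- by rewrite next_lower // next_lower ?starts_mate ?sx // mateK.
- by rewrite next_upper // next_upper ?starts_mate ?sx // mateK.
by rewrite next_outer // next_outer ?starts_mate ?sx // mateK.
Qed.

Lemma connect_next b z : connect jn z (next b z).
Proof.
case: (stackP b z) => x sx.
- by rewrite next_lower //; apply/connect1/joined_lower.
- by rewrite next_upper //; apply/connect1/joined_upper.
by rewrite next_outer //; exact: connect_outer_mate.
Qed.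

Definition odd_next b z : M := if o z then next b z else z.

Lemma odd_odd_next b z : o (odd_next b z) = o z.
Proof. by rewrite /odd_next; case: ifP => // oz;
  rewrite -(o_const (connect_next b z)). Qed.

Lemma odd_nextK b : cancel (odd_next b) (odd_next (~~ b)).
Proof.
move=> z; rewrite {1}/odd_next odd_odd_next /odd_next.
by case: (o z); rewrite ?nextK.
Qed.

Definition closure : {perm M} := perm (can_inj (odd_nextK true)).

Lemma porbit_closure z w : w \in porbit closure z = if o z then connect jn z w else z ==
  w.
Proof.
have oc v i : connect jn v ((closure ^+ i)%g v) &&
  ((~~ o v) ==> ((closure ^+ i)%g v == v)).
  elim: i => [|i /andP[IH1 IH2]]; first by rewrite perm1 connect0 eqxx implybT.
  rewrite expgSr permM permE /odd_next; apply/andP; split.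
    by case: ifP => _ //; apply: connect_trans IH1 (connect_next _ _).
  by apply/implyP => ov; move: IH2; rewrite ov => /eqP->; rewrite (negPf ov).
have [oz|oz] := boolP (o z); last first.
  apply/porbitP/eqP => [[i ->]|<-]; last by exists 0%N; rewrite perm1.
  by have /andP[_] := oc z i; rewrite oz => /eqP.
apply/porbitP/idP => [[i ->]|]; first by case/andP: (oc z i).
move=> zw; apply/porbitP; move: zw => /connectP[p].
elim: p z oz => [z oz _ ->|v p IH z oz /= /andP[zv pv] Ew]; first exact: porbit_id.
have ov : o v by rewrite -(o_const (connect1 zv)).
have {IH} := IH v ov pv Ew; rewrite -!eq_porbit_mem eq_sym => /eqP <-.
have next_orbit y y' : o y -> next true y = y' -> porbit closure y = porbit closure y'.
  move=> oy <-; apply/eqP; rewrite eq_porbit_mem porbit_sym.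
  by have := mem_porbit closure 1 y; rewrite expg1 permE /odd_next oy.
apply/eqP; case: (joinedP zv) => -[x Ez Ev].
  have [sx|sx] := boolP (starts s t x).
    by apply/esym/next_orbit; rewrite // Ez next_lower.
  by apply/next_orbit; rewrite // Ev next_lower ?starts_mate // mateK.
have [sx|sx] := boolP (starts t u x).
  by apply/esym/next_orbit; rewrite // Ez next_upper.
by apply/next_orbit; rewrite // Ev next_upper ?starts_mate // mateK.
Qed.

(** The parity of a permutation is the number of points plus the number of cycles. An even node is
    fixed and is counted in both, so only odd nodes and odd components remain. *)
Lemma odd_closure :
  odd_perm closure = \sum_z (o z : bool) + \sum_z (roots jn z && o z : bool).
Proof.
(* One representative for each cycle: an even node itself, and the root of an odd component. *)
pose A := [pred z | o z ==> roots jn z].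
have cA : #|porbits closure| = #|A|.
  have <- : porbit closure @: A = porbits closure.
    apply/setP => B; apply/imsetP/imsetP => [[z _ ->]|[z _ ->]]; first by exists z.
    have [oz|oz] := boolP (o z); last by exists z; rewrite // inE (negPf oz).
    exists (fingraph.root jn z).
      by rewrite inE (roots_root (@joined_csym _ _ _ D1 D2)) implybT.
    apply/eqP; rewrite eq_porbit_mem porbit_sym porbit_closure oz.
    exact: connect_root.
  apply: card_in_imset => z w; rewrite !inE => Az Aw /eqP.
  rewrite eq_porbit_mem porbit_sym porbit_closure.
  case: ifP => oz; last by move/eqP.
  move=> zw; have ow : o w by rewrite -(o_const zw).
  move: Az Aw; rewrite oz ow /= => /eqP <- /eqP <-.
  by apply/eqP; rewrite root_connect //; exact: joined_csym.
rewrite /odd_perm cA !odd_card -big_split -big_split; apply: eq_bigr => z _ /=.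
by case: (o z); case: (roots _ _).
Qed.

(** This order of the stack restricts to the order [nrk] on both factors and on the composite, so
    one permutation yields all three values of [arc_inv]. *)
Definition srk (z : M) : nat :=
  match z with inl x => nrk x | inr k => (size s + size t + k)%N end.

Lemma srk_inj : injective srk.
Proof.
move=> [[i|i]|i] [[j|j]|j] /= E; do ?[congr inl]; do ?[congr inr]; do ?[congr inl];
  do ?[apply: val_inj]; rewrite /=; have := ltn_ord i; have := ltn_ord j; try lia.
Qed.

Notation lt x y := (srk x < srk y)%N.

(** Every node of the stack is the tail of exactly one arc of [D2], arc of [D1] or reversed arc of
    the composite. *)
Lemma sum_stack (F : M -> bool) :
  \sum_z F z = \sum_(x | starts s t x) F (lower u x)
    + \sum_(y | starts t u y) F (upper s y) + \sum_(x | ~~ starts s u x) F (outer t x).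
Proof.
have E n (b G : 'I_n -> bool) :
    \sum_i G i = \sum_i ((b i == true) * G i : bool) + \sum_i
      ((b i == false) * G i : bool).
  by rewrite -big_split; apply: eq_bigr => i _ /=; case: (b i); case: (G i).
rewrite !(sum_side _ (@startsT _ _)) (sum_side _ (@startsF _ _)) /= !big_sumType /=.
rewrite (E _ (fun i => nth true s i) (fun i => F (inl (inl i))))
  (E _ (fun i => nth true t i) (fun i => F (inl (inr i)))).
rewrite (E _ (fun i => nth true u i) (fun i => F (inr i))); ring.
Qed.

(** A component that is not a loop contains exactly one outer starting point, so these points count
    such components. *)
Lemma sum_roots :
  \sum_z (roots jn z && o z : bool) =
  \sum_z (roots jn z && ~~ [exists x, connect jn (outer t x) z] && o z : bool)
  + \sum_(x | starts s u x) o (outer t x).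
Proof.
pose h x := fingraph.root jn (outer t x).
have sym := @joined_csym _ _ _ D1 D2.
have -> : \sum_(x | starts s u x) o (outer t x) =
          \sum_(z in h @: [pred x | starts s u x]) o z.
  rewrite big_imset => [|x y sx sy /eqP] /=.
    by apply: eq_bigr => x _; apply: o_const; exact: connect_root.
  by rewrite (root_connect sym); exact: connect_outer_eq.
rewrite [X in _ = _ + X]big_mkcond -big_split; apply: eq_bigr => z _ /=.
have -> : (z \in h @: [pred x | starts s u x]) =
          roots jn z && [exists x, connect jn (outer t x) z].
  apply/imsetP/andP => [[x sx ->]|[/eqP rz /existsP[x xz]]].
    split; first exact: (roots_root sym).
    by apply/existsP; exists x; exact: connect_root.
  have [sx|sx] := boolP (starts s u x).
    by exists x; rewrite // -rz; apply/esym/eqP; rewrite (root_connect sym).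
  exists (mate D x); first by rewrite inE starts_mate.
  rewrite -rz; apply/eqP; rewrite (root_connect sym) sym.
  by apply: connect_trans xz; rewrite sym; exact: connect_outer_mate.
by case: (roots _ _); case: [exists _, _]; case: (o z).
Qed.

Lemma sum_pairs (g : M -> M -> bool) :
  let h z w : bool := g z w + g w z in
  \sum_z \sum_w g z w =
  \sum_(x | starts s t x) \sum_(y | starts s t y) g (lower u x) (lower u y)
  + \sum_(x | starts t u x) \sum_(y | starts t u y) g (upper s x) (upper s y)
  + \sum_(x | ~~ starts s u x) \sum_(y | ~~ starts s u y) g (outer t x) (outer t y)
  + \sum_(x | starts s t x) \sum_(y | starts t u y) h (lower u x) (upper s y)
  + \sum_(x | starts s t x) \sum_(y | ~~ starts s u y) h (lower u x) (outer t y)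
  + \sum_(x | starts t u x) \sum_(y | ~~ starts s u y) h (upper s x) (outer t y).
Proof.
move=> h; rewrite sum_stack.
have S (I : finType) (A : pred I) (f : I -> M) :
    \sum_(x | A x) \sum_w g (f x) w =
    \sum_(x | A x) \sum_(y | starts s t y) g (f x) (lower u y)
    + \sum_(x | A x) \sum_(y | starts t u y) g (f x) (upper s y)
    + \sum_(x | A x) \sum_(y | ~~ starts s u y) g (f x) (outer t y).
  by rewrite -!big_split; apply: eq_bigr => x _; exact: sum_stack.
have E (I J : finType) (A : pred I) (B : pred J) (f : I -> M) (k : J -> M) :
    \sum_(x | A x) \sum_(y | B y) h (f x) (k y) =
    \sum_(x | A x) \sum_(y | B y) g (f x) (k y) + \sum_(y | B y) \sum_(x | A x) g (k y)
      (f x).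
  rewrite [X in _ = _ + X]exchange_big -big_split; apply: eq_bigr => x _ /=.
  by rewrite -big_split.
rewrite !S !E; ring.
Qed.

Let oU := o \o upper s.
Let oL := o \o lower u.
Let oO := o \o outer t.

Lemma lt_outer x y : lt (outer t x) (outer t y) = (nrk x < nrk y)%N.
Proof.
case: x y => i [] j //=; rewrite ?ltn_add2l //; have := ltn_ord i; have := ltn_ord j.
  by rewrite !ltn_neqAle; lia.
lia.
Qed.

Let G z w : bool := o z * o w * (lt z w * lt (next true w) (next true z)).

(** The parity of [closure] is computed twice, by cycles and by inversions. The inversions within
    each of the three kinds of arcs give the terms [arc_inv]; pairs of different kinds are evaluated
    by [mixed_pairs]. *)
Lemma parity_comp :
  parity D1 oU + parity D2 oL =
  parity D oO +
  \sum_z (roots jn z && ~~ [exists x, connect jn (outer t x) z] && o z : bool).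
Proof.
have [C2 C1] : compat D2 oL /\ compat D1 oU by apply/andP; exact: const_stack_compat.
have C := compat_comp C2 C1.
have I := odd_closure.
rewrite (odd_perm_inversions srk_inj) (inversions_restrict srk_inj (o := o)) in I;
  first last.
- by move=> z; rewrite permE /odd_next => /negPf->.
- by move=> z; rewrite permE odd_odd_next.
have {I} : \sum_z \sum_w G z w = \sum_z (o z : bool) + \sum_z (roots jn z && o z : bool).
  rewrite -I; apply: eq_bigr => z _; apply: eq_bigr => w _; rewrite !permE /odd_next /G.
  by case: (o z); case: (o w).
have cntE n (r : 'I_n -> bool) (F : 'I_n -> bool) :
    \sum_i F i = \sum_i ((r i == false) * F i : bool) + \sum_i
      ((r i == true) * F i : bool).
  by rewrite -big_split; apply: eq_bigr => i _ /=; case: (r i); case: (F i).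
have -> : \sum_z (o z : bool) =
    cnt (oO \o inl) false + cnt (oO \o inl) true +
      (cnt (oL \o inr) false + cnt (oL \o inr) true)
    + (cnt (oO \o inr) false + cnt (oO \o inr) true).
  by rewrite !big_sumType /=; congr (_ + _ + _); exact: cntE.
rewrite sum_roots sum_pairs /=.
have -> : \sum_(x | starts s t x) \sum_(y | starts s t y) G (lower u x) (lower u y) =
  arc_inv D2 oL.
  by apply: eq_bigr => x sx; apply: eq_bigr => y sy; rewrite /G !next_lower.
have -> : \sum_(x | starts t u x) \sum_(y | starts t u y) G (upper s x) (upper s y) =
  arc_inv D1 oU.
  apply: eq_bigr => x sx; apply: eq_bigr => y sy; rewrite /G !next_upper //.
  have E v : srk (upper s v) = (size s + nrk v)%N by case: v => v //=; rewrite addnA.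
  by rewrite !E !ltn_add2l.
(* The reversed arcs give the inverse bijection, which has the same inversions. *)
have -> : \sum_(x | ~~ starts s u x) \sum_(y | ~~ starts s u y) G (outer t x)
  (outer t y) = arc_inv D oO.
  rewrite -(sum_mate D); under eq_bigr => x _ do rewrite -(sum_mate D).
  rewrite exchange_big; apply: eq_bigr => x sx; apply: eq_bigr => y sy.
  rewrite /G !next_outer ?starts_mate ?sx ?sy // !mateK !lt_outer.
  have Ho v : o (outer t (mate D v)) = o (outer t v) by move/compatP: C; apply.
  by rewrite !Ho [o (outer t y) * _]mulrC [_ * (nrk x < _)%N]mulrC.
have mixed := mixed_pairs srk_inj (can_inj (nextK true)) (o := o).
have oLm x : o (lower u (mate D2 x)) = o (lower u x) by move/compatP: C2; apply.
have oUm x : o (upper s (mate D1 x)) = o (upper s x) by move/compatP: C1; apply.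
have oOm x : o (outer t (mate D x)) = o (outer t x) by move/compatP: C; apply.
have mT (s' t' : signs) (E : obdiag s' t') x : starts s' t' (mate E x) =
  (starts s' t' x == false).
  by rewrite starts_mate eqbF_neg.
have mF (s' t' : signs) (E : obdiag s' t') x : ~~ starts s' t' (mate E x) =
  (starts s' t' x == true).
  by rewrite starts_mate negbK eqb_id.
pose bs := oO \o inl; pose mt := oL \o inr; pose tu := oO \o inr.
(* Sorted by rows, a block between two different rows has a constant order and becomes a product of
   counts or 0, while a block within one row becomes a [pairs]. *)
have M12 : \sum_(x | starts s t x) \sum_(y | starts t u y)
      (G (lower u x) (upper s y) + G (upper s y) (lower u x)) =
    (cnt bs false * cnt mt false + cnt bs false * cnt tu true + pairs mt true false +
      cnt mt true * cnt tu true)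
    + (cnt bs true * cnt mt true + cnt bs true * cnt tu false + pairs mt false true +
      cnt mt false * cnt tu false).
  rewrite (mixed _ _ _ _ _ _ (mate D2) (mate D1)) //; try exact: mateK.
  - congr (_ + _); [rewrite (sum_blocks _ _ _ (startsT (t := t)) (startsT (t := u)))
                   | rewrite (sum_blocks _ _ _ (mT _ _ D2) (mT _ _ D1))];
      congr (_ + _ + _ + _).
    + by apply: block1 => i j /=; have := ltn_ord i; lia.
    + by apply: block1 => i j /=; have := ltn_ord i; lia.
    + by apply: block_pairs => i j /=; rewrite ?ltn_add2l.
    + by apply: block1 => i j /=; have := ltn_ord i; lia.
    + by apply: block1 => i j /=; have := ltn_ord i; lia.
    + by apply: block1 => i j /=; have := ltn_ord i; lia.
    + by apply: block_pairs => i j /=; rewrite ?ltn_add2l.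
    + by apply: block1 => i j /=; have := ltn_ord i; lia.
  - by move=> x sx; rewrite next_lower.
  - by move=> x sx; rewrite next_upper.
  by move=> x y + + E; case: x E => i; case: y => j //= [->]; case: nth.
have M13 : \sum_(x | starts s t x) \sum_(y | ~~ starts s u y)
      (G (lower u x) (outer t y) + G (outer t y) (lower u x)) =
    (pairs bs false true + cnt bs false * cnt tu false + 0 + cnt mt true * cnt tu false)
    + (pairs bs true false + cnt bs true * cnt tu true + 0 + cnt mt false * cnt tu true).
  rewrite (mixed _ _ _ _ _ _ (mate D2) (mate D)) //; try exact: mateK.
  - congr (_ + _); [rewrite (sum_blocks _ _ _ (startsT (t := t)) (startsF (t := u)))
                   | rewrite (sum_blocks _ _ _ (mT _ _ D2) (mF _ _ D))];
      congr (_ + _ + _ + _).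
    + by apply: block1 => i j /=; have := ltn_ord i; lia.
    + by apply: block0 => i j /=; have := ltn_ord j; lia.
    + by apply: block1 => i j /=; have := ltn_ord i; lia.
    + by apply: block1 => i j /=; have := ltn_ord i; lia.
    + by apply: block0 => i j /=; have := ltn_ord j; lia.
    + by apply: block1 => i j /=; have := ltn_ord i; lia.
  - by move=> x sx; rewrite next_lower.
  - by move=> x sx; rewrite next_outer // (negPf sx).
  by move=> x y + + E; case: x E => i; case: y => j //= [->]; case: nth.
have M23 : \sum_(x | starts t u x) \sum_(y | ~~ starts s u y)
      (G (upper s x) (outer t y) + G (outer t y) (upper s x)) =
    (0 + cnt mt false * cnt tu false + 0 + pairs tu true false)
    + (0 + cnt mt true * cnt tu true + 0 + pairs tu false true).
  rewrite (mixed _ _ _ _ _ _ (mate D1) (mate D)) //; try exact: mateK.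
  - congr (_ + _); [rewrite (sum_blocks _ _ _ (startsT (t := u)) (startsF (t := u)))
                   | rewrite (sum_blocks _ _ _ (mT _ _ D1) (mF _ _ D))];
      congr (_ + _ + _ + _).
    + by apply: block0 => i j /=; have := ltn_ord j; lia.
    + by apply: block1 => i j /=; have := ltn_ord i; lia.
    + by apply: block0 => i j /=; have := ltn_ord j; lia.
    + by apply: block_pairs => i j /=; rewrite ?ltn_add2l.
    + by apply: block0 => i j /=; have := ltn_ord j; lia.
    + by apply: block1 => i j /=; have := ltn_ord i; lia.
    + by apply: block0 => i j /=; have := ltn_ord j; lia.
    + by apply: block_pairs => i j /=; rewrite ?ltn_add2l.
  - by move=> x sx; rewrite next_upper.
  - by move=> x sx; rewrite next_outer // (negPf sx).
  by move=> x y + + E; case: x E => i; case: y => j //= [->]; case: nth.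
rewrite {mixed} M12 M13 M23 {M12 M13 M23}.
have PS := pairsC bs true; have PT := pairsC mt true; have PU := pairsC tu true.
have ET := compat_even C2; have EU := compat_even C1.
rewrite (sum_side _ (startsT (t := u))) /parity => H.
exact: (parity_algebra _ _ _ PS PT PU ET EU H).
Qed.
End CompositeParity.

(** * Parity of a juxtaposition *)

Lemma big_pos (R : Type) (idx : R) (op : Monoid.law idx) (s1 s2 : signs)
    (F : 'I_(size (s1 ++ s2)) -> R) :
  \big[op/idx]_i F i =
  op (\big[op/idx]_i F (lpos s2 i)) (\big[op/idx]_i F (rpos s1 i)).
Proof.
rewrite /lpos /rpos; move: F (size_cat s1 s2); move: (size (s1 ++ s2)) => n F E.
by subst n; rewrite big_split_ord; congr (op _ _); apply: eq_bigr => i _;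
  rewrite cast_ord_id.
Qed.

Lemma sum_pos (V : nmodType) (s1 s2 : signs) (F : 'I_(size (s1 ++ s2)) -> V) :
  \sum_i F i = \sum_i F (lpos s2 i) + \sum_i F (rpos s1 i).
Proof. exact: big_pos. Qed.

Section TensorParity.
Variables (s1 t1 s2 t2 : signs) (D1 : obdiag s1 t1) (D2 : obdiag s2 t2).
Notation D := (tens_diag D1 D2).
Notation N := (node (size (s1 ++ s2)) (size (t1 ++ t2))).

Lemma nrk_inj k l : injective (@nrk k l).
Proof.
by case=> i [] j /= E; [congr inl | exfalso | exfalso | congr inr]; do ?apply: val_inj;
  have := ltn_ord i; have := ltn_ord j; rewrite /=; lia.
Qed.

Lemma sum_node_cat (F : N -> bool) :
  \sum_(x | starts (s1 ++ s2) (t1 ++ t2) x) F x =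
  \sum_(x | starts s1 t1 x) F (lnode s2 t2 x) + \sum_(x | starts s2 t2 x) F
    (rnode s1 t1 x).
Proof.
rewrite !(sum_side _ (@startsT _ _)) !sum_pos addrACA.
by congr (_ + _ + (_ + _)); apply: eq_bigr => i _; rewrite ?nth_lpos ?nth_rpos.
Qed.
End TensorParity.

Lemma cnt_cat s1 s2 (o : 'I_(size (s1 ++ s2)) -> bool) b :
  cnt o b = cnt (o \o lpos s2) b + cnt (o \o rpos s1) b.
Proof.
by rewrite /cnt sum_pos; congr (_ + _); apply: eq_bigr => i _;
  rewrite ?nth_lpos ?nth_rpos.
Qed.

Lemma neg_inv_cat s1 s2 (o : 'I_(size (s1 ++ s2)) -> bool) :
  neg_inv o = neg_inv (o \o lpos s2) + neg_inv (o \o rpos s1)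
    + cnt (o \o lpos s2) false * (cnt (o \o rpos s1) false + cnt (o \o rpos s1) true).
Proof.
rewrite /neg_inv sum_pos.
under eq_bigr => i _ do rewrite sum_pos.
under [X in _ + X]eq_bigr => i _ do rewrite sum_pos.
rewrite !big_split /= [X in _ + (X + _)]big1 => [|i _]; last first.
  rewrite big1 // => j _; have -> : (rpos s1 i < lpos s2 j)%N = false.
    by apply/negbTE; rewrite -leqNgt /=; have := ltn_ord j; lia.
  by rewrite mulr0.
rewrite add0r addrAC; congr (_ + _ + _).
- by apply: eq_bigr => i _; apply: eq_bigr => j _; rewrite nth_lpos.
- by apply: eq_bigr => i _; apply: eq_bigr => j _; rewrite nth_rpos ltn_add2l.
rewrite mulrDr !cnt_mul -big_split; apply: eq_bigr => i _ /=.
rewrite -big_split; apply: eq_bigr => j _ /=; rewrite nth_lpos.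
have -> : (i < size s1 + j)%N by apply: ltn_addr.
by move: (nth _ _ i) (nth _ _ j) (o _) (o _) => [] [] [] [].
Qed.

(** Letters as in [parity_algebra], with S and T the bottom and top rows, and primes on [S0], [S1],
    [T0], [T1] for the second factor; [n1'] and [n2'] belong to the top rows. The fact [H] collects
    all mixed terms, which cancel by the two evenness relations. *)
Lemma tens_algebra (a1 a2 n1 n2 n1' n2' S0 S1 T0 T1 S0' S1' T0' T1' : bool) :
  S0 + S1 = T0 + T1 -> S0' + S1' = T0' + T1' ->
  a1 + a2 + ((S0 * S0' + S0 * T1' + 0 + T1 * T1') + (S1 * S1' + S1 * T0' + 0 + T0 * T0'))
  + (n1 + n2 + S0 * (S0' + S1')) + (n1' + n2' + T0 * (T0' + T1'))
  + (S0 + S0') * ((T0 + T0') + (T1 + T1')) + (S0 + S0') =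
  a1 + n1 + n1' + S0 * (T0 + T1) + S0 + (a2 + n2 + n2' + S0' * (T0' + T1') + S0').
Proof.
move=> E E'; apply/eqP; rewrite -subr_eq0; apply/eqP.
have H : (S0 * S0' + S0 * T1' + 0 + T1 * T1') + (S1 * S1' + S1 * T0' + 0 + T0 * T0')
   + S0 * (S0' + S1') + T0 * (T0' + T1')
   + (S0 * (T0' + T1') + S0' * (T0 + T1)) = 0 :> bool.
  by move: S0 S1 T0 T1 S0' S1' T0' T1' E E' => [] [] [] [] // [] [] [] [].
by rewrite -[RHS]H; ring.
Qed.

(** Juxtaposed arcs do not cross: the inversions between the factors stem from the order of the rows
    in [nrk] and cancel against the boundary terms. *)
Lemma parity_tens s1 t1 s2 t2 (D1 : obdiag s1 t1) (D2 : obdiag s2 t2) (o : _ -> bool) :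
  compat (tens_diag D1 D2) o ->
  parity (tens_diag D1 D2) o =
  parity D1 (o \o lnode s2 t2) + parity D2 (o \o rnode s1 t1).
Proof.
move=> C; have := C; rewrite compat_tens => /andP[C1 C2].
have [EL ER] := mate_tens D1 D2.
have mT (s' t' : signs) (E : obdiag s' t') x : starts s' t' (mate E x) =
  (starts s' t' x == false).
  by rewrite starts_mate eqbF_neg.
set ol := o \o lnode s2 t2; set or := o \o rnode s1 t1.
rewrite [LHS]/parity.
have -> : arc_inv (tens_diag D1 D2) o = arc_inv D1 ol + arc_inv D2 or +
    ((cnt (ol \o inl) false * cnt (or \o inl) false
     + cnt (ol \o inl) false * cnt (or \o inr) true + 0
     + cnt (ol \o inr) true * cnt (or \o inr) true)
    + (cnt (ol \o inl) true * cnt (or \o inl) true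
     + cnt (ol \o inl) true * cnt (or \o inr) false + 0
     + cnt (ol \o inr) false * cnt (or \o inr) false)).
  have EX (x y : node (size s1) (size t1)) : (nrk (lnode s2 t2 x) < nrk
    (lnode s2 t2 y))%N = (nrk x < nrk y)%N.
    case: x y => i [] j //=; rewrite ?ltn_add2l //;
      have := ltn_ord i; have := ltn_ord j; rewrite ?size_cat => ? ?; apply/idP/idP; lia.
  have EY (x y : node (size s2) (size t2)) : (nrk (rnode s1 t1 x) < nrk
    (rnode s1 t1 y))%N = (nrk x < nrk y)%N.
    case: x y => i [] j //=; rewrite ?ltn_add2l //;
      have := ltn_ord i; have := ltn_ord j; rewrite ?size_cat => ? ?; apply/idP/idP; lia.
  pose m := mate (tens_diag D1 D2).
  pose G z w : bool := o z * o w * ((nrk z < nrk w)%N * (nrk (m w) < nrk (m z))%N).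
  rewrite /arc_inv sum_node_cat.
  under [X in X + _ = _]eq_bigr => x _ do rewrite (sum_node_cat (G (lnode s2 t2 x))).
  under [X in _ + X = _]eq_bigr => x _ do rewrite (sum_node_cat (G (rnode s1 t1 x))).
  rewrite !big_split /=.
  have -> : \sum_(x | starts s1 t1 x) \sum_(y | starts s1 t1 y) G (lnode s2 t2 x)
    (lnode s2 t2 y)
            = arc_inv D1 ol.
    by do 2!apply: eq_bigr => ? _; rewrite /G /m !EL !EX.
  have -> : \sum_(x | starts s2 t2 x) \sum_(y | starts s2 t2 y) G (rnode s1 t1 x)
    (rnode s1 t1 y)
            = arc_inv D2 or.
    by do 2!apply: eq_bigr => ? _; rewrite /G /m !ER !EY.
  rewrite [X in _ + (X + _) = _]exchange_big /=.
  transitivity (arc_inv D1 ol + arc_inv D2 or + \sum_(x | starts s1 t1 x)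
    \sum_(y | starts s2 t2 y) (G (lnode s2 t2 x) (rnode s1 t1 y) + G (rnode s1 t1 y)
      (lnode s2 t2 x))).
    by under [X in _ = _ + X]eq_bigr => x _ do rewrite big_split /=;
      rewrite big_split /=; ring.
  congr (_ + _).
  rewrite (mixed_pairs (@nrk_inj _ _) (@mate_inj _ _ (tens_diag D1 D2)) (mateK D1)
    (mateK D2)) //.
  - congr (_ + _); [rewrite (sum_blocks _ _ _ (startsT (t := t1)) (startsT (t := t2)))
                   |rewrite (sum_blocks _ _ _ (mT _ _ D1) (mT _ _ D2))];
      congr (_ + _ + _ + _).
    + by apply: block1 => i j /=; have := ltn_ord i; lia.
    + by apply: block1 => i j /=; have := ltn_ord i; rewrite size_cat; lia.
    + by apply: block0 => i j /=; have := ltn_ord j; rewrite size_cat; lia.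
    + by apply: block1 => i j /=; have := ltn_ord i; lia.
    + by apply: block1 => i j /=; have := ltn_ord i; lia.
    + by apply: block1 => i j /=; have := ltn_ord i; rewrite size_cat; lia.
    + by apply: block0 => i j /=; have := ltn_ord j; rewrite size_cat; lia.
    by apply: block1 => i j /=; have := ltn_ord i; lia.
  - by move=> x y _ _ E; have := congr1 (@nrk _ _) E; move: E; case: x => i;
    case: y => j //=;
      have := ltn_ord i; lia.
  - by move=> x; rewrite -EL; move/compatP: C; apply.
  by move=> x; rewrite -ER; move/compatP: C; apply.
rewrite /parity !cnt_cat !neg_inv_cat.
have ES := compat_even C1; have ET := compat_even C2.
exact: (tens_algebra _ _ _ _ _ _ ES ET).
Qed.

(** * Matrix coefficients *)

Definition nlab (L : Type) k l (I : 'I_k -> L) (J : 'I_l -> L) (x : node k l) : L :=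
  match x with inl i => I i | inr j => J j end.

(** * Labellings of closed loops *)

Section CountLabels.
Variables (s t u : signs) (D1 : obdiag t u) (D2 : obdiag s t).
Variables (L : finType) (R : comPzSemiRingType) (w : L -> R).
Notation M := (stack s t u).
Notation jn := (joined D1 D2).
Variables (I : 'I_(size s) -> L) (J3 : 'I_(size u) -> L).
Hypothesis gD : compat (comp_diag D1 D2) (nlab I J3).

Definition stack_lab (J : 'I_(size t) -> L) (z : M) : L :=
  match z with inl (inl i) => I i | inl (inr j) => J j | inr k => J3 k end.

Definition loop_root : pred M :=
  [pred z | roots jn z && ~~ [exists x, connect jn (outer t x) z]].

Lemma card_loop_root : #|loop_root| = loops D1 D2.
Proof. by apply: eq_card => z; rewrite !inE. Qed.

Lemma component_cases z : {r : {z in loop_root} | fingraph.root jn z = val r} +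
                          {x | connect jn (outer t x) z}.
Proof.
case: (pickP (fun x => connect jn (outer t x) z)) => [x xz|no]; first by right; exists x.
have H : fingraph.root jn z \in loop_root.
  rewrite inE (roots_root (@joined_csym _ _ _ D1 D2)) /=; apply/existsP => -[x].
  rewrite joined_csym => zx; have := no x; rewrite joined_csym.
  by rewrite (connect_trans (connect_root _ _) zx).
by left; exists (exist (fun z => z \in loop_root) _ H).
Qed.

Definition lab_of (h : {z in loop_root} -> L) (z : M) : L :=
  match component_cases z with inl r => h (sval r) | inr x => nlab I J3 (sval x) end.

Lemma loop_root_outer (r : {z in loop_root}) x : connect jn (outer t x) (val r) = false.
Proof.
have := valP r; rewrite inE => /andP[_ /existsP no].
by apply/negP => xr; apply: no; exists x.
Qed.

Lemma lab_of_const h z v : connect jn z v -> lab_of h z = lab_of h v.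
Proof.
have sym := @joined_csym _ _ _ D1 D2.
move=> zv; have rzv : fingraph.root jn z = fingraph.root jn v.
  by apply/eqP; rewrite (root_connect sym).
rewrite /lab_of; case: component_cases => -[r Er] /=;
  case: component_cases => -[r' Er'] /=.
- by congr h; apply: val_inj; rewrite -Er -Er' rzv.
- have := loop_root_outer r r'; rewrite -Er rzv.
  by rewrite (connect_trans Er' (connect_root _ _)).
- have := loop_root_outer r' r; rewrite -Er' -rzv.
  by rewrite (connect_trans Er (connect_root _ _)).
have /connect_outer[->//|->] : connect jn (outer t r) (outer t r').
  by apply: connect_trans (connect_trans Er zv) _; rewrite sym.
by move/compatP: gD => ->.
Qed.

Lemma lab_of_outer h x : lab_of h (outer t x) = nlab I J3 x.
Proof.
rewrite /lab_of; case: component_cases => -[r Er] /=.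
  by have := loop_root_outer r x; rewrite -Er connect_root.
case: (connect_outer Er) => [->//|->]; by move/compatP: gD => ->.
Qed.

Lemma lab_of_root h (r : {z in loop_root}) : lab_of h (val r) = h r.
Proof.
rewrite /lab_of; case: component_cases => -[r' Er] /=; last first.
  by rewrite loop_root_outer in Er.
congr h; apply: val_inj; rewrite -Er.
by have := valP r; rewrite inE => /andP[/eqP-> _].
Qed.

Lemma stack_lab_of h : stack_lab (fun j => lab_of h (inl (inr j))) =1 lab_of h.
Proof.
move=> [[i|//]|k] /=; first exact: (esym (lab_of_outer h (inl i))).
exact: (esym (lab_of_outer h (inr k))).
Qed.

(** Once the boundary is labelled, a compatible labelling of the middle row amounts to a free choice
    of one label for each loop ([lab_of]); distributing the product over these choices gives the
    power. *)
Lemma sum_stack_lab :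
  \sum_(J : {ffun 'I_(size t) -> L} |
        compat D2 (nlab I J) && compat D1 (nlab J J3))
     \prod_(z in loop_root) w (stack_lab J z) = (\sum_i w i) ^+ loops D1 D2.
Proof.
have loE J : nlab I J =1 stack_lab J \o lower u by case.
have upE J : nlab J J3 =1 stack_lab J \o upper s by case.
rewrite -card_loop_root -card_sig -prodr_const bigA_distr_bigA /=.
rewrite (reindex_onto (fun h : {ffun {z in loop_root} -> L} =>
  [ffun j => lab_of h (inl (inr j))])
  (fun J => [ffun r => stack_lab J (val r)])) /=; last first.
  move=> J /andP[]; rewrite (eq_compat _ (loE J)) (eq_compat _ (upE J)) => c2 c1.
  have cst := stack_compat_const c2 c1.
  apply/ffunP => j; rewrite ffunE /lab_of.
  case: component_cases => -[r Er] /=.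
    by rewrite ffunE -Er -[RHS]/(stack_lab J (inl (inr j))); apply/esym/cst/connect_root.
  rewrite -[RHS]/(stack_lab J (inl (inr j))) -(cst _ _ Er).
  by case: (r).
have E (h : {ffun {z in loop_root} -> L}) :
    stack_lab [ffun j => lab_of h (inl (inr j))] =1 lab_of h.
  by move=> z; rewrite -stack_lab_of; case: z => [[]|] //= j; rewrite ffunE.
apply: eq_big => [h|h _].
  have [c2 c1] := andP (const_stack_compat (@lab_of_const h)).
  rewrite (eq_compat _ (loE _)) (eq_compat _ (upE _)).
  rewrite (eq_compat D2 (g := lab_of h \o lower u)) => [|x]; last exact: E.
  rewrite (eq_compat D1 (g := lab_of h \o upper s)) => [|x]; last exact: E.
  rewrite c2 c1 /=; apply/eqP/ffunP => r; rewrite ffunE E.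
  exact: lab_of_root.
by rewrite big_sub; apply: eq_bigr => r _; rewrite E lab_of_root.
Qed.
End CountLabels.

Section Coefficients.
Variables (K : fieldType) (V : superspace K).
Notation n := (\dim (homog V false) + \dim (homog V true))%N.

Definition node_deg s t (I : idx V s) (J : idx V t) (x : node (size s) (size t)) : bool :=
  deg (nlab I J x).

Definition coef s t (D : obdiag s t) (I : idx V s) (J : idx V t) : K :=
  if compat D (nlab I J) then (-1) ^+ parity D (node_deg I J) else 0.

Lemma sum_deg : \sum_(i < n) (-1) ^+ deg i = (sdim V)%:~R :> K.
Proof.
rewrite big_split_ord /= /sdim intrB -!pmulrn; congr (_ + _).
  rewrite (eq_bigr (fun _ => 1)) ?sumr_const ?card_ord // => i _.
  by rewrite /deg /= leqNgt ltn_ord.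
rewrite (eq_bigr (fun _ => -1)) ?sumr_const ?card_ord ?mulNrn // => i _.
by rewrite /deg /= leq_addr.
Qed.

Lemma signr_sum (I : finType) (A : pred I) (F : I -> bool) :
  (-1) ^+ ((\sum_(i | A i) F i)%R : bool) = \prod_(i | A i) (-1) ^+ F i :> K.
Proof.
by rewrite (big_morph (fun b : bool => (-1) ^+ b : K) (id1 := 1) (op1 := *%R)) // =>
  a b; rewrite signr_addb.
Qed.

(** By [parity_comp] each compatible middle labelling contributes the coefficient of the composite
    times the signs of the loop labels. Without compatible boundary labels both sides vanish. *)
Lemma coef_comp s t u (D1 : obdiag t u) (D2 : obdiag s t) (I : idx V s) (J3 : idx V u) :
  \sum_(J : idx V t) coef D2 I J * coef D1 J J3 =
  (sdim V)%:~R ^+ loops D1 D2 * coef (comp_diag D1 D2) I J3.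
Proof.
transitivity (\sum_(J : idx V t | compat D2 (nlab I J) && compat D1 (nlab J J3))
    coef (comp_diag D1 D2) I J3 *
    \prod_(z in loop_root D1 D2) (-1) ^+ deg (stack_lab I J3 J z)).
  rewrite [RHS]big_mkcond; apply: eq_bigr => J _; rewrite {1 2}/coef.
  case: ifP => c2; last by rewrite mul0r.
  case: ifP => c1; last by rewrite mulr0.
  pose f := stack_lab I J3 J.
  have loE : nlab I J =1 f \o lower u by case.
  have upE : nlab J J3 =1 f \o upper s by case.
  have ouE : nlab I J3 =1 f \o outer t by case.
  move: (c2) (c1); rewrite (eq_compat _ loE) (eq_compat _ upE) => c2' c1'.
  have cst := stack_compat_const c2' c1'.
  rewrite /coef (eq_compat _ ouE) compat_comp //.
  pose o z := deg (f z).
  have ocst z w : connect (joined D1 D2) z w -> o z = o w by move/cst; rewrite /o => ->.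
  have -> : node_deg I J = o \o lower u by apply: boolp.funext; case.
  have -> : node_deg J J3 = o \o upper s by apply: boolp.funext; case.
  have -> : node_deg I J3 = o \o outer t by apply: boolp.funext; case.
  rewrite mulrC -signr_addb [_ (+) _](parity_comp ocst) signr_addb; congr (_ * _).
  rewrite signr_sum [RHS]big_mkcond; apply: eq_bigr => z _; rewrite inE /=.
  by case: (_ && ~~ _).
rewrite /= -big_distrr /= mulrC /coef; case: ifP => gD; last by rewrite !mulr0.
by rewrite (sum_stack_lab (fun i => (-1) ^+ deg i) gD) sum_deg.
Qed.
End Coefficients.

(** * Coefficients of the generators *)

Definition i0 : 'I_2 := @Ordinal 2 0 isT.
Definition i1 : 'I_2 := @Ordinal 2 1 isT.

Lemma ord2P (P : 'I_2 -> Prop) : P i0 -> P i1 -> forall i, P i.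
Proof.
move=> P0 P1 [[|[|//]] lt_i]; [move: P0|move: P1]; congr P; exact: val_inj.
Qed.

Lemma big_two (R : Type) (idx : R) (op : Monoid.law idx) (F : 'I_2 -> R) :
  \big[op/idx]_i F i = op (F i0) (F i1).
Proof.
by rewrite !big_ord_recl big_ord0 Monoid.mulm1; congr (op (F _) (F _)); apply: val_inj.
Qed.

Lemma big_ord2 (V : nmodType) (F : 'I_2 -> V) : \sum_i F i = F i0 + F i1.
Proof. exact: big_two. Qed.

Section GeneratorArcs.
Variables (L : eqType).

Lemma compat_A_plus (f : _ -> L) : compat A_plus f = (f (inl i0) == f (inl i1)).
Proof.
have /mate_arc[m0 m1] : (inl i0, inl i1) \in obarcs A_plus by rewrite /obarcs /= inE.
apply/compatP/eqP => [H|E]; first by rewrite -m1 H.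
by case=> [|[]//]; apply: ord2P; rewrite ?m0 ?m1.
Qed.

Lemma compat_A_minus (f : _ -> L) : compat A_minus f = (f (inl i0) == f (inl i1)).
Proof.
have /mate_arc[m1 m0] : (inl i1, inl i0) \in obarcs A_minus by rewrite /obarcs /= inE.
apply/compatP/eqP => [H|E]; first by rewrite -m1 H.
by case=> [|[]//]; apply: ord2P; rewrite ?m0 ?m1.
Qed.

Lemma compat_U_plus (f : _ -> L) : compat U_plus f = (f (inr i0) == f (inr i1)).
Proof.
have /mate_arc[m0 m1] : (inr i0, inr i1) \in obarcs U_plus by rewrite /obarcs /= inE.
apply/compatP/eqP => [H|E]; first by rewrite -m1 H.
by case=> [[]//|]; apply: ord2P; rewrite ?m0 ?m1.
Qed.

Lemma compat_U_minus (f : _ -> L) : compat U_minus f = (f (inr i0) == f (inr i1)).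
Proof.
have /mate_arc[m1 m0] : (inr i1, inr i0) \in obarcs U_minus by rewrite /obarcs /= inE.
apply/compatP/eqP => [H|E]; first by rewrite -m1 H.
by case=> [[]//|]; apply: ord2P; rewrite ?m0 ?m1.
Qed.

Lemma mate_X : [/\ mate X_diag (inr i0) = inl i1, mate X_diag (inl i1) = inr i0,
  mate X_diag (inr i1) = inl i0 & mate X_diag (inl i0) = inr i1].
Proof.
have /mate_arc[m0 m1] : (inr i0, inl i1) \in obarcs X_diag by rewrite /obarcs /= !inE.
have /mate_arc[m2 m3] : (inr i1, inl i0) \in obarcs X_diag by rewrite /obarcs /= !inE.
by split.
Qed.

Lemma compat_X (f : _ -> L) :
  compat X_diag f = (f (inr i0) == f (inl i1)) && (f (inr i1) == f (inl i0)).
Proof.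
have [m0 m1 m2 m3] := mate_X.
apply/compatP/andP => [H|[/eqP E0 /eqP E1]]; first by rewrite -{1}m1 -{1}m3 !H.
by case; apply: ord2P; rewrite ?m0 ?m1 ?m2 ?m3.
Qed.

Lemma compat_id s (f : _ -> L) :
  compat (id_diag s) f = [forall i, f (inl i) == f (inr i)].
Proof.
apply/compatP/forallP => [H i|H [] i]; have [m0 m1] := mate_id i.
- by rewrite -{1}m1 H.
- by rewrite m0 (eqP (H i)).
by rewrite m1 (eqP (H i)).
Qed.
End GeneratorArcs.

Lemma arc_inv0 s t (D : obdiag s t) o :
  (forall x y, starts s t x -> starts s t y -> x = y) -> arc_inv D o = 0.
Proof.
by move=> H; apply: big1 => x sx; apply: big1 => y sy;
  rewrite (H x y) // ltnn mul0r mulr0.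
Qed.

Lemma parity_A_plus o : o (inl i0) = o (inl i1) -> parity A_plus o = 0.
Proof.
move=> E; rewrite /parity arc_inv0 => [|[|[]//]]; last first.
  by apply: ord2P => // -[|[]//]; apply: ord2P.
rewrite /neg_inv /cnt /= !big_ord0 !big_ord2 /= E.
by case: (o _).
Qed.

Lemma parity_A_minus o : o (inl i0) = o (inl i1) -> parity A_minus o = o (inl i0).
Proof.
move=> E; rewrite /parity arc_inv0 => [|[|[]//]]; last first.
  by apply: ord2P => // -[|[]//]; apply: ord2P.
rewrite /neg_inv /cnt /= !big_ord0 !big_ord2 /= E.
by case: (o _).
Qed.

Lemma parity_U_plus o : o (inr i0) = o (inr i1) -> parity U_plus o = 0.
Proof.
move=> E; rewrite /parity arc_inv0 => [|[[]//|]]; last first.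
  by apply: ord2P => // -[[]//|]; apply: ord2P.
rewrite /neg_inv /cnt /= !big_ord0 !big_ord2 /= E.
by case: (o _).
Qed.

Lemma parity_U_minus o : o (inr i0) = o (inr i1) -> parity U_minus o = o (inr i0).
Proof.
move=> E; rewrite /parity arc_inv0 => [|[[]//|]]; last first.
  by apply: ord2P => // -[[]//|]; apply: ord2P.
rewrite /neg_inv /cnt /= !big_ord0 !big_ord2 /= E.
by case: (o _).
Qed.

Lemma parity_X o : compat X_diag o -> parity X_diag o = o (inl i0) && o (inl i1).
Proof.
rewrite compat_X => /andP[/eqP E0 /eqP E1]; have [m0 m1 m2 m3] := mate_X.
rewrite /parity /arc_inv /neg_inv /cnt.
rewrite (sum_side _ (startsT (t := [:: true; true]))) !big_ord2.
rewrite !(sum_side _ (startsT (t := [:: true; true]))) /= !big_ord2 /= !m0 !m2 /= E0 E1.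
by case: (o _); case: (o _).
Qed.

(** An identity is a juxtaposition of single vertical arcs, which have no inversions and whose
    boundary terms cancel. *)
Lemma parity_id s o : compat (id_diag s) o -> parity (id_diag s) o = 0.
Proof.
elim: s o => [|e s IH] o.
  move=> _; rewrite /parity arc_inv0 => [|[[]//|[]//]].
  by rewrite /neg_inv /cnt !big_ord0.
have -> : id_diag (e :: s) = tens_diag (id_diag [:: e]) (id_diag s).
  apply: rel_ext => -[|a l] [|b m]; rewrite rel_id // => /andP[zl /eqP[? ?]]; subst a l.
  have r1 : rel_diag (id_diag [:: e]) [:: b] [:: b] by rewrite rel_id !eqxx.
  have r2 : rel_diag (id_diag s) m m by rewrite rel_id eqxx andbT; exact: zl.
  exact: rel_tensI r1 r2.
move=> C; rewrite [LHS](parity_tens (D1 := id_diag [:: e]) (D2 := id_diag s) C).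
have [C1 /IH ->] := andP (etrans (esym (compat_tens (id_diag [:: e]) (id_diag s) o)) C).
rewrite addr0; move: (o \o _) C1 => o1; rewrite compat_id => /forallP/(_ ord0)/eqP E.
rewrite /parity arc_inv0 /neg_inv /cnt.
  by rewrite /= !big_ord_recl !big_ord0 /= E; move: (o1 _) => []; case: (e).
move=> [] [[|//] ix] [] [[|//] iy] /=; try by case: (e).
  by move=> _ _; congr inl; apply: val_inj.
by move=> _ _; congr inr; apply: val_inj.
Qed.
Section Coefs.
Variables (K : fieldType) (V : superspace K).

Lemma coef_tens s1 t1 s2 t2 (D1 : obdiag s1 t1) (D2 : obdiag s2 t2)
    (I : idx V (s1 ++ s2)) (J : idx V (t1 ++ t2)) :
  coef (tens_diag D1 D2) I J =
  coef D1 (lidx I) (lidx J) * coef D2 (ridx I) (ridx J).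
Proof.
have EL : nlab I J \o lnode s2 t2 = nlab (lidx I) (lidx J).
  by apply: boolp.funext => -[] i /=; rewrite ffunE.
have ER : nlab I J \o rnode s1 t1 = nlab (ridx I) (ridx J).
  by apply: boolp.funext => -[] i /=; rewrite ffunE.
rewrite /coef -EL -ER; have [C|] := boolP (compat (tens_diag D1 D2) (nlab I J)).
  have C' : compat (tens_diag D1 D2) (node_deg I J).
    by apply/compatP => x; rewrite /node_deg (eqP (forallP C x)).
  rewrite (parity_tens C'); move: C; rewrite compat_tens => /andP[-> ->].
  have -> : node_deg (lidx I) (lidx J) = node_deg I J \o lnode s2 t2.
    by apply: boolp.funext => x; rewrite /node_deg -EL.
  have -> : node_deg (ridx I) (ridx J) = node_deg I J \o rnode s1 t1.
    by apply: boolp.funext => x; rewrite /node_deg -ER.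
  by rewrite signr_addb.
rewrite compat_tens negb_and => /orP[/negPf->|/negPf->]; by rewrite ?mul0r ?mulr0.
Qed.

Lemma coef_id s (I J : idx V s) : coef (id_diag s) I J = (I == J)%:R.
Proof.
rewrite /coef; case: ifP => C.
  rewrite parity_id ?expr0.
    move: C; rewrite compat_id => /forallP C.
    have -> : I = J by apply/ffunP => i; exact: (eqP (C i)).
    by rewrite eqxx.
  by apply/compatP => x; rewrite /node_deg (eqP (forallP C x)).
case: eqP C => // ->; rewrite compat_id => /forallP[]; by move=> i.
Qed.

Lemma coef_A_plus (I : idx V [:: false; true]) J : coef A_plus I J = (I i0 == I i1)%:R.
Proof.
rewrite /coef compat_A_plus /=; case: eqP => // E; rewrite parity_A_plus //.
by rewrite /node_deg /= E.
Qed.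

Lemma coef_A_minus (I : idx V [:: true; false]) J :
  coef A_minus I J = (-1) ^+ deg (I i0) *+ (I i0 == I i1).
Proof.
rewrite /coef compat_A_minus /=; case: eqP => // E; rewrite parity_A_minus //.
by rewrite /node_deg /= E.
Qed.

Lemma coef_U_plus I (J : idx V [:: true; false]) : coef U_plus I J = (J i0 == J i1)%:R.
Proof.
rewrite /coef compat_U_plus /=; case: eqP => // E; rewrite parity_U_plus //.
by rewrite /node_deg /= E.
Qed.

Lemma coef_U_minus I (J : idx V [:: false; true]) :
  coef U_minus I J = (-1) ^+ deg (J i0) *+ (J i0 == J i1).
Proof.
rewrite /coef compat_U_minus /=; case: eqP => // E; rewrite parity_U_minus //.
by rewrite /node_deg /= E.
Qed.

Lemma coef_X (I J : idx V [:: true; true]) :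
  coef X_diag I J =
  (-1) ^+ (deg (I i0) && deg (I i1)) *+ ((J i0 == I i1) && (J i1 == I i0)).
Proof.
rewrite /coef; case: ifP => C.
  rewrite parity_X; last by apply/compatP => x; rewrite /node_deg (eqP (forallP C x)).
  by move: C; rewrite compat_X /= => ->.
by move: C; rewrite compat_X /= => ->.
Qed.

Lemma coef_even s t (D : obdiag s t) (I : idx V s) (J : idx V t) :
  coef D I J != 0 -> \sum_i deg (I i) = \sum_j deg (J j) :> bool.
Proof.
rewrite /coef; case: ifP; rewrite ?eqxx // => C _.
have C' : compat D (node_deg I J).
  by apply/compatP => x; rewrite /node_deg (eqP (forallP C x)).
have cntE r (o : 'I_(size r) -> bool) : \sum_i o i = cnt o false + cnt o true.
  by rewrite -big_split; apply: eq_bigr => i _ /=; case: nth; case: (o i).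
by rewrite !cntE; exact: compat_even C'.
Qed.
End Coefs.

(** * Equivariance *)

Section Equivariance.
Variables (K : fieldType) (V : superspace K) (A : comSuperAlg K) (g : GLpoint V A).
Notation n := (\dim (homog V false) + \dim (homog V true))%N.

Lemma part_mull a b (x y : A) : part A a x = x ->
  part A (a (+) b) (x * y) = x * part A b y.
Proof.
move=> xa; rewrite -{1}(part_sum y).
have P c : part A (a (+) b) (x * part A c y) = if c == b then x * part A b y else 0.
  have E : part A (a (+) c) (x * part A c y) = x * part A c y.
    by apply: part_mul => //; rewrite part_part eqxx.
  rewrite -E part_part E; case: a b c {xa E} => [] [] [] //=.
by rewrite mulrDr linearD !P; case: b {P}; rewrite /= ?add0r ?addr0.
Qed.

(** Keeping only the part of the expected degree in each entry of the inverse leaves a right inverse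
    of the even matrix [g]; uniqueness of inverses concludes. *)
Lemma ginv_even i j : part A (deg i (+) deg j) (ginv g i j) = ginv g i j.
Proof.
pose h : 'M[A]_n := \matrix_(i, j) part A (deg i (+) deg j) (ginv g i j).
have gh : gmat g *m h = 1%:M.
  apply/matrixP => i' j'; rewrite !mxE.
  transitivity (part A (deg i' (+) deg j') ((gmat g *m ginv g) i' j')).
    rewrite mxE linear_sum; apply: eq_bigr => k _;
      rewrite mxE -(part_mull _ _ (geven g i' k)).
    by congr (part A _ _); case: (deg i'); case: (deg k); case: (deg j').
  rewrite gmulV mxE; case: eqP => [->|]; last by rewrite linear0.
  by rewrite addbb; exact: part_one.
have -> : ginv g = h by rewrite -[LHS]mulmx1 -gh mulmxA gVmul mul1mx.
rewrite mxE; set x := ginv g i j.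
by rewrite part_part eqxx.
Qed.

Lemma sign_mulA (b c : bool) (x : A) :
  (-1) ^+ b * ((-1) ^+ c * x) = (-1) ^+ (b (+) c) * x.
Proof. by rewrite mulrA signr_addb. Qed.

Lemma sign_mulCA (b : bool) (x y : A) : x * ((-1) ^+ b * y) = (-1) ^+ b * (x * y).
Proof. by rewrite mulrA (commr_sign x b) -mulrA. Qed.

Lemma sign_scale (b : bool) (x : A) : (-1) ^+ b *: x = (-1) ^+ b * x.
Proof. by rewrite scaler_sign mulr_sign. Qed.

Definition tdeg s (I : idx V s) : bool := \sum_i deg (I i).

Lemma odd_tdeg s (I : idx V s) : odd (\sum_i deg (I i)) = tdeg I.
Proof. by rewrite odd_sum; apply: eq_bigr => i _; rewrite oddb. Qed.

(** The extra sign moves the coefficients of the left factors past the basis vectors of the right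
    factors; it depends on total degrees only. *)
Lemma tens_entry_cat s1 s2 (I J : idx V (s1 ++ s2)) :
  tens_entry g I J =
  (-1) ^+ ((tdeg (lidx I) (+) tdeg (lidx J)) && tdeg (ridx I)) *
  (tens_entry g (lidx I) (lidx J) * tens_entry g (ridx I) (ridx J)).
Proof.
rewrite /tens_entry.
pose e s (I J : idx V s) : nat := (\sum_(q < size s) \sum_(r < size s | (q < r)%N)
  ((deg (I q) (+) deg (J q)) && deg (I r)))%N.
pose P s (I J : idx V s) : A := \prod_(q < size s) sign_mx g (nth true s q) (I q) (J q).
rewrite -/(e _ I J) -/(P _ I J) -!/(e _ _ _) -!/(P _ _ _).
have -> : P _ I J = P _ (lidx I) (lidx J) * P _ (ridx I) (ridx J).
  rewrite /P big_pos /=; congr (_ * _); apply: eq_bigr => i _.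
    by rewrite !ffunE nth_lpos.
  by rewrite !ffunE nth_rpos.
have -> : e _ I J = (e _ (lidx I) (lidx J) + e _ (ridx I) (ridx J) +
  (\sum_q (deg (lidx I q) (+) deg (lidx J q))) * (\sum_r deg (ridx I r)))%N.
  have inner (p : pred 'I_(size (s1 ++ s2))) (F : 'I_(size (s1 ++ s2)) -> nat) :
      (\sum_(r | p r) F r =
       \sum_(r | p (lpos s2 r)) F (lpos s2 r) + \sum_(r | p (rpos s1 r)) F (rpos s1 r))%N.
    by rewrite big_mkcond big_pos -!big_mkcond.
  rewrite /e big_pos /=.
  under eq_bigr => q _ do rewrite inner.
  under [X in (_ + X = _)%N]eq_bigr => q _ do rewrite inner.
  rewrite !big_split /= [X in (_ + (X + _) = _)%N]big1 => [|q _]; last first.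
    by apply: big1 => r; rewrite /=; have := ltn_ord r; lia.
  rewrite add0n addnAC; congr (_ + _ + _)%N.
  - by apply: eq_bigr => q _; apply: eq_bigr => r _; rewrite !ffunE.
  - apply: eq_bigr => q _; apply: eq_big => [r|r _]; first by rewrite /= ltn_add2l.
    by rewrite !ffunE.
  rewrite big_distrlr /=; apply: eq_bigr => q _; apply: eq_big => [r|r _].
    by have := ltn_ord q; rewrite /=; lia.
  by rewrite !ffunE mulnb.
rewrite !exprD -signr_odd -[(-1) ^+ e _ (ridx I) _]signr_odd -[X in _ * X * _]signr_odd.
rewrite oddM odd_tdeg.
have -> : odd (\sum_q (deg (lidx I q) (+) deg (lidx J q))) =
  tdeg (lidx I) (+) tdeg (lidx J).
  by rewrite odd_sum /tdeg -big_split; apply: eq_bigr => i _; rewrite oddb.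
rewrite -!mulrA [P s1 _ _ * (_ * _)]sign_mulCA !sign_mulA;
  congr ((-1) ^+ nat_of_bool _ * _).
by move: (odd _) (odd _) (_ && _) => [] [] [].
Qed.

Definition intertwines s t (D : obdiag s t) : Prop := forall (I : idx V s) (L : idx V t),
  \sum_(J : idx V s) coef D J L *: tens_entry g J I =
  \sum_(J : idx V t) coef D I J *: tens_entry g L J.

Lemma intertwines_id s : intertwines (id_diag s).
Proof.
move=> I L; rewrite (bigD1 L) //= [RHS](bigD1 I) //= !coef_id !eqxx !big1 ?addr0 //.
  by move=> J /negPf nJ; rewrite coef_id eq_sym nJ scale0r.
by move=> J /negPf nJ; rewrite coef_id nJ scale0r.
Qed.

Lemma intertwines_comp s t u (D1 : obdiag t u) (D2 : obdiag s t) :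
  loops D1 D2 = 0%N -> intertwines D1 -> intertwines D2 ->
  intertwines (comp_diag D1 D2).
Proof.
move=> l0 H1 H2 I L.
have E (J : idx V s) (L' : idx V u) : coef (comp_diag D1 D2) J L' =
    \sum_(M : idx V t) coef D2 J M * coef D1 M L'.
  by rewrite coef_comp l0 expr0 mul1r.
under eq_bigr => J _ do rewrite E scaler_suml.
rewrite exchange_big /=.
transitivity (\sum_M coef D1 M L *: \sum_J coef D2 J M *: tens_entry g J I).
  apply: eq_bigr => M _; rewrite scaler_sumr; apply: eq_bigr => J _.
  by rewrite scalerA mulrC.
under eq_bigr => M _ do rewrite (H2 I M) scaler_sumr.
rewrite exchange_big /=.
transitivity (\sum_J coef D2 I J *: \sum_M coef D1 M L *: tens_entry g M J).
  apply: eq_bigr => M _; rewrite scaler_sumr; apply: eq_bigr => J _.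
  by rewrite !scalerA mulrC.
under eq_bigr => J _ do rewrite (H1 J L) scaler_sumr.
rewrite exchange_big /=; apply: eq_bigr => M _; rewrite E scaler_suml.
by apply: eq_bigr => J _; rewrite scalerA.
Qed.

Lemma sum_idx_cat (W : nmodType) s1 s2 (F : idx V s1 -> idx V s2 -> W) :
  \sum_(J : idx V (s1 ++ s2)) F (lidx J) (ridx J) = \sum_J1 \sum_J2 F J1 J2.
Proof.
rewrite pair_big /= (reindex (fun J : idx V (s1 ++ s2) => (lidx J, ridx J))) //.
exact/onW_bij/idx_pair_bij.
Qed.

(** Wherever the coefficients are nonzero, [coef_even] replaces the total degrees of the summation
    index by those of [I] or [L]. The sign of [tens_entry_cat] is then constant and factors out. *)
Lemma intertwines_tens s1 t1 s2 t2 (D1 : obdiag s1 t1) (D2 : obdiag s2 t2) :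
  intertwines D1 -> intertwines D2 -> intertwines (tens_diag D1 D2).
Proof.
move=> H1 H2 I L.
pose e := (-1) ^+ ((tdeg (lidx L) (+) tdeg (lidx I)) && tdeg (ridx L)) : A.
transitivity (e * (\sum_J coef D1 J (lidx L) *: tens_entry g J (lidx I)) *
  (\sum_J coef D2 J (ridx L) *: tens_entry g J (ridx I))).
  rewrite -mulrA big_distrlr /= -(sum_idx_cat (fun J1 J2 => (coef D1 J1 (lidx L) *:
    tens_entry g J1 (lidx I)) * (coef D2 J2 (ridx L) *: tens_entry g J2 (ridx I)))).
  rewrite big_distrr /=; apply: eq_bigr => J _.
  rewrite coef_tens tens_entry_cat.
  have [c1|c1] := eqVneq (coef D1 (lidx J) (lidx L)) 0.
    by rewrite c1 mul0r !scale0r mul0r mulr0.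
  have [c2|c2] := eqVneq (coef D2 (ridx J) (ridx L)) 0.
    by rewrite c2 mulr0 !scale0r !mulr0.
  rewrite /tdeg (coef_even c1) (coef_even c2) -/(tdeg _) -/(tdeg _) -/(tdeg _) -/e.
  by rewrite -scalerAr -scalerAl -!scalerAr scalerA mulrC.
rewrite H1 H2 -mulrA big_distrlr /= -(sum_idx_cat (fun J1 J2 => (coef D1 (lidx I) J1 *:
    tens_entry g (lidx L) J1) * (coef D2 (ridx I) J2 *: tens_entry g (ridx L) J2))).
rewrite big_distrr /=; apply: eq_bigr => J _.
rewrite coef_tens tens_entry_cat.
have [c1|c1] := eqVneq (coef D1 (lidx I) (lidx J)) 0.
  by rewrite c1 mul0r !scale0r mul0r mulr0.
rewrite /tdeg -(coef_even c1) -/(tdeg _) -/(tdeg _) -/(tdeg _) -/e.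
by rewrite -scalerAr -scalerAl -!scalerAr scalerA mulrC.
Qed.

Lemma tens_entry0 (I J : idx V [::]) : tens_entry g I J = 1.
Proof. by rewrite /tens_entry !big_ord0 mulr1. Qed.

Lemma tens_entry2 a b (I J : idx V [:: a; b]) :
  tens_entry g I J = (-1) ^+ ((deg (I i0) (+) deg (J i0)) && deg (I i1)) *
    (sign_mx g a (I i0) (J i0) * sign_mx g b (I i1) (J i1)).
Proof.
rewrite /tens_entry; congr ((-1) ^+ _ * _); last exact: (@big_two _ _ *%R).
rewrite [LHS](@big_two _ _ addn) /= [X in (X + _)%N]big_mkcond [X in (_ + X)%N]big_mkcond.
by rewrite [X in (X + _)%N](@big_two _ _ addn) [X in (_ + X)%N](@big_two _ _ addn) /=
  !addn0 !add0n.
Qed.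

Definition idx2 a b (x y : 'I_n) : idx V [:: a; b] :=
  [ffun q : 'I_2 => if q == i0 then x else y].

Lemma idx2E a b (J : idx V [:: a; b]) : idx2 a b (J i0) (J i1) = J.
Proof. by apply/ffunP; apply: ord2P; rewrite ffunE. Qed.

Lemma idx2_0 a b x y : idx2 a b x y i0 = x. Proof. by rewrite ffunE. Qed.
Lemma idx2_1 a b x y : idx2 a b x y i1 = y. Proof. by rewrite ffunE. Qed.

Lemma sum_idx2 (W : nmodType) a b (F : idx V [:: a; b] -> W) :
  \sum_J F J = \sum_x \sum_y F (idx2 a b x y).
Proof.
rewrite pair_big /= (reindex (fun p => idx2 a b p.1 p.2)) //=.
exists (fun J : idx V [:: a; b] => (J i0, J i1)) => [[x y] _|J _] /=; last exact: idx2E.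
by rewrite idx2_0 idx2_1.
Qed.

Lemma idx0_eq (I J : idx V [::]) : I = J.
Proof. by apply/ffunP => -[]. Qed.

Lemma sum_idx0 (W : nmodType) (F : idx V [::] -> W) L : \sum_J F J = F L.
Proof.
rewrite (bigD1 L) //= big1 ?addr0 // => J /negP[].
by rewrite (idx0_eq J L).
Qed.

Lemma sum_diag (W : lmodType K) (c : 'I_n -> 'I_n -> K) (F : 'I_n -> 'I_n -> W) :
  \sum_x \sum_y (c x y *+ (x == y)) *: F x y = \sum_x c x x *: F x x.
Proof.
apply: eq_bigr => x _; rewrite (bigD1 x) //= eqxx big1 ?addr0 // => y.
by rewrite eq_sym => /negPf->; rewrite scale0r.
Qed.

Lemma mul_ginv i j : \sum_k gmat g i k * ginv g k j = (i == j)%:R.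
Proof. by have /matrixP/(_ i j) := gmulV g; rewrite !mxE. Qed.

Lemma ginv_mul i j : \sum_k ginv g i k * gmat g k j = (i == j)%:R.
Proof. by have /matrixP/(_ i j) := gVmul g; rewrite !mxE. Qed.

(** This is $g^{-1}g=1$ on entries, and [U_plus] is $gg^{-1}=1$. For [A_minus] and [U_minus] the
    factors come in the opposite order and are first exchanged by supercommutativity. *)
Lemma intertwines_A_plus : intertwines A_plus.
Proof.
move=> I L; rewrite (sum_idx0 _ L) tens_entry0 coef_A_plus.
rewrite sum_idx2; under eq_bigr => x _ do under eq_bigr => y _ do
  rewrite coef_A_plus idx2_0 idx2_1 tens_entry2 idx2_0 idx2_1.
rewrite (sum_diag (fun _ _ => 1)) [RHS]scaler_nat.
rewrite -(ginv_mul (I i0) (I i1)); apply: eq_bigr => x _.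
rewrite /= mxE scale1r -mulrA sign_mulA.
by case: (deg x); case: (deg (I i0)); rewrite /= mul1r.
Qed.

Lemma super_comm_mx i j k l :
  gmat g i j * ginv g k l =
  (-1) ^+ ((deg i (+) deg j) && (deg k (+) deg l)) * (ginv g k l * gmat g i j).
Proof. by apply: part_comm; [exact: geven | exact: ginv_even]. Qed.

Lemma super_comm_gg i j k l :
  gmat g i j * gmat g k l =
  (-1) ^+ ((deg i (+) deg j) && (deg k (+) deg l)) * (gmat g k l * gmat g i j).
Proof. by apply: part_comm; exact: geven. Qed.

Lemma intertwines_A_minus : intertwines A_minus.
Proof.
move=> I L; rewrite (sum_idx0 _ L) tens_entry0 coef_A_minus.
rewrite sum_idx2; under eq_bigr => x _ do under eq_bigr => y _ do
  rewrite coef_A_minus idx2_0 idx2_1 tens_entry2 idx2_0 idx2_1.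
rewrite (sum_diag (fun x _ => (-1) ^+ deg x)).
transitivity ((-1) ^+ (deg (I i0) && deg (I i1)) * \sum_k ginv g (I i1) k * gmat g k
  (I i0)).
  rewrite big_distrr; apply: eq_bigr => x _; rewrite /=
    mxE sign_scale sign_mulCA super_comm_mx.
  rewrite !sign_mulA; congr ((-1) ^+ nat_of_bool _ * _).
  by case: (deg x); case: (deg (I i0)); case: (deg (I i1)).
rewrite ginv_mul eq_sym; case: eqP => [->|_]; last by rewrite mulr0 mulr0n scale0r.
by rewrite sign_scale andbb.
Qed.

Lemma intertwines_U_plus : intertwines U_plus.
Proof.
move=> I L; rewrite (sum_idx0 _ I) tens_entry0 coef_U_plus.
rewrite sum_idx2; under [RHS]eq_bigr => x _ do under eq_bigr => y _ do
  rewrite coef_U_plus idx2_0 idx2_1 tens_entry2 idx2_0 idx2_1.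
rewrite (sum_diag (fun _ _ => 1)).
(* The sign common to all summands; it is 1 when [L i0 = L i1], and otherwise the sum is 0. *)
transitivity ((-1) ^+ ((deg (L i0) (+) deg (L i1)) && deg (L i1)) *
  \sum_k gmat g (L i0) k * ginv g k (L i1)).
  rewrite mul_ginv; case: eqP => [->|_]; last by rewrite mulr0 scale0r.
  by rewrite addbb mul1r scale1r.
rewrite big_distrr; apply: eq_bigr => x _; rewrite /= mxE scale1r sign_mulCA.
rewrite !sign_mulA; congr ((-1) ^+ nat_of_bool _ * _).
by case: (deg x); case: (deg (L i0)); case: (deg (L i1)).
Qed.

Lemma intertwines_U_minus : intertwines U_minus.
Proof.
move=> I L; rewrite (sum_idx0 _ I) tens_entry0 coef_U_minus.
rewrite sum_idx2; under [RHS]eq_bigr => x _ do under eq_bigr => y _ do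
  rewrite coef_U_minus idx2_0 idx2_1 tens_entry2 idx2_0 idx2_1.
rewrite (sum_diag (fun x _ => (-1) ^+ deg x)).
transitivity ((-1) ^+ deg (L i0) * \sum_k gmat g (L i1) k * ginv g k (L i0)).
  rewrite mul_ginv eq_sym; case: eqP => [_|_]; last by rewrite mulr0 mulr0n scale0r.
  by rewrite sign_scale.
rewrite big_distrr; apply: eq_bigr => x _; rewrite /= mxE sign_scale super_comm_mx.
rewrite -mulrA !sign_mulA; congr ((-1) ^+ nat_of_bool _ * _).
by case: (deg x); case: (deg (L i0)); case: (deg (L i1)).
Qed.

Lemma intertwines_X : intertwines X_diag.
Proof.
move=> I L.
rewrite (bigD1 (idx2 true true (L i1) (L i0))) //= big1 => [|J nJ]; last first.
  rewrite coef_X mulrb; case: ifP => [/andP[/eqP E0 /eqP E1]|_]; last by rewrite scale0r.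
  by case/eqP: nJ; rewrite E0 E1 idx2E.
rewrite [RHS](bigD1 (idx2 true true (I i1) (I i0))) //= [X in _ = _ + X]big1 => [|J nJ];
  last first.
  rewrite coef_X mulrb; case: ifP => [/andP[/eqP E0 /eqP E1]|_]; last by rewrite scale0r.
  by case/eqP: nJ; rewrite -E0 -E1 idx2E.
rewrite !coef_X !idx2_0 !idx2_1 !eqxx !mulr1n !addr0 !tens_entry2 !idx2_0 !idx2_1 /=.
rewrite !sign_scale super_comm_gg !sign_mulA; congr ((-1) ^+ nat_of_bool _ * _).
by case: (deg (L i0)); case: (deg (L i1)); case: (deg (I i0)); case: (deg (I i1)).
Qed.

Lemma intertwines_diag s t (D : obdiag s t) : intertwines D.
Proof.
elim: {s t D}(all_generated D) => *.
- exact: intertwines_id.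
- exact: intertwines_X.
- exact: intertwines_A_plus.
- exact: intertwines_A_minus.
- exact: intertwines_U_plus.
- exact: intertwines_U_minus.
- exact: intertwines_tens.
exact: intertwines_comp.
Qed.
End Equivariance.

(** * The functor and its uniqueness *)

Section LinearMaps.
Variables (K : fieldType) (V : superspace K).

Definition diag_fun s t (D : obdiag s t) (x : tspace V s) : tspace V t :=
  [ffun J => \sum_I coef D I J * (x I : K)].

Fact diag_fun_linear s t (D : obdiag s t) : linear (diag_fun D).
Proof.
move=> a x y; apply/ffunP => J; rewrite !ffunE scaler_sumr -big_split.
by apply: eq_bigr => I _; rewrite !ffunE mulrDr mulrCA.
Qed.

HB.instance Definition _ s t (D : obdiag s t) :=
  GRing.isLinear.Build K (tspace V s) (tspace V t) _ (diag_fun D) (diag_fun_linear D).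

Definition diag_hom s t (D : obdiag s t) : 'Hom(tspace V s, tspace V t) :=
  linfun (diag_fun D).

Lemma diag_homE s t (D : obdiag s t) x J :
  diag_hom D x J = \sum_I coef D I J * (x I : K).
Proof. by rewrite lfunE /= ffunE. Qed.

Lemma diag_hom_basis s t (D : obdiag s t) I J : diag_hom D (tbasis I) J = coef D I J.
Proof.
rewrite diag_homE (bigD1 I) //= ffunE eqxx mulr1 big1 ?addr0 // => I' /negPf nI.
by rewrite ffunE nI mulr0.
Qed.

Fact diag_hom_equivariant s t (D : obdiag s t) : diag_hom D \in @equivariantb K V s t.
Proof.
apply/asboolP => A g x; apply/ffunP => L; rewrite !ffunE.
under eq_bigr => J _ do rewrite ffunE diag_hom_basis scaler_sumr.
under [RHS]eq_bigr => J _ do rewrite ffunE mulr_sumr.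
rewrite exchange_big [RHS]exchange_big; apply: eq_bigr => I _ /=.
under eq_bigr => J _ do rewrite scalerAl.
under [RHS]eq_bigr => J _ do rewrite diag_hom_basis -scalerAr scalerAl.
by rewrite -!mulr_suml intertwines_diag.
Qed.

Definition GLdiag s t (D : obdiag s t) : GLhom V s t := MkGLhom (diag_hom_equivariant D).

Definition GLfun s t (f : OB K s t) : GLhom V s t := \sum_D (f D : K) *: GLdiag D.

Fact GLfun_linear s t : linear (@GLfun s t).
Proof.
move=> a f g; rewrite /GLfun scaler_sumr -big_split; apply: eq_bigr => D _.
by rewrite !ffunE scalerDl scalerA.
Qed.

HB.instance Definition _ s t :=
  GRing.isLinear.Build K (OB K s t) (GLhom V s t) _ (@GLfun s t) (@GLfun_linear s t).

Lemma GLmapE s t (f : OB K s t) x J :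
  GLfun f x J = \sum_D (f D : K) * \sum_I coef D I J * (x I : K).
Proof.
rewrite /GLfun -[GLmap _]/(\val _) linear_sum /= sum_lfunE sum_ffunE.
by apply: eq_bigr => D _; rewrite lfunE /= ffunE diag_homE.
Qed.

Definition mcoef s t (f : OB K s t) (I : idx V s) (J : idx V t) : K :=
  \sum_D (f D : K) * coef D I J.

Lemma GLfunE s t (f : OB K s t) x J : GLfun f x J = \sum_I mcoef f I J * (x I : K).
Proof.
rewrite GLmapE; under eq_bigr => D _ do rewrite big_distrr /=.
rewrite exchange_big; apply: eq_bigr => I _ /=; rewrite big_distrl /=.
by apply: eq_bigr => D _; rewrite mulrA.
Qed.

Lemma mcoef_basis s t (D : obdiag s t) I J : mcoef (ob_basis K D) I J = coef D I J.
Proof.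
rewrite /mcoef (bigD1 D) //= ffunE eqxx mul1r big1 ?addr0 // => D' /negPf nD.
by rewrite ffunE nD mul0r.
Qed.

Lemma mcoef_sum s t (T : finType) (a : T -> K) (f : T -> OB K s t) I J :
  mcoef (\sum_i a i *: f i) I J = \sum_i a i * mcoef (f i) I J.
Proof.
rewrite /mcoef; under [RHS]eq_bigr => i _ do rewrite big_distrr /=.
rewrite exchange_big; apply: eq_bigr => D _ /=; rewrite sum_ffunE big_distrl /=.
by apply: eq_bigr => i _; rewrite ffunE mulrA.
Qed.

Lemma mcoef_sum2 s t (T T' : finType) (a : T -> T' -> K) (D : T -> T' -> obdiag s t) I J :
  mcoef (\sum_i \sum_j a i j *: ob_basis K (D i j)) I J =
  \sum_i \sum_j a i j * coef (D i j) I J.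
Proof.
under eq_bigr => i _ do rewrite -[\sum_j _]scale1r.
rewrite mcoef_sum; apply: eq_bigr => i _; rewrite mul1r mcoef_sum.
by apply: eq_bigr => j _; rewrite mcoef_basis.
Qed.

Lemma GLhom_ext s t (h h' : GLhom V s t) : (forall x, h x = h' x) -> h = h'.
Proof. by move=> E; apply: val_inj; apply/lfunP. Qed.

Lemma GLfun_basis s t (D : obdiag s t) : GLfun (ob_basis K D) = GLdiag D.
Proof.
apply: GLhom_ext => x; apply/ffunP => J; rewrite GLfunE diag_homE.
by apply: eq_bigr => I _; rewrite mcoef_basis.
Qed.

Lemma GLdiag_id s : GLdiag (id_diag s) = GLid V s.
Proof.
apply: GLhom_ext => x; apply/ffunP => J; rewrite diag_homE /= lfunE /= (bigD1 J) //=.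
rewrite coef_id eqxx mul1r big1 ?addr0 // => I /negPf nI.
by rewrite coef_id nI mul0r.
Qed.

Let delta : K := (sdim V)%:~R.

Lemma GLfun_id s : GLfun (ob_id K s) = GLid V s.
Proof. by rewrite GLfun_basis GLdiag_id. Qed.

Lemma GLfun_comp s t u (f : OB K t u) (g : OB K s t) :
  GLfun (ob_comp delta f g) = GLcomp (GLfun f) (GLfun g).
Proof.
apply: GLhom_ext => x; apply/ffunP => L; rewrite GLfunE /= lfunE /= GLfunE.
under [RHS]eq_bigr => J _ do rewrite GLfunE big_distrr /=.
rewrite exchange_big; apply: eq_bigr => I _ /=.
under [RHS]eq_bigr => J _ do rewrite mulrA.
rewrite -big_distrl /=; congr (_ * _).
rewrite mcoef_sum2 /mcoef.
under [RHS]eq_bigr => J _ do rewrite big_distrlr /=.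
rewrite [RHS]exchange_big; apply: eq_bigr => D1 _ /=.
rewrite [RHS]exchange_big; apply: eq_bigr => D2 _ /=.
transitivity ((f D1 : K) * (g D2 : K) * (delta ^+ loops D1 D2 * coef (comp_diag D1 D2) I
  L)).
  exact: (esym (mulrA _ _ _)).
rewrite /delta -coef_comp big_distrr /=; apply: eq_bigr => J _; ring.
Qed.

Definition OBfun : OBfunctor delta V :=
  {| Fmap := fun s t => (@GLfun s t : {linear OB K s t -> GLhom V s t});
     Fmap_id := GLfun_id; Fmap_comp := GLfun_comp |}.

Lemma OBfun_tensor : respects_tensor OBfun.
Proof.
move=> s1 t1 s2 t2 f g x y; apply/ffunP => J; rewrite ffunE !GLfunE.
rewrite big_distrlr /=.
rewrite -(sum_idx_cat (fun I1 I2 => (mcoef f I1 (lidx J) * (x I1 : K)) *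
  (mcoef g I2 (ridx J) * (y I2 : K)))).
apply: eq_bigr => I _; rewrite ffunE mulrACA; congr (_ * _).
rewrite mcoef_sum2 /mcoef big_distrlr /=.
by apply: eq_bigr => D1 _; apply: eq_bigr => D2 _; rewrite coef_tens mulrACA.
Qed.

(** * Homogeneous coordinates and the values on the generators *)

Notation n := (\dim (homog V false) + \dim (homog V true))%N.

Lemma hbasis_free : free (hbasis V).
Proof. exact: basis_free (hbasis_basis V). Qed.

Lemma coord_hbasis (i j : 'I_n) : coord (hbasis V) i (tnth (hbasis V) j) = (i == j)%:R.
Proof. by rewrite (tnth_nth 0) coord_free ?hbasis_free // eq_sym. Qed.

Lemma hbasis_expand (v : V) : v = \sum_(i < n) coord (hbasis V) i v *: tnth (hbasis V) i.
Proof.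
rewrite {1}(coord_basis (hbasis_basis V) (memvf v)).
by apply: eq_bigr => i _; rewrite (tnth_nth 0).
Qed.

(** The part of [v] along basis vectors of the other degree is also a difference of two elements of
    degree [a]. It lies in both homogeneous components, hence is 0, and freeness applies. *)
Lemma coord_homog a (v : V) (i : 'I_n) :
  v \in homog V a -> coord (hbasis V) i v != 0 -> deg i = a.
Proof.
move=> va; apply: contraNeq => ia; apply/eqP.
pose c (b : bool) (i : 'I_n) : K := if deg i == b then coord (hbasis V) i v else 0.
pose w b := \sum_(i < n) c b i *: tnth (hbasis V) i.
have wb b : w b \in homog V b.
  apply: memv_suml => j _; rewrite /c; case: eqP => [<-|_]; last by rewrite scale0r mem0v.
  by rewrite memvZ // hbasis_deg.
have Ev : v = w a + w (~~ a).
  rewrite {1}[v]hbasis_expand -big_split; apply: eq_bigr => j _ /=.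
  rewrite /c -scalerDl; congr (_ *: _).
  by case: (deg j); case: (a); rewrite /= ?addr0 ?add0r.
have w0 : w (~~ a) = 0.
  have : w (~~ a) \in (homog V false :&: homog V true)%VS.
    have wa : w (~~ a) \in homog V a.
      by rewrite (_ : w _ = v - w a) ?rpredB // Ev addrAC subrr add0r.
    by rewrite memv_cap; move: wa (wb (~~ a)); case: (a) => -> ->.
  by rewrite homog_cap memv0 => /eqP.
have H : \sum_(i < n) c (~~ a) i *: (hbasis V)`_i = 0.
  by rewrite -[RHS]w0; apply: eq_bigr => j _; rewrite (tnth_nth 0).
have /freeP/(_ _ H i) := hbasis_free; rewrite /c.
by move: ia; case: (deg i); case: (a).
Qed.

Lemma tmul_tinE a b (x : Vsign V a) (y : Vsign V b) (I : idx V [:: a; b]) :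
  tmul (tin a x) (tin b y) I = sign_coord (I i0) x * sign_coord (I i1) y.
Proof.
have E0 : lpos (s1 := [:: a]) [:: b] ord0 = i0 by exact: val_inj.
have E1 : rpos [:: a] (s2 := [:: b]) ord0 = i1 by exact: val_inj.
by rewrite !ffunE E0 E1.
Qed.

Lemma Fdiag_OBfun s t (D : obdiag s t) : Fdiag OBfun D = GLdiag D.
Proof. exact: GLfun_basis. Qed.

Lemma I_plus_id : I_plus = id_diag [:: true].
Proof.
pose z := @Ordinal 1 0 isT.
have /mate_arc[m0 m1] : (inr z, inl z) \in obarcs I_plus by rewrite /obarcs /= inE.
have [d0 d1] := @mate_id [:: true] z.
apply: mate_ext => -[] i; have -> : i = z by apply: val_inj; case: i => -[|[]].
  by rewrite m1 d0.
by rewrite m0 d1.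
Qed.

Lemma I_minus_id : I_minus = id_diag [:: false].
Proof.
pose z := @Ordinal 1 0 isT.
have /mate_arc[m0 m1] : (inl z, inr z) \in obarcs I_minus by rewrite /obarcs /= inE.
have [d0 d1] := @mate_id [:: false] z.
apply: mate_ext => -[] i; have -> : i = z by apply: val_inj; case: i => -[|[]].
  by rewrite m0 d0.
by rewrite m1 d1.
Qed.

Definition idx_nil : idx V [::] := ffun0 (card_ord 0).

Lemma dual_expand (w : dual V) (v : V) :
  w v = \sum_(i < n) coord (hbasis V) i v * w (tnth (hbasis V) i).
Proof. by rewrite {1}[v]hbasis_expand linear_sum; apply: eq_bigr => i _;
  rewrite linearZ. Qed.

Lemma sum_cap a b (c : 'I_n -> K) (x : 'I_n -> 'I_n -> K) :
  \sum_(I : idx V [:: a; b]) (c (I i0) *+ (I i0 == I i1)) * x (I i0) (I i1) =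
  \sum_i c i * x i i.
Proof.
rewrite sum_idx2; under eq_bigr => i _ do under eq_bigr => j _ do rewrite idx2_0 idx2_1.
exact: (sum_diag (fun i _ => c i) (x : 'I_n -> 'I_n -> K^o)).
Qed.

Lemma OBfun_generators : generator_values OBfun.
Proof.
split.
- by rewrite !Fdiag_OBfun I_plus_id I_minus_id !GLdiag_id.
- move=> a b v w va wb; rewrite Fdiag_OBfun; apply/ffunP => J; rewrite diag_homE.
  rewrite (bigD1 (idx2 true true (J i1) (J i0))) //= big1 => [|I nI]; last first.
    rewrite coef_X mulrb; case: ifP => [/andP[/eqP E0 /eqP E1]|_]; last by rewrite mul0r.
    by case/eqP: nI; rewrite E0 E1 idx2E.
  rewrite coef_X idx2_0 idx2_1 !eqxx mulr1n addr0 [RHS]ffunE !tmul_tinE idx2_0 idx2_1 /=.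
  (* The sign in [coef_X] involves degrees of basis vectors; where the coordinates of [v] and [w] do
     not vanish these are [a] and [b]. *)
  have [->|/(coord_homog va) ->] := eqVneq (coord (hbasis V) (J i1) v) 0.
    by rewrite mulr0 mul0r mulr0 scaler0.
  have [->|/(coord_homog wb) ->] := eqVneq (coord (hbasis V) (J i0) w) 0.
    by rewrite mul0r !mulr0 scaler0.
  by rewrite [coord _ _ v * _]mulrC.
- split; rewrite Fdiag_OBfun; apply/ffunP => J;
    rewrite diag_homE (sum_idx0 _ idx_nil) ffunE mulr1 sum_ffunE.
    rewrite coef_U_plus (bigD1 (J i0)) //= big1 => [|i nJ].
      by rewrite tmul_tinE /= lfunE /= !coord_hbasis eqxx mul1r addr0.
    by rewrite tmul_tinE /= coord_hbasis eq_sym (negPf nJ) mul0r.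
  rewrite coef_U_minus (bigD1 (J i0)) //= big1 => [|i nJ].
    rewrite ffunE tmul_tinE /= lfunE /= !coord_hbasis eqxx addr0 mul1r eq_sym.
    by case: eqP => _; rewrite ?mulr1n ?mulr0n ?scaler0 // [RHS]mulr1.
  rewrite ffunE tmul_tinE /= lfunE /= coord_hbasis (negPf nJ) mul0r; exact: scaler0.
- move=> w v; rewrite Fdiag_OBfun; apply/ffunP => J; rewrite diag_homE.
  pose x i j : K := (w (tnth (hbasis V) i) : K) * coord (hbasis V) j v.
  transitivity (\sum_(I : idx V [:: false; true]) (1 *+ (I i0 == I i1)) * x (I i0)
    (I i1)).
    by apply: eq_bigr => I _; rewrite coef_A_plus tmul_tinE.
  rewrite (sum_cap _ _ (fun=> 1) x) !ffunE dual_expand [RHS]mulr1; apply: eq_bigr => i _.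
  by rewrite mul1r [LHS]mulrC.
move=> a b v w va wb; rewrite Fdiag_OBfun; apply/ffunP => J; rewrite diag_homE.
pose x i j : K := coord (hbasis V) i v * (w (tnth (hbasis V) j) : K).
transitivity (\sum_(I : idx V [:: true; false])
    ((-1) ^+ deg (I i0) *+ (I i0 == I i1)) * x (I i0) (I i1)).
  by apply: eq_bigr => I _; rewrite coef_A_minus tmul_tinE.
rewrite (sum_cap _ _ (fun i => (-1) ^+ deg i) x) !ffunE [RHS]mulr1 dual_expand.
rewrite [RHS]big_distrr /=; apply: eq_bigr => i _; rewrite /x.
have [->|vi] := eqVneq (coord (hbasis V) i v) 0; first by rewrite !mul0r !mulr0.
have di := coord_homog va vi; rewrite di.
(* For different degrees [w] vanishes on the component containing [v], and both sides are 0. *)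
have [<-|nab] := eqVneq a b; first by rewrite andbb.
have -> : w (tnth (hbasis V) i) = 0; last by rewrite !mulr0.
apply: wb; have <- : a = ~~ b by move: nab; case: (a); case: (b).
by rewrite -di hbasis_deg.
Qed.

Lemma GLhom_basis_ext s t (h h' : GLhom V s t) :
  (forall I, h (tbasis I) = h' (tbasis I)) -> h = h'.
Proof.
move=> E; apply: GLhom_ext => x.
have -> : x = \sum_I (x I : K) *: tbasis I.
  apply/ffunP => J; rewrite sum_ffunE (bigD1 J) //= big1 ?addr0 => [|I nI].
    by rewrite !ffunE eqxx; exact: (esym (mulr1 _)).
  by rewrite !ffunE eq_sym (negPf nI); exact: mulr0.
by rewrite !linear_sum; apply: eq_bigr => I _; rewrite !linearZ /= E.
Qed.

Lemma tbasis_nil (I : idx V [::]) : tbasis I = tone V.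
Proof. by apply/ffunP => J; rewrite !ffunE (idx0_eq J I) eqxx. Qed.

Definition sign_basis e (i : 'I_n) : Vsign V e :=
  match e with true => tnth (hbasis V) i | false => dbasis i end.

(** Rewrites a coordinate vector as a pure tensor of homogeneous vectors, the form in which
    [generator_values] prescribes a functor. *)
Lemma tbasis_two a b (I : idx V [:: a; b]) :
  tbasis I = tmul (tin a (sign_basis a (I i0))) (tin b (sign_basis b (I i1))).
Proof.
have coordE e i j : sign_coord j (sign_basis e i) = (j == i)%:R.
  by case: e => /=; rewrite ?lfunE /= coord_hbasis // eq_sym.
apply/ffunP => J; rewrite tmul_tinE !coordE ffunE -natrM mulnb; congr (nat_of_bool _)%:R.
apply/eqP/andP => [->//|[/eqP E0 /eqP E1]]; apply/ffunP; exact: ord2P.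
Qed.

Lemma dbasis_homog (i : 'I_n) : homog_dual (deg i) (dbasis i).
Proof.
move=> v vi; rewrite lfunE /=; apply/eqP; apply: contraT => /(coord_homog vi).
by case: (deg i).
Qed.

Lemma ob_basisE s t (D D' : obdiag s t) : ob_basis K D D' = (D' == D)%:R.
Proof. by rewrite ffunE. Qed.

Lemma sum_basis (W : lmodType K) s t s' t' (D1 : obdiag s t) (D2 : obdiag s' t')
    (c : obdiag s t -> obdiag s' t' -> K) (F : obdiag s t -> obdiag s' t' -> W) :
  \sum_D \sum_D' ((ob_basis K D1 D : K) * (ob_basis K D2 D' : K) * c D D') *: F D D' =
  c D1 D2 *: F D1 D2.
Proof.
rewrite (bigD1 D1) //= [X in _ + X]big1 ?addr0 => [|D /negPf nD]; last first.
  by apply: big1 => D' _; rewrite ob_basisE nD !mul0r scale0r.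
rewrite (bigD1 D2) //= [X in _ + X]big1 ?addr0 => [|D /negPf nD]; last first.
  by rewrite (ob_basisE D2) nD mulr0 mul0r scale0r.
by rewrite !ob_basisE !eqxx !mul1r.
Qed.

Lemma ob_comp_basis s t u (D1 : obdiag t u) (D2 : obdiag s t) :
  loops D1 D2 = 0%N ->
  ob_comp delta (ob_basis K D1) (ob_basis K D2) = ob_basis K (comp_diag D1 D2).
Proof.
move=> l0; rewrite /ob_comp.
by rewrite (sum_basis D1 D2 (fun D D' => delta ^+ loops D D')) l0 expr0 scale1r.
Qed.

Lemma ob_tens_basis s1 t1 s2 t2 (D1 : obdiag s1 t1) (D2 : obdiag s2 t2) :
  ob_tens (ob_basis K D1) (ob_basis K D2) = ob_basis K (tens_diag D1 D2).
Proof.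
rewrite -[RHS]scale1r -(sum_basis D1 D2 (fun _ _ => 1)
  (fun D D' => ob_basis K (tens_diag D D'))).
by apply: eq_bigr => D _; apply: eq_bigr => D' _; rewrite mulr1.
Qed.

Lemma ob_expand s t (f : OB K s t) : f = \sum_D (f D : K) *: ob_basis K D.
Proof.
apply/ffunP => D; rewrite sum_ffunE (bigD1 D) //= big1 ?addr0 => [|D' nD].
  by rewrite !ffunE eqxx; exact: (esym (mulr1 _)).
by rewrite !ffunE eq_sym (negPf nD); exact: mulr0.
Qed.

(** * Uniqueness of the functor *)

Section Uniqueness.
Variables F F' : OBfunctor delta V.
Hypotheses (gF : generator_values F) (tF : respects_tensor F).
Hypotheses (gF' : generator_values F') (tF' : respects_tensor F').

Lemma Fdiag_unique s t (D : obdiag s t) : Fdiag F D = Fdiag F' D.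
Proof.
have [_ XF [UF UF'] AF AF'] := gF; have [_ XG [UG UG'] AG AG'] := gF'.
elim: {s t D}(all_generated D) => [s||||||s1 t1 s2 t2 D1 D2 _ IH1 _ IH2|s t u D1 D2 _
  IH1 _ IH2 l0].
- by rewrite /Fdiag -/(ob_id K s) !Fmap_id.
- apply: GLhom_basis_ext => I; rewrite tbasis_two /=.
  by rewrite (XF _ _ _ _ (hbasis_deg _) (hbasis_deg _))
    (XG _ _ _ _ (hbasis_deg _) (hbasis_deg _)).
- by apply: GLhom_basis_ext => I; rewrite tbasis_two /= AF AG.
- apply: GLhom_basis_ext => I; rewrite tbasis_two /=.
  by rewrite (AF' _ _ _ _ (hbasis_deg _) (@dbasis_homog _))
             (AG' _ _ _ _ (hbasis_deg _) (@dbasis_homog _)).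
- by apply: GLhom_basis_ext => I; rewrite tbasis_nil UF UG.
- by apply: GLhom_basis_ext => I; rewrite tbasis_nil UF' UG'.
- apply: GLhom_basis_ext => I; rewrite -tmul_basis /Fdiag -ob_tens_basis tF tF'.
  by rewrite -/(Fdiag F D1) -/(Fdiag F D2) IH1 IH2.
(* As there are no loops, the basis element of the composite is the composition of the two basis
   elements, with no power of $\delta$ to divide by. *)
rewrite /Fdiag -ob_comp_basis // !Fmap_comp.
by rewrite -/(Fdiag F D1) -/(Fdiag F D2) IH1 IH2.
Qed.

Lemma Fmap_unique s t (f : OB K s t) : Fmap F f = Fmap F' f.
Proof.
rewrite (ob_expand f) !linear_sum; apply: eq_bigr => D _; rewrite !linearZ.
by congr (_ *: _); exact: Fdiag_unique.
Qed.
End Uniqueness.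
End LinearMaps.

Theorem theorem5p11 (K : fieldType) (V : superspace K) :
  exists F : OBfunctor ((sdim V)%:~R : K) V,
    (generator_values F /\ respects_tensor F) /\
    forall F' : OBfunctor ((sdim V)%:~R : K) V,
      generator_values F' -> respects_tensor F' ->
      forall (s t : seq bool) (f : OB K s t), Fmap F' f = Fmap F f.
Proof.
exists (OBfun V); split; first by split; [exact: OBfun_generators | exact: OBfun_tensor].
by move=> F' gF' tF' s t f; apply: Fmap_unique => //;
  [exact: OBfun_generators | exact: OBfun_tensor].
Qed.
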